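(* Let $E\subseteq\mathbb{Z}$ and $1\le p<\infty$. (i) Suppose $p$ is an even integer. Then $L^p_E(\mathbb{T})$ has complex (resp. real) umap if and only if $E$ enjoys complex (resp. real) $(\mathcal{J}_{p/2})$. (ii) If $p$ is not an even integer and $L^p_E(\mathbb{T})$ has complex (resp. real) umap, then $E$ enjoys complex (resp. real) $(\mathcal{J}_\infty)$.
   Context: $\mathbb{T}=\{z\in\mathbb{C}:|z|=1\}$ with normalized Haar measure $m$; $L^p_E(\mathbb{T})$ is the space of $f\in L^p(\mathbb{T})$ with $\widehat f(n)=\int f(z)z^{-n}\,dm(z)=0$ for all $n\notin E$. Umap: let $\mathbb{S}=\mathbb{T}$ (complex case) or $\mathbb{S}=\{-1,1\}$ (real case). A separable Banach space $Y$ has complex (resp. real) umap (metric unconditional approximation property) if for every $\varepsilon>0$ there is a sequence $\{T_k\}_{k\ge1}$ of bounded finite-rank operators on $Y$ with $T_ky\to y$ for all $y\in Y$ such that, with $T_0=0$, $\|\sum_{k=1}^n\epsilon_k(T_k-T_{k-1})\|\le1+\varepsilon$ for all $n$ and all $\epsilon_k\in\mathbb{S}$. For $n\ge1$, $E$ enjoys complex (resp. real) $(\mathcal{J}_n)$ (block independence) if for all $m\ge1$, all $\zeta\in(\mathbb{Z}\setminus\{0\})^m$ with $\sum_{i=1}^m\zeta_i=0$ and $\sum_{i=1}^m|\zeta_i|\le2n$, all $1\le j\le m$ with $\zeta_1+\dots+\zeta_j$ nonzero (resp. odd), and all given $p_1,\dots,p_j\in E$, there is a finite $G\subseteq E$ such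 that $\zeta_1p_1+\dots+\zeta_mp_m\ne0$ for all $p_{j+1},\dots,p_m\in E\setminus G$. $E$ enjoys complex (resp. real) $(\mathcal{J}_\infty)$ if it enjoys complex (resp. real) $(\mathcal{J}_n)$ for all $n\ge1$. *)

(* Defs.v *)
From HB Require Import structures.
From mathcomp Require Import all_boot all_order all_algebra.
From mathcomp Require Import generic_quotient ring_quotient complex.
From mathcomp Require Import all_classical all_reals all_analysis.
From mathcomp Require Import measurable_realfun.

Set Implicit Arguments.
Unset Strict Implicit.
Unset Printing Implicit Defensive.
Import Order.TTheory GRing.Theory Num.Theory.
Import numFieldNormedType.Exports.
Local Open Scope classical_set_scope.
Local Open Scope ring_scope.
Local Open Scope complex_scope.

Local Notation Re := (@complex.Re _).
Local Notation Im := (@complex.Im _).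

Section unconditionality.
Context (K : numFieldType) (Y : normedModType K).

(* The operator norm of S is at most c. *)
Definition opnorm_le (S : Y -> Y) (c : K) : Prop :=
  forall y, `|S y| <= c * `|y|.

Definition bounded_op (S : Y -> Y) : Prop := exists c : K, opnorm_le S c.

Definition finite_rank (S : Y -> Y) : Prop :=
  exists (r : nat) (b : 'I_r -> Y), forall y, exists a : 'I_r -> K,
    S y = \sum_(i < r) a i *: b i.

(* When K is R[i], 0 < eps forces eps to be real.  The hypothesis on T starts at
   k = 1, T 0 = 0 being the convention used in the differences T k - T k.-1.
   The operators are K-linear also when the multipliers are the signs 1, -1. *)
Definition umap (S : set K) : Prop :=
  forall eps : K, 0 < eps ->
  exists T : nat -> {linear Y -> Y},
    [/\ forall y, T 0%N y = 0,
        forall k, (1 <= k)%N -> bounded_op (T k) /\ finite_rank (T k),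
        forall y, T k y @[k --> \oo] --> y
      & forall (n : nat) (e : nat -> K), (forall k, S (e k)) ->
          opnorm_le (fun y => \sum_(1 <= k < n.+1) e k *: (T k y - T k.-1 y))
            (1 + eps)].

Definition complex_umap : Prop := umap [set z | `|z| = 1].

Definition real_umap : Prop := umap [set 1; -1].

End unconditionality.

Section block_independence.

(* P is the condition on the partial sum zeta_1 + ... + zeta_j.  Indices start
   at 0, so the first j entries are those of index i < j; the values of p at
   the other indices are irrelevant.  The tuple q extends (p_1, ..., p_j) by
   p_{j+1}, ..., p_m. *)
Definition block_independent (P : int -> Prop) (E : set int) (n : nat) : Prop :=
  forall (m : nat) (zeta : 'I_m -> int),
    (1 <= m)%N -> (forall i, zeta i != 0) ->
    \sum_i zeta i = 0 -> (\sum_i `|zeta i| <= n.*2)%N ->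
  forall j : nat, (1 <= j <= m)%N -> P (\sum_(i < m | (i < j)%N) zeta i) ->
  forall p : 'I_m -> int, (forall i : 'I_m, (i < j)%N -> E (p i)) ->
  exists G : set int, [/\ finite_set G, G `<=` E &
    forall q : 'I_m -> int,
      (forall i : 'I_m, (i < j)%N -> q i = p i) ->
      (forall i : 'I_m, (j <= i)%N -> (E `\` G) (q i)) ->
      \sum_i zeta i * q i != 0].

Definition complex_J (E : set int) (n : nat) : Prop :=
  block_independent (fun s => s != 0) E n.

Definition real_J (E : set int) (n : nat) : Prop :=
  block_independent (fun s => odd `|s|%N) E n.

(* The property J for n = infinity. *)
Definition complex_Joo (E : set int) : Prop :=
  forall n, (1 <= n)%N -> complex_J E n.

Definition real_Joo (E : set int) : Prop :=
  forall n, (1 <= n)%N -> real_J E n.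

End block_independence.

Section complex_functions.
Context d (T : measurableType d) (R : realType).
Variable mu : {measure set T -> \bar R}.
Implicit Types f g : T -> R[i].

Definition cmeasurable f : Prop :=
  measurable_fun setT (fun x => Re (f x)) /\
  measurable_fun setT (fun x => Im (f x)).

Definition cintegral f : R[i] :=
  (\int[mu]_x Re (f x)) +i* (\int[mu]_x Im (f x)).

Definition cLnorm (p : R) f : \bar R :=
  'N[mu]_(p%:E)[EFin \o (fun x => Normc.normc (f x))]%E.

Lemma cReD (x y : R[i]) : Re (x + y) = Re x + Re y.
Proof. by case: x y => [? ?] [? ?]. Qed.

Lemma cImD (x y : R[i]) : Im (x + y) = Im x + Im y.
Proof. by case: x y => [? ?] [? ?]. Qed.

Lemma cReM (x y : R[i]) : Re (x * y) = Re x * Re y - Im x * Im y.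
Proof. by case: x y => [? ?] [? ?]. Qed.

Lemma cImM (x y : R[i]) : Im (x * y) = Re x * Im y + Im x * Re y.
Proof. by case: x y => [? ?] [? ?]. Qed.

Lemma normcE (x : R[i]) : Normc.normc x = Num.sqrt (Re x ^+ 2 + Im x ^+ 2).
Proof. by case: x. Qed.

Lemma normc_ge0 (x : R[i]) : 0 <= Normc.normc x.
Proof. by rewrite normcE sqrtr_ge0. Qed.

Lemma ler_Re_normc (x : R[i]) : `|Re x| <= Normc.normc x.
Proof. by rewrite normcE -sqrtr_sqr ler_wsqrtr// lerDl sqr_ge0. Qed.

Lemma ler_Im_normc (x : R[i]) : `|Im x| <= Normc.normc x.
Proof. by rewrite normcE -sqrtr_sqr ler_wsqrtr// lerDr sqr_ge0. Qed.

Lemma cmeasurableD f g :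
  cmeasurable f -> cmeasurable g -> cmeasurable (fun x => f x + g x).
Proof.
move=> [fr fi] [gr gi]; split.
- rewrite (_ : (fun _ => _) = (fun x => Re (f x)) \+ (fun x => Re (g x))).
    exact: measurable_funD.
  by apply/funext => x /=; rewrite cReD.
- rewrite (_ : (fun _ => _) = (fun x => Im (f x)) \+ (fun x => Im (g x))).
    exact: measurable_funD.
  by apply/funext => x /=; rewrite cImD.
Qed.

Lemma cmeasurableM f g :
  cmeasurable f -> cmeasurable g -> cmeasurable (fun x => f x * g x).
Proof.
move=> [fr fi] [gr gi]; split.
- rewrite (_ : (fun _ => _) = (fun x => Re (f x)) \* (fun x => Re (g x))
      \- (fun x => Im (f x)) \* (fun x => Im (g x))).
    by apply: measurable_funB; exact: measurable_funM.
  by apply/funext => x /=; rewrite cReM.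
- rewrite (_ : (fun _ => _) = (fun x => Re (f x)) \* (fun x => Im (g x))
      \+ (fun x => Im (f x)) \* (fun x => Re (g x))).
    by apply: measurable_funD; exact: measurable_funM.
  by apply/funext => x /=; rewrite cImM.
Qed.

Lemma cmeasurable_cst (c : R[i]) : cmeasurable (fun=> c).
Proof. by split; exact: measurable_cst. Qed.

Lemma measurable_normc f :
  cmeasurable f -> measurable_fun setT (fun x => Normc.normc (f x)).
Proof.
move=> [fr fi].
rewrite (_ : (fun _ => _) =
  Num.sqrt \o (fun x => Re (f x) ^+ 2 + Im (f x) ^+ 2)); last first.
  by apply/funext => x /=; rewrite normcE.
apply: measurableT_comp.
  by apply: continuous_measurable_fun; exact: sqrt_continuous.
by apply: measurable_funD; exact: measurable_funX.
Qed.

Lemma le_Lnorm (p : R) (f g : T -> R) : 1 <= p ->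
  measurable_fun setT f -> measurable_fun setT g ->
  (forall x, `|f x| <= `|g x|) ->
  ('N[mu]_(p%:E)[EFin \o f] <= 'N[mu]_(p%:E)[EFin \o g])%E.
Proof.
move=> p1 mf mg fg; have p0 : 0 < p by rewrite (lt_le_trans ltr01).
have mp (h : T -> R) : measurable_fun setT h ->
    measurable_fun setT (fun x => (`|h x| `^ p)%:E).
  move=> mh; apply/measurable_EFinP.
  by apply: (measurableT_comp (measurable_powR _)); exact: measurableT_comp.
rewrite unlock gt0_ler_poweR ?invr_ge0 ?(ltW p0)//.
- by rewrite in_itv/= leey andbT integral_ge0// => x _; rewrite poweR_ge0.
- by rewrite in_itv/= leey andbT integral_ge0// => x _; rewrite poweR_ge0.
- apply: ge0_le_integral => //=; first exact: mp.
  + exact: mp.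
  + move=> x _; suff : `|f x| `^ p <= `|g x| `^ p by rewrite -lee_fin.
    by rewrite ge0_ler_powR ?nnegrE// ltW.
Qed.

Lemma cLnormD (p : R) f g : 1 <= p -> cmeasurable f -> cmeasurable g ->
  (cLnorm p (fun x => f x + g x)%R <= cLnorm p f + cLnorm p g)%E.
Proof.
move=> p1 mf mg.
apply: le_trans; last first.
  by apply: (eminkowski mu (measurable_normc mf) (measurable_normc mg)).
apply: le_Lnorm => //; first exact/measurable_normc/cmeasurableD.
  by apply: measurable_funD; exact: measurable_normc.
move=> x /=; rewrite !ger0_norm ?addr_ge0 ?normc_ge0//.
exact: (le_normcD (f x) (g x)).
Qed.

Lemma cLnormZ (p : R) (c : R[i]) f : 1 <= p -> cmeasurable f ->
  (cLnorm p (fun x => c * f x)%R = (Normc.normc c)%:E * cLnorm p f)%E.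
Proof.
move=> p1 mf; have p0 : 0 < p by rewrite (lt_le_trans ltr01).
rewrite /cLnorm unlock.
under eq_integral do rewrite /= Normc.normcM normrM powRM// EFinM.
rewrite ge0_integralZl//.
  rewrite poweRM ?lee_fin ?powR_ge0 ?integral_ge0//.
  rewrite poweR_EFin -powRrM mulfV ?gt_eqF// powRr1 ?normr_ge0//.
  by rewrite ger0_norm// normc_ge0.
apply/measurable_EFinP.
apply: (measurableT_comp (measurable_powR _)); apply: measurableT_comp => //.
exact: measurable_normc.
Qed.

Lemma cLnorm_ae (p : R) f g : 1 <= p -> cmeasurable f -> cmeasurable g ->
  (\forall x \ae mu, f x = g x) -> cLnorm p f = cLnorm p g.
Proof.
move=> p1 mf mg fg.
have mp h : cmeasurable h ->
    measurable_fun setT (fun x => (`|Normc.normc (h x)| `^ p)%:E).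
  move=> mh; apply/measurable_EFinP.
  apply: (measurableT_comp (measurable_powR _)); apply: measurableT_comp => //.
  exact: measurable_normc.
rewrite /cLnorm unlock; congr poweR.
apply: ge0_ae_eq_integral => //=.
- exact: mp.
- exact: mp.
- by apply: filterS fg => x /= -> _.
Qed.

End complex_functions.

Section Lebesgue_space.
Context d (T : measurableType d) (R : realType).
Variables (mu : {measure set T -> \bar R}) (p : R).

(* Functions with finite p-norm, before identification up to null sets. *)
Definition cLfun of 1 <= p : {pred T -> R[i]} := fun f =>
  `[< cmeasurable f /\ (cLnorm mu p f < +oo)%E >].

Variable p1 : 1 <= p.

Lemma cLfun_submod_closed : submod_closed (cLfun p1).
Proof.
split.
  apply/asboolP; split; first exact: cmeasurable_cst.
  rewrite /cLnorm (_ : EFin \o _ = cst 0%E); last first.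
    by apply/funext => x /=; exact: (congr1 EFin (@Normc.normc0 R)).
  by rewrite Lnorm0// gt_eqF// lte_fin (lt_le_trans ltr01).
move=> c f g /asboolP[mf lf] /asboolP[mg lg]; apply/asboolP.
have mcf : cmeasurable (fun x => c * f x).
  by apply: cmeasurableM => //; exact: cmeasurable_cst.
split; first exact: (cmeasurableD mcf mg).
apply: (le_lt_trans (cLnormD mu p1 mcf mg)).
rewrite lte_add_pinfty// cLnormZ// lte_mul_pinfty// ?lee_fin ?normc_ge0//.
Qed.

HB.instance Definition _ :=
  GRing.isSubmodClosed.Build _ _ (cLfun p1) cLfun_submod_closed.

Definition cLfunType := {f : T -> R[i] | f \in cLfun p1}.
HB.instance Definition _ := SubChoice.on cLfunType.
HB.instance Definition _ := [SubChoice_isSubLmodule of cLfunType by <:].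

Definition ae_null : {pred cLfunType} := fun f =>
  `[< \forall x \ae mu, val f x = 0 >].

Lemma ae_null_zmod_closed : zmod_closed ae_null.
Proof.
split; first by apply/asboolP; exact: aeW.
move=> f g /asboolP nf /asboolP ng; apply/asboolP.
by apply: filterS2 nf ng => x fx gx; rewrite -[LHS]/(val f x - val g x) fx gx subrr.
Qed.

HB.instance Definition _ :=
  GRing.isZmodClosed.Build _ ae_null ae_null_zmod_closed.

(* Almost everywhere equality is equality modulo ae_null. *)
Definition Lp : Type := Quotient.quot ae_null.
HB.instance Definition _ := GRing.Zmodule.on Lp.

Definition Lp_class (f : cLfunType) : Lp := \pi_(Quotient.quot ae_null)%qT f.

Definition Lp_repr (u : Lp) : cLfunType := repr (u : Quotient.quot ae_null).

Definition Lp_fun (u : Lp) : T -> R[i] := val (Lp_repr u).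

Lemma Lp_reprK u : Lp_class (Lp_repr u) = u.
Proof. exact: reprK. Qed.

Lemma Lp_classP f g :
  Lp_class f = Lp_class g <-> \forall x \ae mu, val f x = val g x.
Proof.
have -> : (Lp_class f = Lp_class g) <-> f - g \in ae_null.
  by rewrite Quotient.idealrBE; split=> [/eqP//|/eqP].
split=> [/asboolP fg|fg].
  apply: filterS fg => x; rewrite -[X in X = _]/(val f x - val g x).
  by move=> /eqP; rewrite subr_eq0 => /eqP.
apply/asboolP; apply: filterS fg => x fgx.
by rewrite -[LHS]/(val f x - val g x) fgx subrr.
Qed.

Lemma Lp_fun_class f : \forall x \ae mu, Lp_fun (Lp_class f) x = val f x.
Proof. by apply/Lp_classP; rewrite Lp_reprK. Qed.

Lemma Lp_classD f g : Lp_class (f + g) = Lp_class f + Lp_class g.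
Proof. exact: (Quotient.pi_add ae_null f g). Qed.

Lemma Lp_class0 : Lp_class 0 = 0.
Proof. by apply: (addrI (Lp_class 0)); rewrite -Lp_classD !addr0. Qed.

Definition Lp_scale (c : R[i]) (u : Lp) : Lp := Lp_class (c *: Lp_repr u).

Lemma Lp_classZ c f : Lp_class (c *: f) = Lp_scale c (Lp_class f).
Proof.
apply/Lp_classP; apply: filterS (Lp_fun_class f) => x fx.
exact: (congr1 (fun y => c * y) (esym fx)).
Qed.

Lemma Lp_scaleA a b u : Lp_scale a (Lp_scale b u) = Lp_scale (a * b) u.
Proof. by rewrite -[u]Lp_reprK -!Lp_classZ scalerA. Qed.

Lemma Lp_scale1 : left_id 1 Lp_scale.
Proof. by move=> u; rewrite -[u]Lp_reprK -!Lp_classZ scale1r. Qed.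

Lemma Lp_scaleDr : right_distributive Lp_scale +%R.
Proof.
move=> a u v; rewrite -[u]Lp_reprK -[v]Lp_reprK.
by rewrite -Lp_classD -!Lp_classZ -Lp_classD scalerDr.
Qed.

Lemma Lp_scaleDl u : {morph Lp_scale^~ u : a b / a + b}.
Proof.
by move=> a b; rewrite -[u]Lp_reprK -!Lp_classZ -Lp_classD scalerDl.
Qed.

HB.instance Definition _ := GRing.Zmodule_isLmodule.Build R[i] Lp
  Lp_scaleA Lp_scale1 Lp_scaleDr Lp_scaleDl.

(* In a normedModType R[i] the norm takes its values in R[i]. *)
Definition Lp_norm (u : Lp) : R[i] := (fine (cLnorm mu p (Lp_fun u)))%:C.

Lemma cLfun_measurable (f : cLfunType) : cmeasurable (val f).
Proof. by case: f => f /= /asboolP[]. Qed.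

Lemma cLnorm_fine (f : cLfunType) :
  (fine (cLnorm mu p (val f)))%:E = cLnorm mu p (val f).
Proof.
rewrite fineK// ge0_fin_numE; first by case: f => f /= /asboolP[].
exact: Lnorm_ge0.
Qed.

Lemma Lp_norm_class f : Lp_norm (Lp_class f) = (fine (cLnorm mu p (val f)))%:C.
Proof.
congr (fine _)%:C; apply: cLnorm_ae p1 _ _ _; [exact: cLfun_measurable..|].
exact: Lp_fun_class.
Qed.

Lemma ler_Lp_normD u v : Lp_norm (u + v) <= Lp_norm u + Lp_norm v.
Proof.
rewrite -[u]Lp_reprK -[v]Lp_reprK -Lp_classD !Lp_norm_class.
rewrite -(rmorphD (real_complex R)) lecR -lee_fin EFinD !cLnorm_fine.
exact: (cLnormD mu p1 (cLfun_measurable (Lp_repr u)) (cLfun_measurable _)).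
Qed.

Lemma Lp_normZ c u : Lp_norm (c *: u) = `|c| * Lp_norm u.
Proof.
rewrite -[u]Lp_reprK -[_ *: _]Lp_classZ !Lp_norm_class.
rewrite (_ : `|c| = (Normc.normc c)%:C)// -(rmorphM (real_complex R)); congr (_ %:C).
apply: EFin_inj; rewrite EFinM !cLnorm_fine.
exact: (cLnormZ mu c p1 (cLfun_measurable (Lp_repr u))).
Qed.

Lemma Lp_norm_eq0 u : Lp_norm u = 0 -> u = 0.
Proof.
rewrite -[u]Lp_reprK Lp_norm_class => /complexI nf0.
rewrite -[0]Lp_reprK; apply/Lp_classP.
have mf := cLfun_measurable (Lp_repr u).
have : cLnorm mu p (val (Lp_repr u)) = 0%E by rewrite -cLnorm_fine nf0.
move=> /Lnorm_eq0_eq0 f0.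
have {}f0 : (EFin \o (fun x => Normc.normc (val (Lp_repr u) x)))%E
    = \0%E %[ae mu].
  apply: f0; first by apply/measurable_EFinP; exact: measurable_normc.
  by rewrite lte_fin (lt_le_trans ltr01).
have /Lp_classP z0 : Lp_class (Lp_repr 0) = Lp_class 0.
  by rewrite Lp_reprK Lp_class0.
apply: filterS2 f0 z0 => x /(_ I)/= [fx] ->.
exact: (Normc.eq0_normc fx).
Qed.

HB.instance Definition _ := Lmodule_isNormed.Build R[i] Lp
  ler_Lp_normD Lp_normZ Lp_norm_eq0.

End Lebesgue_space.

Section circle.
Variable R : realType.

Definition circle := {z : R[i] | `|z| == 1}.

Lemma circle_exp_subproof (t : R) :
  `|cos (2 * pi * t) +i* sin (2 * pi * t)| == 1 :> R[i].
Proof.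
by apply/eqP; rewrite normc_def/= cos2Dsin2 sqrtr1.
Qed.

Definition circle_exp (t : R) : circle :=
  exist (fun z : R[i] => `|z| == 1) _ (circle_exp_subproof t).

Definition circle_coord (z : circle) : measurableTypeR R * measurableTypeR R :=
  (Re (val z), Im (val z)).

HB.instance Definition _ := Choice.on circle.
HB.instance Definition _ := isPointed.Build circle (circle_exp 0).

Definition circle_display : measure_display.
Proof. exact: (preimage_display circle_coord). Qed.

(* The Borel sets of the circle as a subset of the plane. *)
Definition circle_measurable : set (set circle) :=
  g_sigma_algebra_preimage circle_coord.

Lemma circle_measurable0 : circle_measurable set0.
Proof. exact: (@measurable0 _ (g_sigma_algebra_preimageType circle_coord)). Qed.

Lemma circle_measurableC A : circle_measurable A -> circle_measurable (~` A).
Proof. exact: (@measurableC _ (g_sigma_algebra_preimageType circle_coord)). Qed.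

Lemma circle_measurable_bigcup (F : (set circle)^nat) :
  (forall i, circle_measurable (F i)) -> circle_measurable (\bigcup_i F i).
Proof.
by move=> mF; apply: (@bigcup_measurable _
  (g_sigma_algebra_preimageType circle_coord)) => i _; exact: mF.
Qed.

HB.instance Definition _ := @isMeasurable.Build circle_display circle
  circle_measurable circle_measurable0 circle_measurableC
  circle_measurable_bigcup.

Lemma measurable_circle_coord : measurable_fun [set: circle] circle_coord.
Proof. by move=> _ B mB; exists B. Qed.

Lemma measurable_circle_exp :
  measurable_fun [set: measurableTypeR R] circle_exp.
Proof.
move=> _ _ [B mB <-]; rewrite !setTI.
have m2 : measurable_fun [set: measurableTypeR R] (fun t : R => 2 * pi * t).
  exact: measurable_funM.
have : measurable_fun [set: measurableTypeR R] (circle_coord \o circle_exp).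
  apply/measurable_fun_pairP; split; apply: measurableT_comp m2;
    apply: continuous_measurable_fun.
  - exact: continuous_cos.
  - exact: continuous_sin.
by move=> /(_ measurableT _ mB); rewrite setTI.
Qed.

Definition circle_exp_mfun : {mfun measurableTypeR R >-> circle} :=
  HB.pack circle_exp (@isMeasurableFun.Build _ _ (measurableTypeR R) circle
    circle_exp measurable_circle_exp).

(* Normalized Haar measure is the image of the uniform law on [0, 1] under
   t |-> exp(2 i pi t). *)
Definition haar : probability circle R :=
  distribution (uniform_prob (@ltr01 R)) circle_exp_mfun.

Definition fourier_coef (f : circle -> R[i]) (n : int) : R[i] :=
  cintegral haar (fun z => f z * val z ^ (- n)).

Variables (p : R) (p1 : 1 <= p).

Lemma cmeasurable_circle_pow (n : int) :
  cmeasurable (fun z : circle => val z ^ n).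
Proof.
have mz : cmeasurable (fun z : circle => val z).
  have /measurable_fun_pairP[] := measurable_circle_coord.
  by split.
have mzb : cmeasurable (fun z : circle => (val z)^-1).
  have zE (z : circle) : (val z)^-1 = (Re (val z)) -i* (Im (val z)).
    have /eqP := valP z; case: (val z) => a b.
    rewrite normc_def/= => -[] /(congr1 (fun x => x ^+ 2)).
    rewrite sqr_sqrtr ?addr_ge0 ?sqr_ge0// expr1n => ab1.
    by congr (_ +i* _); rewrite ab1 divr1.
  split.
  - by under eq_fun do rewrite zE/=; exact: mz.1.
  - by under eq_fun do rewrite zE/=; apply: measurable_funN; exact: mz.2.
have mX (f : circle -> R[i]) k :
    cmeasurable f -> cmeasurable (fun z => f z ^+ k).
  move=> mf; elim: k => [|k ih]; first exact: cmeasurable_cst.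
  by under eq_fun do rewrite exprS; exact: cmeasurableM.
case: n => k; first exact: mX.
by under eq_fun do rewrite NegzE -exprnN -exprVn; exact: mX.
Qed.

Lemma normc_circle_pow (z : circle) (n : int) : Normc.normc (val z ^ n) = 1.
Proof.
apply: complexI; rewrite -[LHS]/(`|val z ^ n|).
have /eqP z1 := valP z.
case: n => k; first by rewrite -exprnP normrX z1 expr1n.
by rewrite NegzE -exprnN normrV ?normrX ?z1 ?expr1n ?invr1// unitfE
  expf_neq0// -normr_eq0 z1 oner_neq0.
Qed.

Lemma cLfun_integrable (f : cLfunType haar p1) (n : int) :
  haar.-integrable setT
    (EFin \o (fun z => Re (val f z * val z ^ n))) /\
  haar.-integrable setT
    (EFin \o (fun z => Im (val f z * val z ^ n))).
Proof.
have mf := cLfun_measurable f.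
have mfz := cmeasurableM mf (cmeasurable_circle_pow n).
have intf : haar.-integrable setT (EFin \o (fun z => Normc.normc (val f z))).
  apply/Lfun1_integrable.
  have pE : (1 <= p%:E)%E by rewrite lee_fin.
  apply: (Lfun_subset (lexx 1%E) pE) => //; first exact: fin_num_measure.
  apply/andP; split; rewrite inE/=; first exact: measurable_normc.
  by case: f {mf mfz} => f /= /asboolP[].
have nE z : Normc.normc (val f z) = Normc.normc (val f z * val z ^ n).
  by rewrite Normc.normcM normc_circle_pow mulr1.
split; apply: le_integrable intf => //.
- by apply/measurable_EFinP; exact: mfz.1.
- move=> z _; rewrite lee_fin [leRHS]ger0_norm ?normc_ge0// nE.
  exact: ler_Re_normc.
- by apply/measurable_EFinP; exact: mfz.2.
- move=> z _; rewrite lee_fin [leRHS]ger0_norm ?normc_ge0// nE.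
  exact: ler_Im_normc.
Qed.

Lemma fourier_coefP (c : R[i]) (f g : cLfunType haar p1) n :
  fourier_coef (val (c *: f + g)) n =
  c * fourier_coef (val f) n + fourier_coef (val g) n.
Proof.
have [fr fi] := cLfun_integrable f (- n).
have [gr gi] := cLfun_integrable g (- n).
have eqE z : val (c *: f + g) z * val z ^ (- n) =
    c * (val f z * val z ^ (- n)) + val g z * val z ^ (- n).
  by rewrite -[val (c *: f + g) z]/(c * val f z + val g z) mulrDl mulrA.
have ZI (r : R) (h : circle -> R) : haar.-integrable setT (EFin \o h) ->
    haar.-integrable setT (EFin \o (fun z => r * h z)).
  by move=> ih; exact: (integrableZl measurableT r ih).
have BI (h k : circle -> R) : haar.-integrable setT (EFin \o h) ->
    haar.-integrable setT (EFin \o k) ->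
    haar.-integrable setT (EFin \o (fun z => h z - k z)).
  by move=> ih ik; exact: (integrableB measurableT ih ik).
have DI (h k : circle -> R) : haar.-integrable setT (EFin \o h) ->
    haar.-integrable setT (EFin \o k) ->
    haar.-integrable setT (EFin \o (fun z => h z + k z)).
  by move=> ih ik; exact: (integrableD measurableT ih ik).
set F := fun z => val f z * val z ^ (- n) in fr fi eqE.
set G := fun z => val g z * val z ^ (- n) in gr gi eqE.
rewrite /fourier_coef /cintegral -/F -/G.
have -> : \int[haar]_z Re (val (c *: f + g) z * val z ^ (- n)) =
    \int[haar]_z (Re c * Re (F z) - Im c * Im (F z) + Re (G z)).
  apply: eq_Rintegral => z _; rewrite eqE cReD; congr (_ + _); exact: cReM.
have -> : \int[haar]_z Im (val (c *: f + g) z * val z ^ (- n)) =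
    \int[haar]_z (Re c * Im (F z) + Im c * Re (F z) + Im (G z)).
  by apply: eq_Rintegral => z _; rewrite eqE cImD; congr (_ + _); exact: cImM.
rewrite RintegralD//; last by apply: BI; exact: ZI.
rewrite RintegralB//; [|exact: ZI..].
rewrite RintegralD//; last by apply: DI; exact: ZI.
rewrite RintegralD//; [|exact: ZI..].
rewrite !RintegralZl//.
by case: (c) => a b.
Qed.

Lemma fourier_coef_class (f : cLfunType haar p1) n :
  fourier_coef (Lp_fun (Lp_class f)) n = fourier_coef (val f) n.
Proof.
have [fr fi] := cLfun_integrable f (- n).
have [gr gi] := cLfun_integrable (Lp_repr (Lp_class f)) (- n).
rewrite /fourier_coef /cintegral; congr (_ +i* _); congr fine;
  apply: ae_eq_integral => //.
- exact: measurable_int gr.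
- exact: measurable_int fr.
- by apply: filterS (Lp_fun_class f) => z /= -> _.
- exact: measurable_int gi.
- exact: measurable_int fi.
- by apply: filterS (Lp_fun_class f) => z /= -> _.
Qed.

Variable E : set int.

(* Fourier coefficients do not depend on the chosen representative: see
   fourier_coef_class. *)
Definition spectrum_in : {pred Lp haar p1} := fun f =>
  `[< forall n : int, ~ E n -> fourier_coef (Lp_fun f) n = 0 >].

Lemma spectrum_in_submod_closed : submod_closed spectrum_in.
Proof.
split.
  apply/asboolP => n _; rewrite -Lp_class0 fourier_coef_class.
  have := fourier_coefP 0 0 0 n; rewrite scale0r addr0 mul0r add0r.
  set x := fourier_coef _ _; move=> _.
  have := fourier_coefP 1 0 0 n; rewrite scale1r addr0 mul1r -/x.
  by move=> /esym /eqP; rewrite -[X in _ == X]addr0 (inj_eq (addrI _)) => /eqP.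
move=> c u v /asboolP uE /asboolP vE; apply/asboolP => n En.
rewrite -[u]Lp_reprK -[v]Lp_reprK -[_ *: _]Lp_classZ -Lp_classD.
by rewrite fourier_coef_class fourier_coefP [X in c * X]uE// [X in _ + X]vE// mulr0 addr0.
Qed.

HB.instance Definition _ :=
  GRing.isSubmodClosed.Build _ _ spectrum_in spectrum_in_submod_closed.

Definition LpE := {f : Lp haar p1 | f \in spectrum_in}.
HB.instance Definition _ := SubChoice.on LpE.
HB.instance Definition _ := [SubChoice_isSubLmodule of LpE by <:].

Definition LpE_norm (f : LpE) : R[i] := `|val f|.

Lemma ler_LpE_normD f g : LpE_norm (f + g) <= LpE_norm f + LpE_norm g.
Proof. exact: (ler_normD (val f) (val g)). Qed.

Lemma LpE_normZ c f : LpE_norm (c *: f) = `|c| * LpE_norm f.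
Proof. exact: (normrZ c (val f)). Qed.

Lemma LpE_norm_eq0 f : LpE_norm f = 0 -> f = 0.
Proof. by move=> /normr0_eq0 f0; apply: val_inj. Qed.

HB.instance Definition _ := Lmodule_isNormed.Build R[i] LpE
  ler_LpE_normD LpE_normZ LpE_norm_eq0.

End circle.

(* Main.v *)
(* Necessity.  For unimodular theta_0 = 1, theta_1, ..., theta_m average
   |1 + r sum_(i >= 1) w_i theta_i|^p over torus points w_i against the character
   prod_i w_i^(- zeta_i).  The leading term in r is
   c r^(u+v) prod_i theta_i^zeta_i, where c is a positive multiple of
   binom(p/2, u) binom(p/2, v) and u, v <= n are the positive and negative
   masses of the remaining zeta_i; c <> 0 unless p/2 is a natural number smaller
   than max(u, v).  If zeta_1 q_1 + ... + zeta_m q_m = 0 then the monomials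
   theta_i = z^(q_i) satisfy prod_i theta_i^zeta_i = 1, so multiplying all
   but the first j coefficients by mu with mu^(zeta_1 + ... + zeta_j) <> 1
   changes some L^p norm by a fixed amount.  On the other hand umap provides a
   finite-rank T, almost fixing the first j characters, with T + mu (1 - T)
   almost contractive, and a bounded finite-rank operator is small on all but
   finitely many characters; so q_(j+1), ..., q_m cannot all be far away.

   Sufficiency, p = 2n.  Expanding |f|^(2n) shows that
   ||a + lambda b|| = ||a + b|| exactly, when the spectra of a and b are
   separated by a large gap.  Averaging many cutoffs T_i, successively separated
   by such gaps, gives an operator T for which T + lambda (1 - T) is almost
   contractive: the average of the T_(i+1) y + lambda (y - T_(i+2) y) has norm
   at most that of y up to the mean of ||(T_(i+2) - T_(i+1)) y||, and by
   Clarkson's inequality the sum of the 2n-th powers of these is bounded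
   independently of the number of cutoffs.  For nested cutoffs,
   sum_k e_k (T_k - T_(k-1)) is a product of operators T_k + mu_k (1 - T_k). *)
Require Import Defs.
From HB Require Import structures.
From mathcomp Require Import all_boot all_order all_algebra.
From mathcomp Require Import generic_quotient ring_quotient complex.
From mathcomp Require Import all_classical all_reals all_analysis.
From mathcomp Require Import measurable_realfun.
From mathcomp Require Import ring lra zify finmap.

Set Implicit Arguments.
Unset Strict Implicit.
Unset Printing Implicit Defensive.
Import Order.TTheory GRing.Theory Num.Theory.
Import numFieldNormedType.Exports.
Local Open Scope classical_set_scope.
Local Open Scope ring_scope.

Local Notation Re := (@complex.Re _).
Local Notation Im := (@complex.Im _).
Local Notation normc := (@Normc.normc _).
Local Notation "x %:C" := (x%:C)%C : ring_scope.

(** * Norms *)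

(** Both cases are one argument about a set S of unimodular multipliers and a predicate P on
    integers. Necessity uses that each s with P s has some mu in S with mu^s <> 1; sufficiency uses
    that mu^s = 1 on S when P s fails.

    Since the zeta_i sum to 0 and have total mass at most 2n, their positive and negative masses are
    equal and at most n. For p = 2n this is the range in which binom(n, k) does not vanish.

    Torus averages are taken over a finite grid of roots of unity: |1 + h|^p is first replaced by a
    polynomial, at the price of an error of higher order in r, and for bounded degree the grid
    average is exact. The resulting coefficients and lower bound do not depend on q, so that the
    finite set G can be chosen before q.

    The norm identities of the sufficiency part hold for trigonometric polynomials, hence the need
    for density. The approximants must keep their spectrum in E and the cutoffs must have norm close
    to 1; Fejer multipliers provide both. *)

Section normc.
Variable R : rcfType.
Implicit Types x y : R[i].

Lemma norm_normc x : `|x| = (normc x)%:C.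
Proof. by []. Qed.

(* The library states normcD and normcN for Rcomplex R, whose operations are not
   syntactically those of R[i]. *)
Lemma normcD x y : normc (x + y) <= normc x + normc y.
Proof. exact: le_normcD. Qed.

Lemma normcN x : normc (- x) = normc x.
Proof. by apply: complexI; rewrite -!norm_normc normrN. Qed.

Lemma normcB x y : normc (x - y) <= normc x + normc y.
Proof. by rewrite -[in leRHS](normcN y) normcD. Qed.

Lemma normcX x n : normc (x ^+ n) = normc x ^+ n.
Proof. by apply: complexI; rewrite rmorphXn -!norm_normc normrX. Qed.

Lemma normc_real (r : R) : normc r%:C = `|r|.
Proof. by rewrite /= expr0n/= addr0 sqrtr_sqr. Qed.

Lemma normc_sum (I : Type) (s : seq I) (P : pred I) (F : I -> R[i]) :
  normc (\sum_(i <- s | P i) F i) <= \sum_(i <- s | P i) normc (F i).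
Proof.
elim/big_ind2 : _ => [|x a y b xa yb|//]; first by rewrite Normc.normc0.
exact: le_trans (normcD _ _) (lerD xa yb).
Qed.

Lemma normc_eq0 x : (normc x == 0) = (x == 0).
Proof. by apply/eqP/eqP => [/Normc.eq0_normc//|->]; rewrite Normc.normc0. Qed.

Lemma normc_sqr x : normc x ^+ 2 = Re x ^+ 2 + Im x ^+ 2.
Proof. by case: x => a b; rewrite sqr_sqrtr// addr_ge0 ?sqr_ge0. Qed.

Lemma unimodularV x : `|x| = 1 -> x^-1 = x^*.
Proof. by move=> x1; rewrite invC_norm x1 expr1n invr1 mul1r. Qed.

Lemma unimodularVc x : `|x| = 1 -> x^-1 = conjc x.
Proof. exact: unimodularV. Qed.

End normc.

Section nrm.
Variables (R : realType) (V : normedModType R[i]).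
Implicit Types (u v : V) (c : R[i]).

(* The norm of a normedModType R[i] is complex-valued; nrm is its real value. *)
Definition nrm v : R := Re `|v|.

Lemma normE v : `|v| = (nrm v)%:C.
Proof.
rewrite /nrm; have := normr_ge0 v; case: `|v| => a b.
by rewrite lecE/= => /andP[/eqP -> _].
Qed.

Lemma nrm_ge0 v : 0 <= nrm v.
Proof. by rewrite -lecR -normE normr_ge0. Qed.

Lemma nrmD u v : nrm (u + v) <= nrm u + nrm v.
Proof. by rewrite -lecR rmorphD/= -!normE ler_normD. Qed.

Lemma nrmZ c v : nrm (c *: v) = normc c * nrm v.
Proof. by apply: complexI; rewrite rmorphM/= -!normE normrZ. Qed.

Lemma nrmN v : nrm (- v) = nrm v.
Proof. by rewrite /nrm normrN. Qed.

Lemma nrm0 : nrm 0 = 0.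
Proof. by rewrite /nrm normr0. Qed.

Lemma nrmB u v : nrm (u - v) <= nrm u + nrm v.
Proof. by rewrite -[in leRHS](nrmN v) nrmD. Qed.

Lemma nrmBC u v : nrm (u - v) = nrm (v - u).
Proof. by rewrite -nrmN opprB. Qed.

Lemma nrm0_eq0 v : nrm v = 0 -> v = 0.
Proof. by move=> v0; apply: normr0_eq0; rewrite normE v0. Qed.

Lemma nrm_sum (I : Type) (s : seq I) (P : pred I) (F : I -> V) :
  nrm (\sum_(i <- s | P i) F i) <= \sum_(i <- s | P i) nrm (F i).
Proof.
elim/big_ind2 : _ => [|x a y b xa yb|//]; first by rewrite nrm0.
exact: le_trans (nrmD _ _) (lerD xa yb).
Qed.

Lemma nrm_dist u v : `|nrm u - nrm v| <= nrm (u - v).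
Proof.
rewrite ler_norml; have := nrmD (u - v) v; have := nrmD (v - u) u.
by rewrite !subrK -(nrmBC u v) => ? ?; apply/andP; split; lra.
Qed.

Lemma cvg_nrm (T : nat -> V) l :
  (T k @[k --> \oo] --> l) <->
  forall e : R, 0 < e -> exists K, forall k, (K <= k)%N -> nrm (l - T k) < e.
Proof.
split=> [/cvgrPdist_lt Tl e e0|Tl].
  have /Tl[K _ KT] : 0 < e%:C by rewrite ltcR.
  by exists K => k Kk; have := KT k Kk; rewrite /= normE ltcR.
apply/cvgrPdist_lt => -[e f]; rewrite ltcE/= => /andP[/eqP f0 e0].
have [K KT] := Tl e e0; exists K => // k /= Kk.
by rewrite f0 normE ltcR; exact: KT.
Qed.

End nrm.

(** * The circle and its characters *)

Section circle_integrals.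
Variable R : realType.
Notation haar := (haar R).

Lemma haar_integralE (g : circle R -> R) : measurable_fun setT g ->
  (forall z, 0 <= g z) ->
  (\int[haar]_z (g z)%:E =
   \int[lebesgue_measure]_(t in `[0%R, 1%R]) (g (circle_exp t))%:E)%E.
Proof.
move=> mg g0; rewrite ge0_integral_distribution//; last first.
  exact/measurable_EFinP.
rewrite (@integral_uniform R 0 1 ltr01) ?subr0 ?invr1 ?mul1e//.
- apply/measurable_EFinP.
  exact: (measurableT_comp mg (@measurable_circle_exp R)).
- by move=> z; rewrite lee_fin.
Qed.

Lemma circle_expX (t : R) (n : int) :
  val (circle_exp t) ^ n =
  (cos (2 * pi * n%:~R * t) +i* sin (2 * pi * n%:~R * t))%C.
Proof.
have X (k : nat) : val (circle_exp t) ^+ k =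
    (cos (2 * pi * k%:R * t) +i* sin (2 * pi * k%:R * t))%C.
  elim: k => [|k ih]; first by rewrite expr0 mulr0 mul0r cos0 sin0.
  rewrite exprS ih.
  have -> : 2 * pi * k.+1%:R * t = 2 * pi * t + 2 * pi * k%:R * t :> R.
    by rewrite -natr1; ring.
  rewrite cosD sinD; apply/eqP; rewrite eq_complex/= eqxx/=.
  by apply/eqP; ring.
case: n => k; first exact: X.
rewrite NegzE -exprnN unimodularV; last by rewrite normrX (eqP (valP (circle_exp t))) expr1n.
rewrite X mulrNz mulrN mulNr cosN sinN.
by rewrite -[LHS]/(conjc _).
Qed.

Lemma bounded_haar_integrable (g : circle R -> R) (M : R) :
  measurable_fun setT g -> (forall z, `|g z| <= M) ->
  haar.-integrable setT (EFin \o g).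
Proof.
move=> mg gM; apply: measurable_bounded_integrable => //.
  by apply: (le_lt_trans (@probability_le1 _ _ _ haar setT measurableT)); exact: ltry.
exists M; split; first exact: num_real.
by move=> x Mx z _; exact: le_trans (gM z) (ltW Mx).
Qed.

(** Adding 1 makes the integrand nonnegative, as [haar_integralE] requires; the phase b serves the
    real and imaginary parts of a character at once. *)
Lemma cos_integral (n : int) (b : R) : n != 0 ->
  (\int[lebesgue_measure]_(t in `[0%R, 1%R])
    (1 + cos (2 * pi * n%:~R * t + b))%:E = 1)%E.
Proof.
move=> n0; set a := 2 * pi * n%:~R.
have a0 : a != 0 :> R by rewrite !mulf_neq0// ?pnatr_eq0 ?intr_eq0// gt_eqF ?pi_gt0.
have dF (t : R) :
    is_derive t 1 (fun t => t + a^-1 * sin (a * t + b)) (1 + cos (a * t + b)).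
  by apply: is_derive_eq; rewrite /GRing.scale/= addr0 mulr1 mulrCA mulVf// mulr1.
have cF : continuous (fun t => t + a^-1 * sin (a * t + b)).
  by move=> t; apply/differentiable_continuous/derivable1_diffP; case: (dF t).
rewrite (@continuous_FTC2 _ _ (fun t => t + a^-1 * sin (a * t + b)))//.
(* Periodicity is read off from [circle_expX] at t = 1, where the point of the circle is 1. *)
- have := circle_expX 1 n.
  have -> : val (circle_exp 1 : circle R) = 1.
    by rewrite /= mulr1 mulr_natl cos2pi sin2pi.
  rewrite exp1rz !mulr1 -/a => -[ca sa].
  by rewrite mulr0 !add0r sinD -ca -sa mul1r mul0r add0r EFinD addeK.
- apply: continuous_subspaceT => t; apply: continuousD; first exact: cst_continuous.
  apply: continuous_comp; last exact: continuous_cos.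
  apply: continuousD; last exact: cst_continuous.
  by apply: continuousM; [exact: cst_continuous|exact: id].
- split; first by move=> t _; case: (dF t).
  + exact: (cvg_at_right_filter (cF 0)).
  + exact: (cvg_at_left_filter (cF 1)).
- by move=> t _; rewrite derive1E; case: (dF t).
Qed.

Lemma haar_cst (r : R) : \int[haar]_z r = r.
Proof.
rewrite Rintegral_cst// -[RHS]mulr1; congr (_ * _).
exact: (congr1 fine (@probability_setT _ _ _ haar)).
Qed.

Lemma haar_int0 (g : circle R -> R) (n : int) (b : R) : n != 0 ->
  measurable_fun setT g -> (forall z, `|g z| <= 1) ->
  (forall t, g (circle_exp t) = cos (2 * pi * n%:~R * t + b)) ->
  \int[haar]_z g z = 0.
Proof.
move=> n0 mg g1 gE.
have g10 z : 0 <= 1 + g z by have := g1 z; rewrite ler_norml => /andP[]; lra.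
have m1g : measurable_fun setT (fun z => 1 + g z) by exact: measurable_funD.
have /(congr1 fine)/= : (\int[haar]_z (1 + g z)%:E = 1)%E.
  rewrite haar_integralE// -[RHS](cos_integral b n0).
  by apply: eq_integral => t _; rewrite gE.
rewrite -[LHS]/(\int[haar]_z (1 + g z)) RintegralD//.
- by rewrite haar_cst => /eqP; rewrite eq_sym addrC -subr_eq subrr => /eqP/esym.
- by apply: (@bounded_haar_integrable _ `|1|).
- exact: (bounded_haar_integrable _ g1).
Qed.

Lemma cintegral_pow (n : int) :
  cintegral haar (fun z => val z ^ n) = (n == 0)%:R.
Proof.
have [-> |n0] := eqVneq n 0.
  by rewrite /cintegral; under eq_Rintegral do rewrite /=;
    under [X in (_ +i* X)%C]eq_Rintegral do rewrite /=; rewrite !haar_cst.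
have [mr mi] := @cmeasurable_circle_pow R n.
have n1 (z : circle R) : normc (val z ^ n) <= 1 by rewrite normc_circle_pow.
rewrite /cintegral (@haar_int0 _ n 0)//; last 2 first.
- by move=> z; exact: le_trans (ler_Re_normc _) (n1 z).
- by move=> t; rewrite circle_expX/= addr0.
rewrite (@haar_int0 _ n (- (pi / 2)))//.
- by move=> z; exact: le_trans (ler_Im_normc _) (n1 z).
- by move=> t; rewrite circle_expX/= cosBpihalf.
Qed.

End circle_integrals.

Section Lp_circle.
Variables (R : realType) (p : R) (p1 : 1 <= p).
Notation haar := (haar R).
Notation X := (Lp haar p1).
Implicit Types (u v : X) (f g : cLfunType haar p1) (n : int).

Let p_gt0 : 0 < p. Proof. exact: lt_le_trans ltr01 p1. Qed.

Lemma measurable_pow_normc (f : circle R -> R[i]) : cmeasurable f ->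
  measurable_fun setT (fun z => normc (f z) `^ p).
Proof.
by move=> mf; apply: (measurableT_comp (measurable_powR _)); exact: measurable_normc.
Qed.

Lemma poweR_cLnorm (f : circle R -> R[i]) :
  (cLnorm haar p f `^ p = \int[haar]_z (normc (f z) `^ p)%:E)%E.
Proof.
rewrite poweR_Lnorm; last by rewrite gt_eqF.
apply: eq_integral => z _ /=.
by rewrite ger0_norm// normc_ge0.
Qed.

Lemma cLfun_pow_integrable f :
  haar.-integrable setT (EFin \o (fun z => normc (val f z) `^ p)).
Proof.
apply/integrableP; split.
  by apply/measurable_EFinP/measurable_pow_normc; exact: cLfun_measurable.
under eq_integral do rewrite /= ger0_norm ?powR_ge0//.
rewrite -poweR_cLnorm; apply: poweR_lty.
by case: f => f /= /asboolP[].
Qed.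

Lemma nrm_class f :
  nrm (Lp_class f) `^ p = \int[haar]_z (normc (val f z) `^ p).
Proof.
have -> : nrm (Lp_class f) = fine (cLnorm haar p (val f)).
  by apply: complexI; rewrite -normE -Lp_norm_class.
rewrite /Rintegral -poweR_cLnorm.
by rewrite -[in RHS](cLnorm_fine f) poweR_EFin.
Qed.

Lemma bounded_cLfun (f : circle R -> R[i]) (M : R) :
  cmeasurable f -> (forall z, normc (f z) <= M) -> f \in cLfun haar p1.
Proof.
move=> mf fM; apply/asboolP; split=> //.
have : (cLnorm haar p f `^ p < +oo)%E.
  rewrite poweR_cLnorm.
  have /integrableP[_] : haar.-integrable setT (EFin \o (fun z => normc (f z) `^ p)).
    apply: (@bounded_haar_integrable _ _ (M `^ p)).
      exact: measurable_pow_normc.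
    move=> z; rewrite ger0_norm ?powR_ge0//; apply: ge0_ler_powR => //.
    - exact: ltW.
    - by rewrite nnegrE normc_ge0.
    - by rewrite nnegrE (le_trans (normc_ge0 _) (fM z)).
  by under eq_integral do rewrite /= ger0_norm ?powR_ge0//.
have := Lnorm_ge0 haar p%:E (EFin \o (fun x => normc (f x))).
rewrite -/(cLnorm haar p f); case: (cLnorm _ _ _) => [r _ _|_|//].
  exact: ltry.
by rewrite poweRyr ?gt_eqF// ltxx.
Qed.

Lemma monomial_cLfun n : (fun z : circle R => val z ^ n) \in cLfun haar p1.
Proof.
apply: (@bounded_cLfun _ 1); first exact: cmeasurable_circle_pow.
by move=> z; rewrite normc_circle_pow.
Qed.

Definition monomial n : cLfunType haar p1 :=
  exist (fun h : circle R -> R[i] => h \in cLfun haar p1) _ (monomial_cLfun n).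

Definition Lpe n : X := Lp_class (monomial n).

Definition Lpcoef u n : R[i] := fourier_coef (Lp_fun u) n.

Lemma LpcoefP c u v n : Lpcoef (c *: u + v) n = c * Lpcoef u n + Lpcoef v n.
Proof.
rewrite -[u]Lp_reprK -[v]Lp_reprK -[_ *: _]Lp_classZ -Lp_classD.
by rewrite /Lpcoef !fourier_coef_class fourier_coefP.
Qed.

Lemma Lpcoef0 n : Lpcoef 0 n = 0.
Proof.
have := LpcoefP 1 0 0 n; rewrite scale1r addr0 mul1r => /eqP.
by rewrite -subr_eq subrr => /eqP.
Qed.

Lemma LpcoefD u v n : Lpcoef (u + v) n = Lpcoef u n + Lpcoef v n.
Proof. by have := LpcoefP 1 u v n; rewrite scale1r mul1r. Qed.

Lemma LpcoefZ c u n : Lpcoef (c *: u) n = c * Lpcoef u n.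
Proof. by have := LpcoefP c u 0 n; rewrite Lpcoef0 !addr0. Qed.

Lemma Lpcoef_sum (I : Type) (s : seq I) (P : pred I) (F : I -> X) n :
  Lpcoef (\sum_(i <- s | P i) F i) n = \sum_(i <- s | P i) Lpcoef (F i) n.
Proof. by apply: (big_morph (Lpcoef^~ n)) => [u v|]; rewrite ?LpcoefD ?Lpcoef0. Qed.

Lemma Lpcoef_Lpe m n : Lpcoef (Lpe m) n = (m == n)%:R.
Proof.
rewrite /Lpcoef fourier_coef_class /fourier_coef.
rewrite (_ : (fun z => _) = (fun z : circle R => val z ^ (m - n))).
  by rewrite cintegral_pow subr_eq0.
apply/funext => z /=; rewrite -expfzDr//.
by rewrite -normr_eq0 (eqP (valP z)) oner_neq0.
Qed.

Lemma Lp_class_sum (I : Type) (s : seq I) (P : pred I) (F : I -> cLfunType haar p1) :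
  Lp_class (\sum_(i <- s | P i) F i) = \sum_(i <- s | P i) Lp_class (F i).
Proof.
by apply: (big_morph (@Lp_class _ _ _ haar p p1)) => [f g|];
  rewrite ?Lp_classD ?Lp_class0.
Qed.

Lemma val_cLfun_sum (I : Type) (s : seq I) (P : pred I) (F : I -> cLfunType haar p1) z :
  val (\sum_(i <- s | P i) F i) z = \sum_(i <- s | P i) val (F i) z.
Proof. by apply: (big_morph (fun f : cLfunType haar p1 => val f z)). Qed.

Lemma trig_class (I : Type) (s : seq I) (P : pred I) (c : I -> R[i]) (q : I -> int) :
  \sum_(i <- s | P i) c i *: Lpe (q i) =
  Lp_class (\sum_(i <- s | P i) c i *: monomial (q i)).
Proof. by rewrite Lp_class_sum; apply: eq_bigr => i _; exact: esym (Lp_classZ _ _). Qed.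

Lemma nrm_trig (I : Type) (s : seq I) (P : pred I) (c : I -> R[i]) (q : I -> int) :
  nrm (\sum_(i <- s | P i) c i *: Lpe (q i)) `^ p =
  \int[haar]_z (normc (\sum_(i <- s | P i) c i * val z ^ q i) `^ p).
Proof.
rewrite trig_class nrm_class; apply: eq_Rintegral => z _.
by rewrite val_cLfun_sum.
Qed.

Lemma nrm_Lpe n : nrm (Lpe n) = 1.
Proof.
have := nrm_class (monomial n).
under eq_Rintegral do rewrite /= normc_circle_pow powR1.
rewrite haar_cst => /eqP; rewrite powR_eq1 (gt_eqF p_gt0) orbF.
by rewrite ltNge nrm_ge0 orbF => /eqP.
Qed.

Lemma le_haar_norm (f : cLfunType haar p1) (g : circle R -> R) :
  haar.-integrable setT (EFin \o g) -> (forall z, `|g z| <= normc (val f z)) ->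
  nrm (Lp_class f) = 1 -> `|\int[haar]_z g z| <= 2.
Proof.
move=> ig gf f1; apply: le_trans (le_normr_Rintegral measurableT ig) _.
have i1 : haar.-integrable setT (EFin \o fun=> 1 : R).
  by apply: (@bounded_haar_integrable _ _ 1) => // z; rewrite normr1.
have ifp := cLfun_pow_integrable f.
apply: (@le_trans _ _ (\int[haar]_z (1 + normc (val f z) `^ p))).
  apply: le_Rintegral => //.
  - exact: integrable_norm.
  - exact: (integrableD measurableT i1 ifp).
  move=> z _; apply: le_trans (gf z) _.
  have [fz1|fz1] := leP (normc (val f z)) 1; first by rewrite ler_wpDr// powR_ge0.
  by rewrite ler_wpDl// -[leLHS]powRr1 ?normc_ge0// ler_powR// ltW.
by rewrite RintegralD// haar_cst -nrm_class f1 powR1.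
Qed.

(* For a function of norm 1, |f| <= 1 + |f|^p bounds the L^1 norm without
   Hoelder's inequality. *)
Lemma Lpcoef_le u n : normc (Lpcoef u n) <= 4 * nrm u.
Proof.
have le4 v : nrm v = 1 -> normc (Lpcoef v n) <= 4.
  rewrite -[v]Lp_reprK /Lpcoef fourier_coef_class => v1.
  set f := Lp_repr v in v1 *.
  have [fr fi] := cLfun_integrable f (- n).
  rewrite /fourier_coef/cintegral.
  have fE z : normc (val f z * val z ^ (- n)) = normc (val f z).
    by rewrite Normc.normcM normc_circle_pow mulr1.
  set a := \int[_]_z _; set b := \int[_]_z _.
  have a2 : `|a| <= 2.
    by apply: (le_haar_norm fr) v1 => z; rewrite -fE ler_Re_normc.
  have b2 : `|b| <= 2.
    by apply: (le_haar_norm fi) v1 => z; rewrite -fE ler_Im_normc.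
  have -> : (a +i* b = a%:C + 'i * b%:C)%C by rewrite [LHS]complexE.
  apply: le_trans (normcD _ _) _; rewrite Normc.normcM !normc_real.
  by rewrite /= expr0n expr1n/= add0r sqrtr1 mul1r; lra.
have [u0|u0] := eqVneq (nrm u) 0.
  by rewrite (nrm0_eq0 u0) Lpcoef0 Normc.normc0 nrm0 mulr0.
have un0 : 0 < nrm u by rewrite lt_def u0 nrm_ge0.
have := le4 ((nrm u)^-1%:C *: u); rewrite nrmZ LpcoefZ Normc.normcM normc_real.
rewrite gtr0_norm ?invr_gt0// mulVf// => /(_ erefl).
by rewrite ler_pdivrMl// mulrC.
Qed.

End Lp_circle.

(** * Density of trigonometric polynomials *)

Section density.
Variables (R : realType) (p : R) (p1 : 1 <= p).
Notation haar := (haar R).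
Notation T := (circle R).
Implicit Types (f g : T -> R[i]).

Let p_gt0 : 0 < p. Proof. exact: lt_le_trans ltr01 p1. Qed.

Definition trigfun (s : seq (R[i] * int)) : T -> R[i] :=
  fun z => \sum_(x <- s) x.1 * val z ^ x.2.

(** Stated for functions rather than classes, because the closure properties below multiply
    functions and take pointwise limits. *)
Definition Lp_approx f := forall e : R, 0 < e ->
  exists s, (cLnorm haar p (fun z => f z - trigfun s z)%R <= e%:E)%E.

Lemma cmeasurableN f : cmeasurable f -> cmeasurable (fun z => - f z).
Proof.
move=> mf; rewrite (_ : (fun _ => _) = (fun z => (-1) * f z)).
  exact: cmeasurableM (cmeasurable_cst _ _) mf.
by apply/funext => z; rewrite mulN1r.
Qed.

Lemma cmeasurableB f g :
  cmeasurable f -> cmeasurable g -> cmeasurable (fun z => f z - g z).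
Proof. by move=> mf mg; apply: cmeasurableD mf (cmeasurableN mg). Qed.

Lemma cmeasurable_real (h : T -> R) :
  measurable_fun setT h -> cmeasurable (fun z => (h z)%:C).
Proof. by move=> mh; split=> //=; exact: measurable_cst. Qed.

Lemma trigfun_cat s t z : trigfun (s ++ t) z = trigfun s z + trigfun t z.
Proof. by rewrite /trigfun big_cat. Qed.

Lemma trigfun_cons x s z : trigfun (x :: s) z = x.1 * val z ^ x.2 + trigfun s z.
Proof. by rewrite /trigfun big_cons. Qed.

Lemma trigfun_scale c s : exists t, trigfun t =1 (fun z => c * trigfun s z).
Proof.
exists [seq (c * x.1, x.2) | x <- s] => z.
by rewrite /trigfun big_map mulr_sumr; apply: eq_bigr => x _; rewrite /= mulrA.
Qed.

Lemma circle_neq0 (z : T) : val z != 0.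
Proof. by rewrite -normr_eq0 (eqP (valP z)) oner_neq0. Qed.

Lemma trigfunM s t : exists u, trigfun u =1 (fun z => trigfun s z * trigfun t z).
Proof.
exists [seq (x.1 * y.1, x.2 + y.2) | x <- s, y <- t] => z.
rewrite /trigfun big_allpairs_dep mulr_suml; apply: eq_bigr => x _.
rewrite mulr_sumr; apply: eq_bigr => y _ /=.
by rewrite expfzDr ?circle_neq0// mulrACA.
Qed.

Lemma cmeasurable_trigfun s : cmeasurable (trigfun s).
Proof.
elim: s => [|x s ih].
  rewrite (_ : trigfun _ = fun=> 0); first exact: cmeasurable_cst.
  by apply/funext => z; rewrite /trigfun big_nil.
rewrite (_ : trigfun _ = fun z => x.1 * val z ^ x.2 + trigfun s z).
  apply: cmeasurableD ih; apply: cmeasurableM; first exact: cmeasurable_cst.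
  exact: cmeasurable_circle_pow.
by apply/funext => z; rewrite trigfun_cons.
Qed.

Lemma trigfun_bounded s : exists2 M : R, 0 <= M & forall z, normc (trigfun s z) <= M.
Proof.
exists (\sum_(x <- s) normc x.1); first by apply: sumr_ge0 => x _; exact: normc_ge0.
move=> z; apply: le_trans (normc_sum _ _ _) _; apply: ler_sum => x _.
by rewrite Normc.normcM normc_circle_pow mulr1.
Qed.

Lemma eq_cLnorm f g : f =1 g -> cLnorm haar p f = cLnorm haar p g.
Proof. by move=> /funext ->. Qed.

Lemma le_cLnorm f g : cmeasurable f -> cmeasurable g ->
  (forall z, normc (f z) <= normc (g z)) -> (cLnorm haar p f <= cLnorm haar p g)%E.
Proof.
move=> mf mg fg; apply: le_Lnorm => //; [exact: measurable_normc..|].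
by move=> z; rewrite !ger0_norm ?normc_ge0.
Qed.

Lemma cLnorm_le f (e : R) : 0 <= e -> cmeasurable f ->
  (\int[haar]_z (normc (f z) `^ p)%:E <= (e `^ p)%:E)%E -> (cLnorm haar p f <= e%:E)%E.
Proof.
move=> e0 mf; rewrite -(poweR_cLnorm p1) => le_e.
have N0 : (0 <= cLnorm haar p f)%E by exact: Lnorm_ge0.
rewrite leNgt; apply/negP; move: N0 le_e; case: (cLnorm _ _ _) => [r|_|//].
  rewrite lee_fin poweR_EFin lee_fin lte_fin => r0 + er; apply/negP; rewrite -ltNge.
  by apply: gt0_ltr_powR => //; rewrite nnegrE.
by rewrite poweRyr ?gt_eqF// => + _; rewrite leye_eq.
Qed.

Lemma Lp_approx_trigfun s : Lp_approx (trigfun s).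
Proof.
move=> e e0; exists s; rewrite (@eq_cLnorm _ (fun=> 0)).
  apply: cLnorm_le; [exact: ltW|exact: cmeasurable_cst|].
  under eq_integral do rewrite Normc.normc0 powR0 ?gt_eqF//.
  by rewrite integral0 lee_fin powR_ge0.
by move=> z; rewrite subrr.
Qed.

Lemma Lp_approxD f g : cmeasurable f -> cmeasurable g ->
  Lp_approx f -> Lp_approx g -> Lp_approx (fun z => f z + g z).
Proof.
move=> mf mg af ag e e0; have e2 : 0 < e / 2 by rewrite divr_gt0.
have [s fs] := af _ e2; have [t gt] := ag _ e2.
exists (s ++ t).
rewrite (@eq_cLnorm _ (fun z => (f z - trigfun s z) + (g z - trigfun t z))); last first.
  by move=> z; rewrite trigfun_cat opprD addrACA.
have ms := cmeasurable_trigfun s; have mt := cmeasurable_trigfun t.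
apply: le_trans (cLnormD haar p1 (cmeasurableB mf ms) (cmeasurableB mg mt)) _.
by rewrite [e]splitr EFinD leeD.
Qed.

Lemma Lp_approxZ c f : cmeasurable f -> Lp_approx f -> Lp_approx (fun z => c * f z).
Proof.
move=> mf af e e0; have c0 : 0 < normc c + 1 by rewrite ltr_pwDr// normc_ge0.
have [s fs] := af _ (divr_gt0 e0 c0); have [t tE] := trigfun_scale c s; exists t.
rewrite (@eq_cLnorm _ (fun z => c * (f z - trigfun s z))); last first.
  by move=> z; rewrite tE mulrBr.
rewrite cLnormZ//; last exact: cmeasurableB mf (cmeasurable_trigfun s).
apply: (@le_trans _ _ ((normc c)%:E * (e / (normc c + 1))%:E)%E).
  by rewrite lee_wpmul2l// lee_fin normc_ge0.
rewrite -EFinM lee_fin mulrCA ler_piMr ?ltW//.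
by rewrite ltr_pdivrMr// mul1r ltrDl.
Qed.

(** From f g - s t = f (g - t) + t (f - s): t is chosen first, and s only once a uniform bound for t
    is known. *)
Lemma Lp_approxM f g M : cmeasurable f -> cmeasurable g ->
  (forall z, normc (f z) <= M) -> Lp_approx f -> Lp_approx g -> Lp_approx (fun z => f z * g z).
Proof.
move=> mf mg fM af ag e e0; have e2 : 0 < e / 2 by rewrite divr_gt0.
have M0 : 0 <= M by apply: le_trans (normc_ge0 _) (fM point).
have M1 : 0 < M + 1 by rewrite ltr_pwDr.
have [t gt] := ag _ (divr_gt0 e2 M1).
have [N N0 tN] := trigfun_bounded t.
have N1 : 0 < N + 1 by rewrite ltr_pwDr.
have [s fs] := af _ (divr_gt0 e2 N1).
have [u uE] := trigfunM s t; exists u.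
rewrite (@eq_cLnorm _ (fun z => f z * (g z - trigfun t z) +
    trigfun t z * (f z - trigfun s z))); last by move=> z; rewrite uE; ring.
have ms := cmeasurable_trigfun s; have mt := cmeasurable_trigfun t.
have mft := cmeasurableB mg mt; have mfs := cmeasurableB mf ms.
apply: le_trans (cLnormD haar p1 (cmeasurableM mf mft) (cmeasurableM mt mfs)) _.
have bnd h k K d : cmeasurable h -> cmeasurable k -> 0 <= K -> (forall z, normc (h z) <= K) ->
    (cLnorm haar p k <= (d / (K + 1))%:E)%E -> 0 <= d ->
    (cLnorm haar p (fun z => h z * k z)%R <= d%:E)%E.
  move=> mh mk K0 hK kd d0.
  apply: (@le_trans _ _ (cLnorm haar p (fun z => K%:C * k z)%R)).
    apply: le_cLnorm => [||z]; [exact: cmeasurableM|apply: cmeasurableM => //;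
      exact: cmeasurable_cst|].
    by rewrite !Normc.normcM ler_wpM2r ?normc_ge0// normc_real ger0_norm.
  rewrite cLnormZ// normc_real ger0_norm//.
  apply: (@le_trans _ _ (K%:E * (d / (K + 1))%:E)%E); first by rewrite lee_wpmul2l.
  have K1 : 0 < K + 1 by rewrite ltr_pwDr.
  by rewrite -EFinM lee_fin mulrCA ler_piMr// ltW// ltr_pdivrMr// mul1r ltrDl.
by rewrite [e]splitr EFinD leeD//; [apply: bnd fM gt _|apply: bnd tN fs _]; rewrite // ltW.
Qed.

(** Dominated convergence, applied to the p-th powers of |f_k - f|. *)
Lemma Lp_approx_lim (f_ : nat -> T -> R[i]) f (F : T -> R) :
  (forall k, cmeasurable (f_ k)) -> cmeasurable f -> (forall k, Lp_approx (f_ k)) ->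
  (forall z, normc (f_ k z - f z) @[k --> \oo] --> (0 : R)) ->
  (forall k z, normc (f_ k z - f z) <= F z) ->
  haar.-integrable setT (EFin \o (fun z => F z `^ p)) -> Lp_approx f.
Proof.
move=> mf_ mf af_ f_f f_F iF e e0; have e2 : 0 < e / 2 by rewrite divr_gt0.
pose h k z := (normc (f_ k z - f z) `^ p)%:E.
have mfk k : cmeasurable (fun z => f_ k z - f z) by exact: cmeasurableB.
have : (\int[haar]_z h k z)%E @[k --> \oo] --> (\int[haar]_z 0)%E.
  apply: (@dominated_cvg _ _ _ haar setT measurableT h (fun=> 0%E)
    (fun z => (F z `^ p)%:E)) => //.
  - by move=> k; apply/measurable_EFinP; exact: measurable_pow_normc.
  - move=> z _; apply/cvg_EFin; first by apply: nearW.
    have : normc (f_ k z - f z) `^ p @[k --> \oo] --> (0 : R).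
      have /cvgrPdist_lt f0 := f_f z; apply/cvgrPdist_lt => d d0.
      have dp0 : 0 < d `^ p^-1 by rewrite powR_gt0.
      apply: filterS (f0 _ dp0) => k; rewrite !sub0r !normrN.
      rewrite !ger0_norm ?powR_ge0 ?normc_ge0// => kd.
      have : normc (f_ k z - f z) `^ p < (d `^ p^-1) `^ p.
        by apply: gt0_ltr_powR; rewrite ?nnegrE ?normc_ge0 ?powR_ge0.
      by rewrite -powRrM mulVf ?gt_eqF// powRr1// ltW.
    by [].
  - move=> k z _; rewrite gee0_abs ?lee_fin ?powR_ge0//.
    apply: ge0_ler_powR; rewrite ?nnegrE ?normc_ge0//; first exact: ltW.
    exact: le_trans (normc_ge0 _) (f_F 0%N z).
rewrite integral0 => /fine_cvgP[fink hk0].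
have ep0 : 0 < (e / 2) `^ p by rewrite powR_gt0.
have /cvgrPdist_lt/(_ _ ep0) hke := hk0.
have [k [hk1 hk2]] : exists k, (\int[haar]_z h k z)%E \is a fin_num /\
    `|0 - fine (\int[haar]_z h k z)%E|%R < (e / 2) `^ p.
  have : \forall k \near \oo, (\int[haar]_z h k z)%E \is a fin_num /\
    `|0 - fine (\int[haar]_z h k z)%E|%R < (e / 2) `^ p.
    by apply: filterS2 fink hke => k ? ?; split.
  by move=> [k _ kP]; exists k; apply: kP => /=.
have hk : (cLnorm haar p (fun z => f_ k z - f z)%R <= (e / 2)%:E)%E.
  apply: cLnorm_le => //; first exact: ltW.
  rewrite -/(h k) -(fineK hk1) lee_fin ltW//.
  by move: hk2; rewrite sub0r normrN; apply: le_lt_trans; rewrite ler_norm.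
have [s fs] := af_ k _ e2; exists s.
rewrite (@eq_cLnorm _ (fun z => (-1) * (f_ k z - f z) + (f_ k z - trigfun s z)));
  last by move=> z; ring.
apply: le_trans (cLnormD haar p1 _ _) _.
- by apply: cmeasurableM => //; exact: cmeasurable_cst.
- exact: cmeasurableB (cmeasurable_trigfun s).
rewrite cLnormZ// normcN Normc.normc1 mul1e.
by rewrite [e]splitr EFinD leeD.
Qed.

End density.

(** * Polynomial approximation of the sign function *)

Section sign_iteration.
Variable R : realType.
Implicit Types t : R.

(* A polynomial with fixed points -1, 0 and 1, the first and last attracting: its
   iterates turn polynomial approximations into indicator functions. *)
Definition sgn_step t := (3 * t - t ^+ 3) / 2.

Lemma sgn_stepN t : sgn_step (- t) = - sgn_step t.
Proof. by rewrite /sgn_step; field. Qed.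

Lemma sgn_step_ge t : 0 <= t <= 1 -> t <= sgn_step t <= 1.
Proof.
move=> /andP[t0 t1]; rewrite /sgn_step; apply/andP; split.
  have : 0 <= t * ((1 - t) * (1 + t)) by rewrite !mulr_ge0//; lra.
  by lra.
have : 0 <= (1 - t) * (1 - t) * (2 + t) by rewrite !mulr_ge0//; lra.
by lra.
Qed.

Lemma sgn_step_bound t k : `|t| <= 1 -> `|iter k sgn_step t| <= 1.
Proof.
move=> t1; elim: k => //= k; move: (iter _ _ _) => {t1}t.
have [t0|t0] := leP 0 t.
  rewrite ger0_norm// => t1.
  have /andP[tt s1] : t <= sgn_step t <= 1 by apply: sgn_step_ge; rewrite t0 t1.
  by rewrite ger0_norm// (le_trans t0).
rewrite ltr0_norm// => t1; rewrite -normrN -sgn_stepN.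
have t0' : 0 <= - t by lra.
have /andP[tt s1] : - t <= sgn_step (- t) <= 1 by apply: sgn_step_ge; rewrite t0' t1.
by rewrite ger0_norm// (le_trans t0').
Qed.

(** One step multiplies the distance of x to 1 by at most 1 - x / 2, and the iterates never fall
    below t, so this factor is at most 1 - t / 2. *)
Lemma sgn_step_rate t k : 0 <= t <= 1 ->
  t <= iter k sgn_step t /\ 0 <= 1 - iter k sgn_step t <= (1 - t / 2) ^+ k.
Proof.
move=> /andP[t0 t1]; elim: k => [|k [tx /andP[x1 xk]]].
  by split => //=; rewrite expr0; apply/andP; split; lra.
set x := iter k sgn_step t in tx x1 xk *; rewrite iterS -/x.
have /andP[xx xle] : x <= sgn_step x <= 1 by apply: sgn_step_ge; apply/andP; split; lra.
split; first exact: le_trans tx xx.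
apply/andP; split; first by lra.
rewrite exprS; apply: (@le_trans _ _ ((1 - x / 2) * (1 - x))).
  rewrite /sgn_step -subr_ge0.
  have -> : (1 - x / 2) * (1 - x) - (1 - (3 * x - x ^+ 3) / 2) =
    x ^+ 2 * (1 - x) / 2 by field.
  by rewrite divr_ge0// mulr_ge0// sqr_ge0.
apply: ler_pM => //; first by lra.
by lra.
Qed.

Lemma sgn_step_cvg t : `|t| <= 1 -> iter k sgn_step t @[k --> \oo] --> Num.sg t.
Proof.
have pos x : 0 < x <= 1 -> iter k sgn_step x @[k --> \oo] --> (1 : R).
  move=> /andP[x0 x1].
  have q : `|1 - x / 2| < 1 by rewrite ger0_norm; lra.
  have := cvg_expr q => /cvgrPdist_lt qc; apply/cvgrPdist_lt => e e0.
  apply: filterS (qc _ e0) => k; rewrite sub0r normrN.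
  have [|_ /andP[k0 kx]] := @sgn_step_rate x k; first by rewrite ltW.
  rewrite !ger0_norm//; last by rewrite exprn_ge0//; lra.
  exact: le_lt_trans.
move=> t1; have [t0|t0|t0] := ltgtP t 0.
- rewrite ltr0_sg//.
  have -> : (fun k => iter k sgn_step t) = (fun k => - iter k sgn_step (- t)).
    apply/funext => k; elim: k => /= [|k ->]; first by rewrite opprK.
    by rewrite sgn_stepN.
  by apply: cvgN; apply: pos; rewrite ltr0_norm// in t1; apply/andP; split; lra.
- by rewrite gtr0_sg//; apply: pos; rewrite t0 -(gtr0_norm t0).
- rewrite t0 sgr0 (_ : (fun _ => _) = fun=> 0); first exact: cvg_cst.
  by apply/funext; elim => //= k ->; rewrite /sgn_step; field.
Qed.

End sign_iteration.

(** * From indicator functions to all of L^p *)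

Section density.
Import HBSimple HBNNSimple.
Variables (R : realType) (p : R) (p1 : 1 <= p).
Notation haar := (haar R).
Notation T := (circle R).
Implicit Types (f g : T -> R[i]).

Let p_gt0 : 0 < p. Proof. exact: lt_le_trans ltr01 p1. Qed.

Definition bounded_approx f :=
  [/\ cmeasurable f, exists M : R, forall z, normc (f z) <= M & Lp_approx p f].

Lemma eq_bounded_approx f g : f =1 g -> bounded_approx f -> bounded_approx g.
Proof. by move=> /funext ->. Qed.

Lemma bounded_approxD f g : bounded_approx f -> bounded_approx g ->
  bounded_approx (fun z => f z + g z).
Proof.
move=> [mf [M fM] af] [mg [N gN] ag]; split.
- exact: cmeasurableD.
- by exists (M + N) => z; apply: le_trans (normcD _ _) (lerD (fM z) (gN z)).
- exact: Lp_approxD.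
Qed.

Lemma bounded_approxM f g : bounded_approx f -> bounded_approx g ->
  bounded_approx (fun z => f z * g z).
Proof.
move=> [mf [M fM] af] [mg [N gN] ag]; split.
- exact: cmeasurableM.
- exists (M * N) => z; rewrite Normc.normcM.
  by apply: ler_pM => //; rewrite ?normc_ge0.
- exact: Lp_approxM fM af ag.
Qed.

Lemma bounded_approx_trig s : bounded_approx (trigfun s).
Proof.
split; [exact: cmeasurable_trigfun| |exact: Lp_approx_trigfun].
by have [M _ sM] := trigfun_bounded s; exists M.
Qed.

Lemma bounded_approx_cst c : bounded_approx (fun=> c).
Proof.
apply: eq_bounded_approx (bounded_approx_trig [:: (c, 0)]) => z.
by rewrite /trigfun big_seq1/= expr0z mulr1.
Qed.

Lemma bounded_approxZ c f : bounded_approx f -> bounded_approx (fun z => c * f z).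
Proof. by move=> af; apply: bounded_approxM => //; exact: bounded_approx_cst. Qed.

Lemma bounded_approx_lim (f_ : nat -> T -> R[i]) f (M : R) :
  (forall k, bounded_approx (f_ k)) -> cmeasurable f ->
  (forall k z, normc (f_ k z) <= M) -> (forall z, normc (f z) <= M) ->
  (forall z, normc (f_ k z - f z) @[k --> \oo] --> (0 : R)) -> bounded_approx f.
Proof.
move=> af_ mf f_M fM f_f; split => //; first by exists M.
apply: (@Lp_approx_lim _ _ p1 f_ f (fun=> M + M)) => //.
- by move=> k; have [] := af_ k.
- by move=> k; have [] := af_ k.
- by move=> k z; apply: le_trans (normcB _ _) (lerD _ _).
- apply: (@bounded_haar_integrable _ _ (`|(M + M) `^ p|)) => //.
Qed.

Lemma bounded_approx_Re : bounded_approx (fun z => (Re (val z))%:C).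
Proof.
apply: eq_bounded_approx (bounded_approx_trig [:: (1 / 2, 1); (1 / 2, -1)]) => z.
rewrite /trigfun big_cons big_seq1/= expr1z exprN1 (@unimodularVc _ (val z)) ?(eqP (valP z))//.
by rewrite ReJ_add; field.
Qed.

Lemma bounded_approx_Im : bounded_approx (fun z => (Im (val z))%:C).
Proof.
apply: eq_bounded_approx (bounded_approx_trig [:: (- 'i%C / 2, 1); ('i%C / 2, -1)]) => z.
rewrite /trigfun big_cons big_seq1/= expr1z exprN1 (@unimodularVc _ (val z)) ?(eqP (valP z))//.
by rewrite ImJ_sub; field.
Qed.

(** The function h - a is scaled into [-1, 1], the iterates of [sgn_step] converge boundedly to its
    sign s, and (s^2 + s) / 2 is the indicator of s = 1. *)
Lemma bounded_approx_gt (h : T -> R) (a : R) : measurable_fun setT h ->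
  bounded_approx (fun z => (h z)%:C) -> (forall z, `|h z| <= 1) ->
  bounded_approx (fun z => ((a < h z)%R%:R)%:C).
Proof.
move=> mh ah h1; have a1 : 0 < 1 + `|a| by rewrite ltr_pwDl.
pose t z := (h z - a) / (1 + `|a|).
have mt : measurable_fun setT t by apply: measurable_funM => //; exact: measurable_funB.
have t1 z : `|t z| <= 1.
  rewrite normrM normfV (gtr0_norm a1) ler_pdivrMr// mul1r.
  by apply: le_trans (ler_normB _ _) _; rewrite lerD2r.
have at_ : bounded_approx (fun z => (t z)%:C).
  apply: eq_bounded_approx (bounded_approxZ ((1 + `|a|)^-1)%:C
    (bounded_approxD ah (bounded_approx_cst (- a)%:C))) => z.
  by rewrite -rmorphD -rmorphM mulrC.
have ak k : bounded_approx (fun z => (iter k (@sgn_step R) (t z))%:C).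
  elim: k => //= k ih.
  apply: eq_bounded_approx (bounded_approxZ (2^-1)%:C (bounded_approxD
    (bounded_approxZ 3%:C ih)
    (bounded_approxZ (-1)%:C (bounded_approxM ih (bounded_approxM ih ih))))) => z.
  by rewrite -!(rmorphM, rmorphD)/=; congr _%:C; rewrite /sgn_step; ring.
have msg : measurable_fun setT (fun z => Num.sg (t z)).
  rewrite (_ : (fun _ => _) =
    fun z => (if 0 < t z then 1 else 0) - (if t z < 0 then 1 else 0)).
    by apply: measurable_funB; apply: measurable_fun_ifT => //; exact: measurable_fun_ltr.
  apply/funext => z; have [t0|t0|->] := ltgtP (t z) 0.
  - by rewrite ltr0_sg// sub0r.
  - by rewrite gtr0_sg// subr0.
  - by rewrite sgr0 subrr.
have as_ : bounded_approx (fun z => (Num.sg (t z))%:C).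
  apply: (@bounded_approx_lim _ _ 1 ak).
  - exact: cmeasurable_real.
  - by move=> k z; rewrite normc_real sgn_step_bound.
  - by move=> z; rewrite normc_real normr_sg; case: eqP.
  - move=> z; under eq_fun do rewrite -rmorphB normc_real.
    have /cvgrPdist_lt tc := sgn_step_cvg (t1 z).
    apply/cvgrPdist_lt => e e0; apply: filterS (tc _ e0) => k.
    by rewrite sub0r normrN normr_id distrC.
apply: eq_bounded_approx (bounded_approxZ (2^-1)%:C
  (bounded_approxD (bounded_approxM as_ as_) as_)) => z.
rewrite -!(rmorphM, rmorphD)/=; congr _%:C.
have -> : (a < h z) = (0 < t z) by rewrite pmulr_lgt0 ?invr_gt0// subr_gt0.
have [t0|t0|->] := ltgtP (t z) 0.
- by rewrite ltr0_sg//=; ring.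
- by rewrite (gtr0_sg t0)/=; field.
- by rewrite (@sgr0 R)/=; field.
Qed.

(** These sets form a sigma-algebra. It contains the preimages of half-lines under both coordinates,
    hence every Borel set of the circle. *)
Definition approx_set (B : set T) :=
  measurable B /\ bounded_approx (fun z => (\1_B z)%:C).

Lemma indicE_normc (B : set T) z : normc (\1_B z)%:C <= 1 :> R.
Proof. by rewrite normc_real indicE; case: (z \in B); rewrite ?normr1 ?normr0. Qed.

Lemma approx_setC B : approx_set B -> approx_set (~` B).
Proof.
move=> [mB aB]; split; first exact: measurableC.
apply: eq_bounded_approx (bounded_approxD (bounded_approx_cst 1)
  (bounded_approxZ (-1) aB)) => z.
rewrite !indicE in_setC; case: (z \in B) => /=; first by rewrite mulr1 subrr.
by rewrite mulr0 addr0.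
Qed.

Lemma approx_setI A B : approx_set A -> approx_set B -> approx_set (A `&` B).
Proof.
move=> [mA aA] [mB aB]; split; first exact: measurableI.
apply: eq_bounded_approx (bounded_approxM aA aB) => z.
by rewrite !indicE in_setI -rmorphM/= -natrM mulnb.
Qed.

Lemma approx_setU A B : approx_set A -> approx_set B -> approx_set (A `|` B).
Proof.
by move=> aA aB; rewrite -[_ `|` _]setCK setCU; apply/approx_setC/approx_setI;
  exact: approx_setC.
Qed.

Lemma approx_set0 : approx_set set0.
Proof.
split; first exact: measurable0.
by apply: eq_bounded_approx (bounded_approx_cst 0) => z; rewrite indicE in_set0.
Qed.

Lemma approx_set_bigcup (A : nat -> set T) :
  (forall n, approx_set (A n)) -> approx_set (\bigcup_n A n).
Proof.
move=> aA; have mU : measurable (\bigcup_n A n).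
  by apply: bigcup_measurable => k _; have [] := aA k.
split => //.
pose U k := \big[setU/set0]_(i < k) A i.
have aU k : approx_set (U k).
  elim: k => [|k ih]; first by rewrite /U big_ord0; exact: approx_set0.
  by rewrite /U big_ord_recr/=; exact: approx_setU.
apply: (@bounded_approx_lim (fun k z => (\1_(U k) z)%:C) _ 1).
- by move=> k; have [] := aU k.
- by apply: cmeasurable_real; exact: measurable_indic.
- by move=> k z; exact: indicE_normc.
- by move=> z; exact: indicE_normc.
- move=> z; apply/cvgrPdist_lt => e e0.
  have [[n _ Anz]|Az] := pselect ((\bigcup_n A n) z).
    exists n.+1 => // k nk; rewrite sub0r normrN.
    have Ukz : U k z by rewrite /U -bigcup_mkord; exists n.
    have Az : (\bigcup_n A n) z by exists n.
    by rewrite !indicE (mem_set Ukz) (mem_set Az) -rmorphB normc_real subrr !normr0.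
  exists 0%N => // k _; rewrite sub0r normrN.
  have Ukz : ~ U k z.
    by rewrite /U -bigcup_mkord => -[i _ Aiz]; apply: Az; exists i.
  by rewrite !indicE (memNset Ukz) (memNset Az) -rmorphB normc_real subrr !normr0.
Qed.

Lemma approx_set_preimage (h : T -> measurableTypeR R) : measurable_fun setT h ->
  bounded_approx (fun z => (h z)%:C) -> (forall z, `|h z| <= 1) ->
  forall B, measurable B -> approx_set (h @^-1` B).
Proof.
move=> mh ah h1 B; rewrite RGenOInfty.measurableE => mB.
move: B mB; apply: smallest_sub.
  split.
  - by rewrite preimage_set0; exact: approx_set0.
  - by move=> A hA; rewrite setTD preimage_setC; exact: approx_setC.
  - by move=> A hA; rewrite preimage_bigcup; exact: approx_set_bigcup.
move=> _ [a ->]; split.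
  rewrite -[_ @^-1` _]setTI; apply: mh => //; exact: measurable_itv.
apply: eq_bounded_approx (bounded_approx_gt a mh ah h1) => z.
rewrite indicE; congr ((nat_of_bool _)%:R)%:C; apply/idP/idP => [az|/set_mem].
  by apply/mem_set; rewrite /= in_itv/= az.
by rewrite /= in_itv/= andbT.
Qed.

Lemma measurable_approx_set (B : set T) : measurable B -> approx_set B.
Proof.
have [mr mi] : measurable_fun setT (fun z : T => Re (val z)) /\
    measurable_fun setT (fun z : T => Im (val z)).
  by have /measurable_fun_pairP[] := @measurable_circle_coord R.
have r1 (z : T) : `|Re (val z)| <= 1.
  by rewrite (le_trans (ler_Re_normc _))// -lecR -norm_normc (eqP (valP z)).
have i1 (z : T) : `|Im (val z)| <= 1.
  by rewrite (le_trans (ler_Im_normc _))// -lecR -norm_normc (eqP (valP z)).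
move=> [A mA <-]; rewrite setTI; move: A mA; apply: smallest_sub.
  split.
  - by rewrite preimage_set0; exact: approx_set0.
  - by move=> A hA; rewrite setTD preimage_setC; exact: approx_setC.
  - by move=> A hA; rewrite preimage_bigcup; exact: approx_set_bigcup.
move=> _ [[A mA <-]|[A mA <-]]; rewrite setTI.
- exact: (approx_set_preimage mr bounded_approx_Re r1 mA).
- exact: (approx_set_preimage mi bounded_approx_Im i1 mA).
Qed.

(** Simple functions increasing to g are finite combinations of approximable indicators, and g
    itself dominates the error. *)
Lemma Lp_approx_ge0 (g : T -> R) : measurable_fun setT g -> (forall z, 0 <= g z) ->
  haar.-integrable setT (EFin \o (fun z => g z `^ p)) ->
  Lp_approx p (fun z => (g z)%:C).
Proof.
move=> mg g0 ig; have meg := (measurable_EFinP _ _).2 mg.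
pose G := nnsfun_approx measurableT meg.
pose g_ k : T -> R := G k.
have eg0 z : setT z -> (0 <= (EFin \o g) z)%E by rewrite lee_fin.
have gc z : g_ k z @[k --> \oo] --> g z.
  by have /fine_cvgP[_] := @cvg_nnsfun_approx _ _ _ setT measurableT _ meg eg0 z I.
have g_g k z : g_ k z <= g z.
  have <- : limn (g_^~ z) = g z by apply/cvg_lim => //; exact: gc.
  apply: nondecreasing_cvgn_le; last by apply/cvg_ex; exists (g z); exact: gc.
  by move=> m n mn; exact/lefP/nd_nnsfun_approx.
have gB k z : normc ((g_ k z)%:C - (g z)%:C) = g z - g_ k z.
  by rewrite -rmorphB normc_real distrC ger0_norm// subr_ge0.
apply: (@Lp_approx_lim _ _ p1 (fun k z => (g_ k z)%:C) _ g) => //.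
- move=> k; set s := fset_set (g_ k @` setT).
  suff [] : bounded_approx (fun z => (g_ k z)%:C) by [].
  apply: (@eq_bounded_approx (fun z => \sum_(i < #|` s|%fset)
      (s`_i)%:C * (\1_(g_ k @^-1` [set s`_i]) z)%:C)).
    by move=> z; rewrite [g_ k z](fimfunEord (G k)) rmorph_sum; apply: eq_bigr => i _; rewrite rmorphM.
  move: (#|` s|%fset) => m; elim: m => [|m ih].
    by under eq_fun do rewrite big_ord0; exact: bounded_approx_cst.
  under eq_fun do rewrite big_ord_recr/=; apply: bounded_approxD => //.
  apply: bounded_approxZ; apply: (measurable_approx_set _).2.
  exact: measurable_sfunP.
- move=> z; under eq_fun do rewrite gB.
  have /cvgrPdist_lt gz := gc z; apply/cvgrPdist_lt => e e0.
  by apply: filterS (gz _ e0) => k; rewrite sub0r normrN ger0_norm ?subr_ge0// ger0_norm ?subr_ge0.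
- by move=> k z; rewrite gB gerBl.
Qed.

Lemma Lp_approx_cLfun (f : cLfunType haar p1) : Lp_approx p (val f).
Proof.
have [mr mi] := cLfun_measurable f; have ifp := cLfun_pow_integrable f.
have part (h : T -> R) : measurable_fun setT h -> (forall z, `|h z| <= normc (val f z)) ->
    Lp_approx p (fun z => (h z)%:C).
  have pos (g : T -> R) : measurable_fun setT g -> (forall z, `|g z| <= normc (val f z)) ->
      Lp_approx p (fun z => (Num.max (g z) 0)%:C).
    move=> mg gf; apply: Lp_approx_ge0.
    - exact: measurable_maxr.
    - by move=> z; rewrite le_max lexx orbT.
    - apply: le_integrable ifp => //.
        apply/measurable_EFinP; apply: (measurableT_comp (measurable_powR _)).
        exact: measurable_maxr.
      move=> z _; rewrite /= !ger0_norm ?powR_ge0// lee_fin.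
      apply: ge0_ler_powR; rewrite ?nnegrE ?normc_ge0//.
      + exact: ltW.
      + by rewrite le_max lexx orbT.
      + by rewrite ge_max normc_ge0 andbT (le_trans (ler_norm _)).
  have maxB (x : R) : Num.max x 0 - Num.max (- x) 0 = x.
    have [x0|/ltW x0] := leP 0 x; first by rewrite max_r ?oppr_le0// subr0.
    by rewrite max_l ?oppr_ge0// sub0r opprK.
  move=> mh hf.
  have mhN : measurable_fun setT (fun z => - h z) by exact: measurableT_comp.
  have ah := pos _ mh hf.
  have ahN : Lp_approx p (fun z => (Num.max (- h z) 0)%:C).
    by apply: pos => // z; rewrite normrN.
  have := Lp_approxD p1 _ _ ah (Lp_approxZ p1 (-1) _ ahN).
  rewrite (_ : (fun _ => _ + _) = (fun z => (h z)%:C)).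
    by apply; [|apply: cmeasurableM; first exact: cmeasurable_cst|];
      apply/cmeasurable_real/measurable_maxr.
  apply/funext => z; rewrite mulN1r -rmorphB; congr _%:C.
  exact: maxB.
have ar := part _ mr (fun z => ler_Re_normc _).
have ai := part _ mi (fun z => ler_Im_normc _).
have := Lp_approxD p1 _ _ ar (Lp_approxZ p1 'i%C _ ai).
rewrite (_ : (fun _ => _ + _) = val f).
  by apply; [|apply: cmeasurableM; first exact: cmeasurable_cst|];
    exact: cmeasurable_real.
by apply/funext => z; rewrite -complexE.
Qed.

Lemma trig_dense (u : Lp haar p1) (e : R) : 0 < e ->
  exists s : seq (R[i] * int), nrm (u - \sum_(x <- s) x.1 *: Lpe p1 x.2) <= e.
Proof.
move=> e0; have [s us] := Lp_approx_cLfun (Lp_repr u) e0; exists s.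
rewrite trig_class -[u]Lp_reprK; set f := \sum_(x <- s) _.
have -> : Lp_class (Lp_repr u) - Lp_class f = Lp_class (Lp_repr u - f).
  by apply/eqP; rewrite subr_eq -Lp_classD subrK.
have -> : nrm (Lp_class (Lp_repr u - f)) =
    fine (cLnorm haar p (val (Lp_repr u - f))).
  by apply: complexI; rewrite -normE -Lp_norm_class.
rewrite -lee_fin cLnorm_fine; apply: le_trans us.
rewrite (@eq_cLnorm _ _ _ (fun z => val (Lp_repr u) z - trigfun s z))//.
by move=> z; rewrite -[LHS]/(val (Lp_repr u) z - val f z) val_cLfun_sum.
Qed.

End density.

(** * The binomial series *)

Section binomial_expansion.
Variables (R : realType) (x : R).
Implicit Types (h : R[i]) (s t : R) (k : nat).

(** The generalized binomial coefficient of x over k. *)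
Definition gbin k : R := \prod_(i < k) (x - i%:R) / k`!%:R.

Lemma gbin0 : gbin 0 = 1.
Proof. by rewrite /gbin big_ord0 fact0 divr1. Qed.

Lemma gbinS k : k.+1%:R * gbin k.+1 = (x - k%:R) * gbin k.
Proof.
rewrite /gbin big_ord_recr/= factS natrM invfM.
have k0 : k.+1%:R != 0 :> R by rewrite pnatr_eq0.
have f0 : k`!%:R != 0 :> R by rewrite pnatr_eq0 -lt0n fact_gt0.
by field; rewrite ?natr1 ?nat1r f0 k0.
Qed.

Lemma gbin_neq0 k : (forall i, (i < k)%N -> x != i%:R) -> gbin k != 0.
Proof.
move=> xi; rewrite mulf_neq0 ?invr_eq0 ?pnatr_eq0 -?lt0n ?fact_gt0//.
by apply/prodf_neq0 => i _; rewrite subr_eq0 xi.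
Qed.

Definition bin_sum k h : R[i] := \sum_(a < k.+1) (gbin a)%:C * h ^+ a.

(** The termwise derivative in s of [bin_sum k] at s h. The truncated exponent [a.-1] is harmless at
    a = 0, where the factor [a%:R] vanishes. *)
Let dsum k h s : R[i] := \sum_(a < k.+1) (gbin a)%:C * (a%:R * h ^+ a * (s ^+ a.-1)%:C).

(** P stands for the real and the imaginary part, so that only real functions are differentiated. *)
Lemma is_derive_part (P : R[i] -> R) k h s :
  {morph P : a b / a + b} -> P 0 = 0 -> (forall (r : R) z, P (z * r%:C) = P z * r) ->
  is_derive s 1 (fun t => P (bin_sum k (t%:C * h))) (P (dsum k h s)).
Proof.
move=> PD P0 PZ.
have PS (F : 'I_k.+1 -> R[i]) : P (\sum_(a < k.+1) F a) = \sum_(a < k.+1) P (F a).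
  by apply: (big_morph P).
rewrite (_ : (fun _ => _) = \sum_(a < k.+1) (fun t => P ((gbin a)%:C * h ^+ a) * t ^+ a)).
  rewrite /dsum PS; apply: is_derive_sum => i.
  set c := P ((gbin i)%:C * h ^+ i).
  have -> : (fun t => c * t ^+ i) = horner (c *: 'X^i).
    by apply/funext => t; rewrite hornerE hornerXn.
  apply: is_derive_eq; rewrite derivZ derivXn hornerZ hornerMn hornerXn -mulr_natl.
  rewrite -PZ; congr P.
  by rewrite [(i%:R * _)%:C]rmorphM [in LHS]rmorph_nat; ring.
apply/funext => t; rewrite fct_sumE PS; apply: eq_bigr => i _.
by rewrite -PZ; congr P; rewrite exprMn rmorphXn; ring.
Qed.

(* The truncated binomial series satisfies the differential equation of
   (1 + h)^x up to one term. *)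
Lemma bin_sum_ode k h s :
  (1 + s%:C * h) * dsum k h s =
  x%:C * h * bin_sum k (s%:C * h) - ((x - k%:R) * gbin k)%:C * h ^+ k.+1 * (s ^+ k)%:C.
Proof.
elim: k => [|k ih].
  rewrite /dsum /bin_sum !big_ord1 /= gbin0 mul0r mulr0n rmorph1 !expr0 expr1 subr0 mulr1. ring.
rewrite /dsum /bin_sum [in LHS]big_ord_recr [in RHS]big_ord_recr/= -/(dsum k h s) -/(bin_sum k _).
rewrite !mulrDr ih -(gbinS k).
have -> : (x - k.+1%:R) * gbin k.+1 = x * gbin k.+1 - k.+1%:R * gbin k.+1 by ring.
set g := gbin k.+1.
by rewrite !(rmorphM, rmorphB, rmorphXn, rmorph_nat) exprMn !exprS; ring.
Qed.

Lemma bin_sum_le k h : normc h <= 1 ->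
  normc (bin_sum k h) <= \sum_(a < k.+1) `|gbin a|.
Proof.
move=> h1; apply: le_trans (normc_sum _ _ _) _; apply: ler_sum => a _.
rewrite Normc.normcM normc_real normcX ler_piMr// exprn_ile1//.
exact: normc_ge0.
Qed.

Lemma powR_quarter (D r : R) : 1 / 4 <= D <= 4 -> D `^ r <= 4 `^ `|r|.
Proof.
move=> /andP[D4 D4']; have D0 : 0 < D by lra.
have [r0|r0] := leP 0 r; first by rewrite ger0_norm//; apply: ge0_ler_powR; rewrite ?nnegrE//; lra.
rewrite ltr0_norm// -[r in leLHS]opprK powRN -powR_inv1 ?powR_ge0// powRAC powR_inv1; last exact: ltW.
apply: ge0_ler_powR; rewrite ?nnegrE//; [lra|by rewrite invr_ge0 ltW|].
by rewrite -[leRHS]invrK lef_pV2 ?posrE ?invr_gt0//; lra.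
Qed.

(** The quotient Q(s) of |[bin_sum k] (s h)|^2 by |1 + s h|^(2x) is 1 at s = 0 and would be constant
    for the full series. By [bin_sum_ode] its derivative only contains the remainder, of order
    |h|^(k+1), and the mean value theorem on [0, 1] concludes. The bound 1/2 on |h| keeps |1 + s
    h|^2 between 1/4 and 4, which gives the powers of 4 in the constant. *)
Lemma bin_sum_approx k : exists2 C : R, 0 <= C & forall h, normc h <= 1 / 2 ->
  `|normc (1 + h) `^ (2 * x) - normc (bin_sum k h) ^+ 2| <= C * normc h ^+ k.+1.
Proof.
pose B := \sum_(a < k.+1) `|gbin a|; pose c := (x - k%:R) * gbin k.
have B0 : 0 <= B by apply: sumr_ge0.
exists (4 `^ `|x| * (4 `^ `|- x - 1| * (16 * B * `|c|))).
  by rewrite !mulr_ge0 ?powR_ge0.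
move=> h h2; have nh0 := normc_ge0 h.
pose a s := 1 + s * Re h; pose b s := s * Im h.
pose u s := Re (bin_sum k (s%:C * h)); pose v s := Im (bin_sum k (s%:C * h)).
pose A s := u s * u s + v s * v s; pose D s := a s * a s + b s * b s.
have abE s : 1 + s%:C * h = (a s +i* b s)%C.
  by rewrite /a /b; case: (h) => h1 h2'; apply/eqP; rewrite eq_complex/=; apply/andP; split; apply/eqP; ring.
have DE s : D s = normc (1 + s%:C * h) ^+ 2 by rewrite normc_sqr abE /D /= !expr2.
have sh s : 0 <= s <= 1 -> normc (s%:C * h) <= 1 / 2.
  move=> /andP[s0 s1]; rewrite Normc.normcM normc_real ger0_norm//.
  by apply: le_trans h2; rewrite ler_piMl.
have Dbnd s : 0 <= s <= 1 -> 1 / 2 <= normc (1 + s%:C * h) <= 2.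
  move=> /sh s2; have := normcD 1 (s%:C * h); have := normcB (1 + s%:C * h) (s%:C * h).
  by rewrite addrK Normc.normc1 => ? ?; apply/andP; split; lra.
have D4 s : 0 <= s <= 1 -> 1 / 4 <= D s <= 4.
  move=> /Dbnd /andP[n1 n2]; rewrite DE; apply/andP; split.
    have -> : 1 / 4 = (1 / 2) ^+ 2 :> R by field.
    by rewrite lerXn2r ?nnegrE ?normc_ge0//; lra.
  have -> : 4 = 2 ^+ 2 :> R by ring.
  by rewrite lerXn2r ?nnegrE ?normc_ge0//; lra.
pose d1 s := Re (dsum k h s); pose d2 s := Im (dsum k h s).
have du s : is_derive s 1 u (d1 s).
  apply: is_derive_part => //; first by move=> [? ?] [? ?].
  by move=> r [z1 z2] /=; ring.
have dv s : is_derive s 1 v (d2 s).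
  apply: is_derive_part => //; first by move=> [? ?] [? ?].
  by move=> r [z1 z2] /=; ring.
have da s : is_derive s 1 a (Re h).
  have -> : a = horner (1 + (Re h) *: 'X).
    by apply/funext => t; rewrite !hornerE /a mulrC.
  by apply: (is_derive_eq (is_derive_poly _ s)); rewrite !poly.derivE !hornerE.
have db s : is_derive s 1 b (Im h).
  have -> : b = horner ((Im h) *: 'X).
    by apply/funext => t; rewrite !hornerE /b mulrC.
  by apply: (is_derive_eq (is_derive_poly _ s)); rewrite !poly.derivE !hornerE.
pose dA s := 2 * (u s * d1 s + v s * d2 s); pose dD s := 2 * (a s * Re h + b s * Im h).
have isA s : is_derive s 1 A (dA s).
  apply: (is_derive_eq (is_deriveD (is_deriveM (du s) (du s)) (is_deriveM (dv s) (dv s)))).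
  by rewrite /GRing.scale/= /dA; ring.
have isD s : is_derive s 1 D (dD s).
  apply: (is_derive_eq (is_deriveD (is_deriveM (da s) (da s)) (is_deriveM (db s) (db s)))).
  by rewrite /GRing.scale/= /dD; ring.
pose Q s := A s * D s `^ (- x).
pose dQ s := D s `^ (- x - 1) * (dA s * D s - x * A s * dD s).
have isQ s : 0 <= s <= 1 -> is_derive s 1 Q (dQ s).
  move=> s01; have D0 : 0 < D s by have /andP[? _] := D4 _ s01; lra.
  apply: (is_derive_eq (is_deriveM (isA s)
    (is_derive1_comp (is_derive1_powR (- x) D0) (isD s)))); rewrite /GRing.scale/= /dQ.
  have -> : D s `^ (- x) = D s `^ (- x - 1) * D s.
    rewrite -{3}[D s]powRr1 ?ltW// -powRD ?subrK//.
    by rewrite (gt_eqF D0) implybT.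
  by ring.
have cQ : {within `[0, 1], continuous Q}.
  apply: derivable_within_continuous => s; rewrite in_itv/= => s01.
  by case: (isQ s s01).
have itvW s : s \in `]0, 1[%R -> 0 <= s <= 1.
  by rewrite in_itv/= => /andP[? ?]; apply/andP; split; lra.
have [s s01] := @MVT _ Q dQ 0 1 ltr01 (fun s s01 => isQ s (itvW s s01)) cQ.
have {}s01 := itvW s s01; rewrite subr0 mulr1.
have Q0 : Q 0 = 1.
  have D0 : D 0 = 1 by rewrite DE mul0r addr0 Normc.normc1 expr1n.
  have A0 : A 0 = 1.
    rewrite /A /u /v mul0r.
    have -> : bin_sum k 0 = 1.
      rewrite /bin_sum big_ord_recl/= gbin0 expr0 mulr1 big1 ?addr0// => i _.
      by rewrite expr0n mulr0.
    by rewrite /=; ring.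
  by rewrite /Q A0 D0 powR1 mulr1.
have Q1 : Q 1 = normc (bin_sum k h) ^+ 2 * D 1 `^ (- x).
  by rewrite /Q normc_sqr /A /u /v mul1r !expr2.
rewrite Q0 Q1 => MVTs.
have i1 : 0 <= (1 : R) <= 1 by rewrite ler01 lexx.
have D1p : 0 < D 1 by have /andP[? _] := D4 _ i1; lra.
have -> : normc (1 + h) `^ (2 * x) = D 1 `^ x.
  by rewrite DE mul1r powRrM powR_mulrn ?normc_ge0.
have -> : D 1 `^ x - normc (bin_sum k h) ^+ 2 = - (D 1 `^ x * dQ s).
  rewrite -MVTs powRN mulrBr mulr1 mulrCA mulfV ?mulr1 ?opprB//.
  by rewrite powR_eq0 negb_and gt_eqF.
rewrite normrN normrM (ger0_norm (powR_ge0 _ _)) -!mulrA ler_pM ?powR_ge0//.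
  exact: powR_quarter (D4 _ i1).
rewrite /dQ normrM (ger0_norm (powR_ge0 _ _)) ler_pM ?powR_ge0//.
  exact: powR_quarter (D4 _ s01).
have /andP[_ ab2] := Dbnd _ s01.
have a2 : `|a s| <= 2 by apply: le_trans ab2; rewrite abE; exact: (@ler_Re_normc _ (a s +i* b s)%C).
have b2 : `|b s| <= 2 by apply: le_trans ab2; rewrite abE; exact: (@ler_Im_normc _ (a s +i* b s)%C).
have sh1 : normc (s%:C * h) <= 1 by apply: le_trans (sh _ s01) _; lra.
have uB : `|u s| <= B by apply: le_trans (bin_sum_le k sh1); exact: ler_Re_normc.
have vB : `|v s| <= B by apply: le_trans (bin_sum_le k sh1); exact: ler_Im_normc.
set w := c%:C * h ^+ k.+1 * (s ^+ k)%:C.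
have ww : normc w <= `|c| * normc h ^+ k.+1.
  rewrite !Normc.normcM !normc_real normcX ler_piMr//.
    by rewrite mulr_ge0// exprn_ge0.
  have /andP[s0 s1] := s01.
  by rewrite normrX ger0_norm// exprn_ile1.
have := bin_sum_ode k h s; rewrite -/c -/w abE.
move=> ode.
have /(congr1 (fun z => Re z)) := ode; have /(congr1 (fun z => Im z)) := ode.
move=> {ode}.
have w1 : `|Re w| <= `|c| * normc h ^+ k.+1 by apply: le_trans ww; exact: ler_Re_normc.
have w2 : `|Im w| <= `|c| * normc h ^+ k.+1 by apply: le_trans ww; exact: ler_Im_normc.
move: w1 w2; set W := `|c| * _ => w1 w2.
rewrite !(cReM, cImM, cReD, cImD)/=.
rewrite -/(u s) -/(v s) -/(d1 s) -/(d2 s).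
have ReN z : Re (- z) = - Re z by case: z.
have ImN z : Im (- z) = - Im z by case: z.
rewrite ReN ImN !mul0r subr0 addr0 => oI oR.
(* With b = [bin_sum k] at s h and b' = [dsum k h s], the left side is twice the real part of
   conj((1 + s h) b) ((1 + s h) b' - x h b), and the differential equation turns the last factor
   into - w. *)
have -> : dA s * D s - x * A s * dD s =
   - 2 * (a s * (u s * Re w + v s * Im w) + b s * (u s * Im w - v s * Re w)).
  transitivity (2 * u s * (a s * (a s * d1 s - b s * d2 s) + b s * (a s * d2 s + b s * d1 s))
    + 2 * v s * (a s * (a s * d2 s + b s * d1 s) - b s * (a s * d1 s - b s * d2 s))
    - x * A s * dD s).
    by rewrite /dA /D /A /dD; ring.
  by rewrite oI oR /A /dD; ring.
have W0 : 0 <= W by rewrite mulr_ge0// exprn_ge0.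
have bnd (t1 t2 : R) T1 T2 : `|t1| <= T1 -> `|t2| <= T2 -> `|t1 * t2| <= T1 * T2.
  by move=> ? ?; rewrite normrM ler_pM.
have bndD (t1 t2 : R) T1 T2 : `|t1| <= T1 -> `|t2| <= T2 -> `|t1 + t2| <= T1 + T2.
  by move=> ? ?; apply: le_trans (ler_normD _ _) (lerD _ _).
have bndB (t1 t2 : R) T1 T2 : `|t1| <= T1 -> `|t2| <= T2 -> `|t1 - t2| <= T1 + T2.
  by move=> ? ?; apply: le_trans (ler_normB _ _) (lerD _ _).
have := bnd _ _ _ _ a2 (bndD _ _ _ _ (bnd _ _ _ _ uB w1) (bnd _ _ _ _ vB w2)).
move=> /bndD /(_ (bnd _ _ _ _ b2 (bndB _ _ _ _ (bnd _ _ _ _ uB w2) (bnd _ _ _ _ vB w1)))).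
set z := (X in `|X| <= _) => zW.
rewrite normrM normrN (ger0_norm (ler0n _ 2)).
rewrite -/W.
have BW : 0 <= B * W by rewrite mulr_ge0.
by lra.
Qed.

End binomial_expansion.

(** * Averages over roots of unity *)

Section roots_of_unity.
Variable R : realType.

(** Powers of 2 suffice, as the order only has to be large. The order of a 2^k-th root of -1 divides
    2^(k+1) but not 2^k. *)
Lemma primitive_root_pow2 k : exists2 w : R[i], (2 ^ k.+1).-primitive_root w & `|w| = 1.
Proof.
pose w : R[i] := (2 ^ k).-root (-1).
have k0 : (0 < 2 ^ k)%N by rewrite expn_gt0.
have wk : w ^+ (2 ^ k) = -1 by rewrite rootCK.
exists w; last first.
  apply/eqP; rewrite -(@pexpr_eq1 _ _ (2 ^ k)) ?normr_ge0//.
  by rewrite -normrX wk normrN normr1.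
have w1 : w ^+ (2 ^ k.+1) = 1 by rewrite expnS mulnC exprM wk sqrrN expr1n.
have [|m mw] := prim_order_exists _ w1; first by rewrite expn_gt0.
move=> /(dvdn_pfactor _ _ (isT : prime 2))[j jk mE].
move: jk; rewrite leq_eqVlt => /predU1P[<-|jk]; first by rewrite -mE.
exfalso; have : (m %| 2 ^ k)%N by rewrite mE dvdn_exp2l.
rewrite (prim_order_dvd mw) => /eqP; rewrite wk => /eqP.
by rewrite eqr_oppLR -subr_eq0 opprK -mulr2n pnatr_eq0.
Qed.

Variables (M : nat) (w : R[i]).
Hypothesis wM : M.-primitive_root w.

Lemma sum_root (d : int) :
  \sum_(a < M) (w ^+ a) ^ d = if (M %| `|d|)%N then M%:R else 0.
Proof.
have wd (a : nat) : (w ^+ a) ^ d = (w ^ d) ^+ a.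
  by rewrite !exprnP exprzAC.
under eq_bigr do rewrite wd.
have -> : (M %| `|d|)%N = (w ^ d == 1).
  case: d {wd} => d; first by rewrite (prim_order_dvd wM).
  by rewrite NegzE -exprnN invr_eq1 (prim_order_dvd wM).
have [->|wd1] := eqVneq.
  by under eq_bigr do rewrite expr1n; rewrite sumr_const card_ord.
apply/eqP; have : (w ^ d - 1) * (\sum_(a < M) (w ^ d) ^+ a) == 0.
  by rewrite -subrX1 -wd prim_expr_order// exp1rz subrr.
by rewrite mulf_eq0 subr_eq0 (negbTE wd1).
Qed.

(** Orthogonality of characters on the grid: an exponent below M in absolute value is divisible by M
    only if it is 0. *)
Lemma avg_root n (d : 'I_n -> int) : (forall i, (`|d i| < M)%N) ->
  \sum_(f : {ffun 'I_n -> 'I_M}) \prod_i (w ^+ f i) ^ d i =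
  (M ^ n)%:R * [forall i, d i == 0]%:R.
Proof.
move=> dM; rewrite -(bigA_distr_bigA (fun i (a : 'I_M) => (w ^+ a) ^ d i)).
under eq_bigr => i _ do rewrite sum_root.
have [/forallP d0|/forallPn[i di]] := boolP [forall i, d i == 0].
  under eq_bigr => i _ do rewrite (eqP (d0 i)) dvdn0.
  by rewrite prodr_const card_ord natrX mulr1.
rewrite mulr0; apply/eqP/prodf_eq0; exists i => //.
case: ifPn => // /dvdn_leq; rewrite absz_gt0 => /(_ di).
by rewrite leqNgt dM.
Qed.

End roots_of_unity.

Lemma unimodular_exprz (R : rcfType) (x : R[i]) (d : int) : `|x| = 1 -> `|x ^ d| = 1.
Proof.
by case: d => k x1; rewrite ?NegzE -?exprnN -?exprnP ?normrV ?normrX ?x1 ?expr1n ?invr1//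
  unitfE expf_neq0// -normr_eq0 x1 oner_neq0.
Qed.

Lemma normc_conj (R : rcfType) (x : R[i]) : (normc x ^+ 2)%:C = x * x^*.
Proof. by rewrite rmorphXn; exact: normCK. Qed.

Lemma unimodular_prod (R : rcfType) (I : finType) (F : I -> R[i]) :
  (forall i, `|F i| = 1) -> `|\prod_i F i| = 1.
Proof. by move=> F1; rewrite normr_prod big1. Qed.

(** * Multiplicities of variables in a monomial *)

Section multiplicity.
Variable n : nat.
Implicit Types (i : 'I_n).

Definition mult a (f : {ffun 'I_a -> 'I_n}) i : nat := (\sum_(j < a) (f j == i))%N.

Lemma prod_mult (K : comNzRingType) (y : 'I_n -> K) a (f : {ffun 'I_a -> 'I_n}) :
  \prod_j y (f j) = \prod_i y i ^+ mult f i.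
Proof.
under [RHS]eq_bigr do rewrite /mult expr_sum.
rewrite exchange_big/=; apply: eq_bigr => j _.
rewrite (bigD1 (f j))//= eqxx expr1 big1 ?mulr1// => i.
by rewrite eq_sym => /negbTE ->; rewrite expr0.
Qed.

Lemma sum_mult a (f : {ffun 'I_a -> 'I_n}) : (\sum_i mult f i)%N = a.
Proof.
rewrite /mult exchange_big/= -[RHS]card_ord -sum1_card; apply: eq_bigr => j _.
by rewrite (bigD1 (f j))//= eqxx big1 ?addn0// => i; rewrite eq_sym => /negbTE ->.
Qed.

Lemma mult_surj (m : 'I_n -> nat) :
  exists f : {ffun 'I_(\sum_i m i) -> 'I_n}, mult f =1 m.
Proof.
pose s := flatten [seq nseq (m i) i | i <- enum 'I_n].
have ss : size s == (\sum_i m i)%N.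
  rewrite size_flatten /shape -map_comp sumnE big_map big_enum/=.
  by apply/eqP; apply: eq_bigr => i _; rewrite size_nseq.
exists [ffun j => tnth (Tuple ss) j] => i; rewrite /mult.
have tE a (t : a.-tuple 'I_n) :
  (\sum_(j < a) ([ffun j => tnth t j] j == i) = \sum_(x <- t) (x == i))%N.
  by rewrite big_tuple; apply: eq_bigr => j _; rewrite ffunE.
rewrite tE /=.
rewrite big_flatten big_map big_enum/= (bigD1 i)//= [X in (_ + X)%N]big1 ?addn0.
  by rewrite big_nseq eqxx iter_addn_0 mul1n.
by move=> k ki; rewrite big_nseq (negbTE ki) iter_addn_0.
Qed.

End multiplicity.

(** * Fourier coefficients on the torus, computed on a grid *)

Section torus_average.
Variables (R : realType) (n : nat).
Implicit Types (th : 'I_n -> R[i]) (z : 'I_n -> int) (r : R).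

Definition posp (z : int) : nat := if z is Posz k then k else 0.
Definition negp (z : int) : nat := if z is Negz k then k.+1 else 0.

Lemma posp_negp (z : int) : z = (posp z)%:Z - (negp z)%:Z.
Proof. by case: z => k /=; rewrite ?subr0// sub0r NegzE. Qed.

(** The coefficient of the character with exponents z in h^a conj(h)^b, for h a sum of n independent
    unimodular variables. *)
Definition paircount z a b : nat :=
  (\sum_(f : {ffun 'I_a -> 'I_n}) \sum_(g : {ffun 'I_b -> 'I_n})
     [forall i, ((mult f i)%:Z - (mult g i)%:Z == z i)%R])%N.

(** A monomial with exponents z needs at least the positive part of z from h and the negative part
    from conj(h). This identifies the leading term in r. *)
Lemma paircount_ge z a b : (0 < paircount z a b)%N ->
  (\sum_i posp (z i) <= a)%N /\ (\sum_i negp (z i) <= b)%N.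
Proof.
rewrite lt0n => /eqP; rewrite /paircount.
case: (pickP [pred fg : {ffun 'I_a -> 'I_n} * {ffun 'I_b -> 'I_n} |
    [forall i, (mult fg.1 i)%:Z - (mult fg.2 i)%:Z == z i]]) => [[f g]/= /forallP fg _|none].
  rewrite -[in X in (_ <= X)%N /\ _](sum_mult f) -[in X in _ /\ (_ <= X)%N](sum_mult g).
  split; apply: leq_sum => i _; have /eqP := fg i;
    case: (z i) => k /=; lia.
case; apply: big1 => f _; apply: big1 => g _.
by have /= -> := none (f, g).
Qed.

Lemma paircount_gt0 z :
  (0 < paircount z (\sum_i posp (z i)) (\sum_i negp (z i)))%N.
Proof.
have [f fE] := mult_surj (fun i => posp (z i)).
have [g gE] := mult_surj (fun i => negp (z i)).
rewrite /paircount (bigD1 f)//= (bigD1 g)//= (_ : [forall i, _]) ?addSn//.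
by apply/forallP => i; rewrite fE gE -posp_negp.
Qed.

Variables (M : nat) (w : R[i]).
Hypotheses (wM : M.-primitive_root w) (w1 : `|w| = 1).

Definition torus_sum th r (f : {ffun 'I_n -> 'I_M}) : R[i] :=
  \sum_i r%:C * (w ^+ f i * th i).

Lemma torus_sum_le th r f : 0 <= r -> (forall i, `|th i| = 1) -> normc (torus_sum th r f) <= n%:R * r.
Proof.
move=> r0 th1; apply: le_trans (normc_sum _ _ _) _.
rewrite -[X in X%:R * r]card_ord mulr_natl -sumr_const; apply: ler_sum => i _.
rewrite Normc.normcM normc_real ger0_norm// -[leRHS]mulr1 ler_wpM2l//.
by rewrite -lecR -norm_normc normrM normrX w1 th1 expr1n mulr1.
Qed.

Lemma torus_sum_expand th r f a : torus_sum th r f ^+ a =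
  (r ^+ a)%:C * \sum_(g : {ffun 'I_a -> 'I_n}) \prod_i (w ^+ f i * th i) ^+ mult g i.
Proof.
rewrite -[a in LHS]card_ord -prodr_const /torus_sum.
under eq_bigr => j _ do rewrite -mulr_sumr.
rewrite big_split/= prodr_const card_ord rmorphXn; congr (_ * _).
rewrite (bigA_distr_bigA (fun (j : 'I_a) i => w ^+ f i * th i)).
by apply: eq_bigr => g _; rewrite (prod_mult (fun i => w ^+ f i * th i)).
Qed.

Lemma torus_sum_expandJ th r f a : (forall i, `|th i| = 1) -> (torus_sum th r f)^* ^+ a =
  (r ^+ a)%:C * \sum_(g : {ffun 'I_a -> 'I_n}) \prod_i (w ^+ f i * th i) ^- mult g i.
Proof.
move=> th1; rewrite -rmorphXn torus_sum_expand rmorphM rmorph_sum; congr (_ * _).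
  exact: conjc_real.
apply: eq_bigr => g _; rewrite rmorph_prod; apply: eq_bigr => i _.
apply/esym/unimodularV; by rewrite !(normrX, normrM) th1 w1 !expr1n mulr1 expr1n.
Qed.

Lemma torus_avg th r z a b k : (forall i, `|th i| = 1) ->
  (a + b + k < M)%N -> (forall i, (`|z i| <= k)%N) ->
  \sum_(f : {ffun 'I_n -> 'I_M}) torus_sum th r f ^+ a * (torus_sum th r f)^* ^+ b * \prod_i (w ^+ f i) ^ (- z i) =
  (M ^ n)%:R * (r ^+ (a + b))%:C * (paircount z a b)%:R * \prod_i th i ^ z i.
Proof.
move=> th1 abM zk.
have w0 : w != 0 by rewrite -normr_eq0 w1 oner_eq0.
have th0 i : th i != 0 by rewrite -normr_eq0 th1 oner_eq0.
transitivity (\sum_(f : {ffun 'I_n -> 'I_M}) \sum_(g : {ffun 'I_a -> 'I_n}) \sum_(g' : {ffun 'I_b -> 'I_n})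
    (r ^+ (a + b))%:C * ((\prod_i (w ^+ f i * th i) ^+ mult g i) *
    (\prod_i (w ^+ f i * th i) ^- mult g' i) * \prod_i (w ^+ f i) ^ (- z i))).
  apply: eq_bigr => f _; rewrite torus_sum_expand torus_sum_expandJ// mulrACA -rmorphM -exprD.
  rewrite -mulrA big_distrlr/= mulr_suml mulr_sumr; apply: eq_bigr => g _.
  by rewrite mulr_suml mulr_sumr.
rewrite exchange_big/= /paircount natr_sum [in RHS]mulr_sumr mulr_suml.
apply: eq_bigr => g _.
rewrite exchange_big/= natr_sum [in RHS]mulr_sumr mulr_suml.
apply: eq_bigr => g' _.
pose d i : int := (mult g i)%:Z - (mult g' i)%:Z.
transitivity ((r ^+ (a + b))%:C * \prod_i th i ^ d i *
    \sum_(f : {ffun 'I_n -> 'I_M}) \prod_i (w ^+ f i) ^ (d i - z i)).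
  rewrite mulr_sumr; apply: eq_bigr => f _; rewrite -[RHS]mulrA; congr (_ * _).
  rewrite -!big_split/=; apply: eq_bigr => i _.
  have wf0 : w ^+ f i != 0 by rewrite expf_neq0.
  by rewrite /d !exprMn invfM !expfzDr// !exprnP -!exprnN; ring.
rewrite (avg_root wM); last first.
  move=> i; rewrite /d.
  have : (mult g i <= a)%N by rewrite -[leqRHS](sum_mult g) (bigD1 i)//= leq_addr.
  have : (mult g' i <= b)%N by rewrite -[leqRHS](sum_mult g') (bigD1 i)//= leq_addr.
  by have := zk i; lia.
have -> : [forall i, d i - z i == 0] = [forall i, d i == z i].
  by apply: eq_forallb => i; rewrite subr_eq0.
rewrite -[[forall i, (mult g i)%:Z - _ == z i]]/[forall i, d i == z i].
have [/forallP dz|_] := boolP [forall i, d i == z i]; last by rewrite !(mulr0, mul0r).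
by under eq_bigr => i _ do rewrite (eqP (dz i)); ring.
Qed.

End torus_average.

(** The function |1 + h|^(2x) is not a polynomial on the torus, but it differs by O(r^(k+1)) from
    the squared modulus of a truncated binomial sum, for which the grid average is exact; k = u + v
    is the order of the leading term. *)
Lemma torus_expansion (R : realType) n (x : R) (z : 'I_n -> int) :
  let u := (\sum_i posp (z i))%N in let v := (\sum_i negp (z i))%N in
  gbin x u != 0 -> gbin x v != 0 ->
  exists M (w : R[i]) (c C : R), [/\ (0 < M)%N, `|w| = 1, c != 0, 0 <= C &
    forall (r : R) (th : 'I_n -> R[i]), 0 <= r -> r <= 1 -> n%:R * r <= 1 / 2 ->
      (forall i, `|th i| = 1) ->
      normc (\sum_(f : {ffun 'I_n -> 'I_M}) (normc (1 + torus_sum w th r f) `^ (2 * x))%:C *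
          \prod_i (w ^+ f i) ^ (- z i) -
        (c * r ^+ (u + v))%:C * \prod_i th i ^ z i) <= C * r ^+ (u + v).+1].
Proof.
move=> u v gu gv; set k := (u + v)%N.
have zk i : (`|z i| <= k)%N.
  have : (posp (z i) <= u)%N by rewrite /u (bigD1 i)//= leq_addr.
  have : (negp (z i) <= v)%N by rewrite /v (bigD1 i)//= leq_addr.
  by rewrite {3}(posp_negp (z i)) /k; lia.
(* The exponents to be told apart from 0 are at most a + b + |z i| <= 3 k. *)
have [w wM w1] := primitive_root_pow2 R (3 * k).
set M := (2 ^ (3 * k).+1)%N in wM.
have kM : (3 * k < M)%N by rewrite (leq_trans (ltn_expl _ (isT : 1 < 2)%N))// leq_exp2l.
have [C1 C10 C1P] := bin_sum_approx x k.
pose N : R := (M ^ n)%:R; have N0 : 0 <= N by rewrite ler0n.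
pose c0 a b : R := gbin x a * gbin x b * (paircount z a b)%:R.
pose C2 : R := \sum_(a < k.+1) \sum_(b < k.+1) `|c0 a b|.
exists M, w, (N * c0 u v), (N * (C1 * n%:R ^+ k.+1) + N * C2).
have C20 : 0 <= C2 by apply: sumr_ge0 => a _; apply: sumr_ge0.
split => //; first by rewrite expn_gt0.
- have pc0 : (paircount z u v)%:R != 0 :> R by rewrite pnatr_eq0 -lt0n paircount_gt0.
  have N00 : N != 0 by rewrite pnatr_eq0 -lt0n !expn_gt0.
  by rewrite mulf_neq0// mulf_neq0// mulf_neq0.
- by rewrite addr_ge0// !mulr_ge0// exprn_ge0.
move=> r th r0 r1 rn th1.
pose h (f : {ffun 'I_n -> 'I_M}) := torus_sum w th r f.
pose W (f : {ffun 'I_n -> 'I_M}) := \prod_i (w ^+ f i) ^ (- z i).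
have W1 f : normc (W f) = 1.
  apply: complexI; rewrite -norm_normc; apply: unimodular_prod => i.
  by apply: unimodular_exprz; rewrite normrX w1 expr1n.
pose P := \sum_(a < k.+1) \sum_(b < k.+1) c0 a b * r ^+ (a + b).
have PE : \sum_f (normc (bin_sum x k (h f)) ^+ 2)%:C * W f =
    N%:C * P%:C * \prod_i th i ^ z i.
  transitivity (\sum_f \sum_(a < k.+1) \sum_(b < k.+1)
      (gbin x a * gbin x b)%:C * (h f ^+ a * (h f)^* ^+ b * W f)).
    apply: eq_bigr => f _.
    rewrite normc_conj /bin_sum rmorph_sum big_distrlr/= mulr_suml.
    apply: eq_bigr => a _; rewrite mulr_suml; apply: eq_bigr => b _.
    have -> : ((gbin x b)%:C * h f ^+ b)^* = (gbin x b)%:C * (h f)^* ^+ b.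
      by rewrite rmorphM rmorphXn; congr (_ * _); exact: conjc_real.
    by rewrite [(gbin x a * gbin x b)%:C]rmorphM; ring.
  rewrite exchange_big/= /P rmorph_sum mulr_sumr mulr_suml; apply: eq_bigr => a _.
  rewrite exchange_big/= rmorph_sum mulr_sumr mulr_suml; apply: eq_bigr => b _.
  rewrite -mulr_sumr (@torus_avg _ _ _ _ wM w1 _ _ _ _ _ k)//; last first.
    by have := ltn_ord a; have := ltn_ord b; lia.
  rewrite /c0 /N; move: (gbin x a) (gbin x b) => ga gb.
  by rewrite !rmorphM !rmorph_nat; ring.
(* By [paircount_ge], any other pair (a, b) with a nonzero coefficient satisfies a + b > k. *)
have Pc : `|P - c0 u v * r ^+ k| <= C2 * r ^+ k.+1.
  have uk : (u < k.+1)%N by rewrite ltnS leq_addr.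
  have vk : (v < k.+1)%N by rewrite ltnS leq_addl.
  have -> : c0 u v * r ^+ k = \sum_(a < k.+1) \sum_(b < k.+1)
      (((a : nat, b : nat) == (u, v))%:R * (c0 a b * r ^+ (a + b))).
    rewrite (bigD1 (Ordinal uk))//= (bigD1 (Ordinal vk))//= eqxx mul1r !big1 ?addr0//.
      move=> a au; rewrite big1// => b _; rewrite xpair_eqE.
      by rewrite (_ : (a == u :> nat) = false) ?mul0r//; apply/negbTE.
    move=> b bv; rewrite xpair_eqE.
    by rewrite (_ : (b == v :> nat) = false) ?andbF ?mul0r//; apply/negbTE.
  rewrite /P -sumrB mulr_suml (le_trans (ler_norm_sum _ _ _))//.
  apply: ler_sum => a _; rewrite -sumrB mulr_suml (le_trans (ler_norm_sum _ _ _))//.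
  apply: ler_sum => b _.
  have [_|ab] := eqVneq; first by rewrite mul1r subrr normr0 mulr_ge0// exprn_ge0.
  rewrite mul0r subr0 normrM; have [pc|] := posnP (paircount z a b).
    by rewrite /c0 pc mulr0 normr0 !mul0r.
  move=> /paircount_ge[au bv]; rewrite ler_wpM2l// ger0_norm ?exprn_ge0//.
  apply: ler_wiXn2l => //.
  move: ab au bv; rewrite xpair_eqE -/u -/v /k; move: (a : nat) (b : nat) => a' b'.
  by lia.
have main f : normc ((normc (1 + h f) `^ (2 * x))%:C * W f -
    (normc (bin_sum x k (h f)) ^+ 2)%:C * W f) <= C1 * n%:R ^+ k.+1 * r ^+ k.+1.
  have hn : normc (h f) <= n%:R * r by exact: torus_sum_le.
  rewrite -mulrBl Normc.normcM W1 mulr1 -rmorphB normc_real.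
  rewrite (le_trans (C1P (h f) _)) ?(le_trans hn)//.
  by rewrite -mulrA -exprMn ler_wpM2l// lerXn2r// nnegrE ?normc_ge0// (le_trans _ hn) ?normc_ge0.
rewrite -[X in normc X](subrKA (\sum_f (normc (bin_sum x k (h f)) ^+ 2)%:C * W f)).
apply: le_trans (normcD _ _) _; rewrite [leRHS]mulrDl lerD//.
  rewrite -sumrB (le_trans (normc_sum _ _ _))//.
  rewrite (le_trans (ler_sum _ (fun f _ => main f)))//.
  by rewrite sumr_const card_ffun !card_ord -[leLHS]mulr_natl -!mulrA.
rewrite PE -mulrBl Normc.normcM.
have -> : normc (\prod_i th i ^ z i) = 1.
  apply: complexI; rewrite -norm_normc; apply: unimodular_prod => i.
  exact: unimodular_exprz.
rewrite mulr1 -rmorphM -rmorphB normc_real -mulrA -mulrBr normrM (ger0_norm N0).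
by rewrite -[leRHS]mulrA ler_wpM2l.
Qed.

(** Passing from th to lam th changes the leading term of [torus_expansion] by nu r^k with nu = c
    (mu - 1). The weights [rho] come from pairing the average with conj(nu), so that the main part
    of the change becomes |nu|^2 r^k; [kap] is half of it. *)
Lemma key_family (R : realType) (p : R) m (z : 'I_m.+1 -> int) (lam : 'I_m.+1 -> R[i]) :
  \sum_i z i = 0 ->
  (forall k, (k <= \sum_i posp (z i))%N -> gbin (p / 2) k != 0) ->
  (forall i, `|lam i| = 1) -> \prod_i lam i ^ z i != 1 ->
  exists (I : finType) (c : I -> 'I_m.+1 -> R[i]) (rho : I -> R) (kap : R),
    0 < kap /\ forall th : 'I_m.+1 -> R[i], (forall i, `|th i| = 1) ->
      \prod_i th i ^ z i = 1 ->
      kap <= \sum_a rho a * (normc (\sum_i c a i * (lam i * th i)) `^ p -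
                             normc (\sum_i c a i * th i) `^ p).
Proof.
move=> z0 gz lam1 mu1; set mu := \prod_i _ in mu1.
pose z' (i : 'I_m) := z (lift ord0 i).
have uE : (\sum_i posp (z' i) <= \sum_i posp (z i))%N by rewrite big_ord_recl leq_addl.
(* As the z i sum to 0, their positive and negative masses agree, so one nonvanishing range covers
   both binomial coefficients. *)
have vE : (\sum_i negp (z' i) <= \sum_i posp (z i))%N.
  have : (\sum_i negp (z i))%:Z = (\sum_i posp (z i))%:Z.
    apply/eqP; rewrite eq_sym -subr_eq0 !(big_morph Posz PoszD (erefl _)) -sumrB.
    by rewrite -[X in _ == X]z0; apply/eqP; apply: eq_bigr => i _; rewrite -posp_negp.
  by case=> <-; rewrite [leqRHS]big_ord_recl leq_addl.
have [M [w [c [C [M0 w1 c0 C0 exp]]]]] := torus_expansion (gz _ uE) (gz _ vE).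
set k := (_ + _)%N in exp.
pose nu := c%:C * (mu - 1).
have nu0 : 0 < normc nu.
  by rewrite lt_def normc_ge0 andbT normc_eq0 mulf_neq0 ?subr_eq0// -normc_eq0 normc_real normr_eq0.
(* The choice r = |nu| / D gives r <= 1, m r <= 1/2 and 4 C r <= |nu| together; the last makes the
   two error terms at most half of the main part. *)
pose D : R := 4 * (C + 1) + 2 * m%:R * normc nu + normc nu.
have D0 : 0 < D by rewrite ltr_wpDl// addr_ge0 ?mulr_ge0 ?addr_ge0// ltW.
pose r := normc nu / D.
have r0 : 0 < r by rewrite divr_gt0.
have r1 : r <= 1.
  by rewrite ler_pdivrMr// mul1r /D lerDr addr_ge0 ?mulr_ge0 ?addr_ge0// ltW.
have rm : m%:R * r <= 1 / 2.
  rewrite mulrA ler_pdivrMr// /D.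
  have : 0 <= m%:R * normc nu by rewrite mulr_ge0// ltW.
  by lra.
have rC : 4 * C * r <= normc nu.
  rewrite mulrA ler_pdivrMr// mulrC ler_wpM2l ?(ltW nu0)// /D.
  have : 0 <= m%:R * normc nu by rewrite mulr_ge0// ltW.
  by lra.
pose W (f : {ffun 'I_m -> 'I_M}) := \prod_i (w ^+ f i) ^ (- z' i).
pose cf (f : {ffun 'I_m -> 'I_M}) (i : 'I_m.+1) : R[i] :=
  if unlift ord0 i is Some j then r%:C * w ^+ f j else 1.
exists {ffun 'I_m -> 'I_M}, cf, (fun f => Re (nu^* * W f)), (normc nu ^+ 2 * r ^+ k / 2).
split; first by rewrite divr_gt0// mulr_gt0// exprn_gt0.
pose S th : R[i] := \sum_f (normc (\sum_i cf f i * th i) `^ p)%:C * W f.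
have SE th : (forall i, `|th i| = 1) ->
    normc (S th - (c * r ^+ k)%:C * \prod_i th i ^ z i) <= C * r ^+ k.+1.
  move=> th1; have th0 i : th i != 0 by rewrite -normr_eq0 th1 oner_neq0.
  (* Dividing by th 0 normalizes it to 1 and, since the exponents sum to 0, does not change the
     product of the th i ^ z i. *)
  pose th' i := th (lift ord0 i) / th ord0.
  have th'1 i : `|th' i| = 1 by rewrite normrM normfV !th1 divr1.
  have -> : \prod_i th i ^ z i = \prod_i th' i ^ z' i.
    rewrite big_ord_recl; under [RHS]eq_bigr do rewrite expfzMl.
    rewrite big_split/= mulrC; congr (_ * _).
    under eq_bigr do rewrite exprz_inv.
    rewrite -(big_morph (exprz (th ord0)) (fun a b => expfzDr a b (th0 ord0)) (expr0z _)).
    congr (_ ^ _); rewrite sumrN; apply/eqP; rewrite -addr_eq0.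
    by rewrite -[X in _ == X]z0 [X in _ == X]big_ord_recl.
  have -> : S th = \sum_f (normc (1 + torus_sum w th' r f) `^ (2 * (p / 2)))%:C * W f.
    apply: eq_bigr => f _; rewrite [2 * _]mulrCA mulfV// mulr1; congr ((_ `^ p)%:C * _).
    have -> : \sum_i cf f i * th i = th ord0 * (1 + torus_sum w th' r f).
      rewrite big_ord_recl /cf unlift_none mul1r mulrDr mulr1; congr (_ + _).
      rewrite /torus_sum mulr_sumr; apply: eq_bigr => i _; rewrite liftK /th'.
      by field; rewrite th0.
    rewrite Normc.normcM (_ : normc (th ord0) = 1) ?mul1r//.
    by apply: complexI; rewrite -norm_normc th1.
  exact: exp (ltW r0) r1 rm th'1.
move=> th th1 thz.
have lth1 i : `|lam i * th i| = 1 by rewrite normrM lam1 th1 mulr1.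
have lthz : \prod_i (lam i * th i) ^ z i = mu.
  by under eq_bigr do rewrite expfzMl; rewrite big_split/= thz mulr1.
have := SE _ th1; rewrite thz mulr1; set z1 := S th; set A1 := (X in normc X).
have := SE _ lth1; rewrite lthz; set z2 := S _; set A2 := (X in normc X) => A2le A1le.
have -> : \sum_a Re (nu^* * W a) * (normc (\sum_i cf a i * (lam i * th i)) `^ p -
     normc (\sum_i cf a i * th i) `^ p) = Re (nu^* * (z2 - z1)).
  rewrite /z1 /z2 /S -sumrB mulr_sumr.
  rewrite (big_morph (fun z : R[i] => Re z) (id1 := 0) (op1 := +%R))//; last by move=> [? ?] [? ?].
  apply: eq_bigr => f _; rewrite -mulrBl -rmorphB mulrCA mulrC.
  have -> (x : R) (y : R[i]) : Re (x%:C * y) = x * Re y by case: y => ? ? /=; ring.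
  by [].
have zz : z2 - z1 = nu * (r ^+ k)%:C + (A2 - A1).
  by rewrite /A2 /A1 /nu !rmorphM; ring.
have -> : Re (nu^* * (z2 - z1)) = normc nu ^+ 2 * r ^+ k + Re (nu^* * (A2 - A1)).
  rewrite zz mulrDr cReD; congr (_ + _).
  by rewrite mulrA [_^* * _]mulrC -normc_conj -rmorphM.
have : `|Re (nu^* * (A2 - A1))| <= normc nu * (2 * C * r ^+ k.+1).
  apply: le_trans (ler_Re_normc _) _; rewrite Normc.normcM.
  have -> : normc nu^* = normc nu by apply: complexI; rewrite -!norm_normc norm_conjC.
  rewrite ler_wpM2l ?normc_ge0// (le_trans (normcB _ _))//.
  by have := A1le; have := A2le; lra.
rewrite ler_norml => /andP[+ _].
have : normc nu * (2 * C * r ^+ k.+1) <= normc nu ^+ 2 * r ^+ k / 2.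
  rewrite exprS expr2.
  have := ler_wpM2r (mulr_ge0 (ltW nu0) (exprn_ge0 k (ltW r0))) rC.
  move: (normc nu) (r ^+ k) => a b; lra.
by lra.
Qed.

(** * Norms of trigonometric polynomials *)

Section trig_integrals.
Variables (R : realType) (p : R) (p1 : 1 <= p).
Notation haar := (haar R).
Notation T := (circle R).
Notation X := (Lp haar p1).

Let p_gt0 : 0 < p. Proof. exact: lt_le_trans ltr01 p1. Qed.

Lemma haar_int_trig (I : finType) (c : I -> R[i]) (d : I -> int) (g : T -> R) :
  (forall z, (g z)%:C = \sum_i c i * val z ^ d i) ->
  (\int[haar]_z g z)%:C = \sum_(i | d i == 0) c i.
Proof.
move=> gE; pose F : cLfunType haar p1 := \sum_i c i *: monomial p1 (d i).
have FE z : val F z = (g z)%:C by rewrite gE val_cLfun_sum.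
transitivity (Lpcoef (Lp_class F) 0).
  rewrite /Lpcoef fourier_coef_class /fourier_coef /cintegral oppr0.
  under [in RHS]eq_Rintegral do rewrite expr0z mulr1 FE/=.
  under [X in (_ +i* X)%C]eq_Rintegral do rewrite expr0z mulr1 FE/=.
  by rewrite haar_cst.
rewrite -trig_class Lpcoef_sum [RHS]big_mkcond; apply: eq_bigr => i _.
by rewrite LpcoefZ Lpcoef_Lpe; case: ifP; rewrite ?mulr1 ?mulr0.
Qed.

Lemma conj_circleX (z : T) (d : int) : (val z ^ d)^* = val z ^ (- d).
Proof.
rewrite -unimodularV; last by apply: unimodular_exprz; rewrite (eqP (valP z)).
by rewrite invr_expz.
Qed.

Lemma nrm_trig_even (n : nat) (J : finType) (c : J -> R[i]) (q : J -> int) :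
  p = n.*2%:R ->
  (nrm (\sum_i c i *: Lpe p1 (q i)) `^ p)%:C =
  \sum_(fg : {ffun 'I_n -> J} * {ffun 'I_n -> J} |
      \sum_i q (fg.1 i) - \sum_i q (fg.2 i) == 0)
    (\prod_i c (fg.1 i)) * (\prod_i (c (fg.2 i))^* ).
Proof.
move=> pn; rewrite nrm_trig; apply: haar_int_trig => z.
rewrite pn powR_mulrn ?normc_ge0// -mul2n exprM.
set f := \sum_i _.
have -> : ((normc f ^+ 2) ^+ n)%:C = (f * f^* ) ^+ n by rewrite -normc_conj rmorphXn.
have fE : f ^+ n = \sum_(g : {ffun 'I_n -> J}) (\prod_i c (g i)) * val z ^ (\sum_i q (g i)).
  rewrite -[n in LHS]card_ord -prodr_const (bigA_distr_bigA (fun (j : 'I_n) i => c i * val z ^ q i)).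
  apply: eq_bigr => g _; rewrite big_split/=; congr (_ * _).
  by rewrite (big_morph (exprz (val z)) (fun a b => expfzDr a b (circle_neq0 z)) (expr0z _)).
rewrite exprMn -rmorphXn fE rmorph_sum big_distrlr/= pair_big/=.
apply: eq_bigr => -[g h] _ /=.
have -> : ((\prod_i c (h i)) * val z ^ (\sum_i q (h i)))^* =
    (\prod_i (c (h i))^* ) * val z ^ (- \sum_i q (h i)).
  by rewrite rmorphM rmorph_prod; congr (_ * _); exact: conj_circleX.
by rewrite mulrACA -expfzDr ?circle_neq0.
Qed.

Lemma haar_int_sqr (J : finType) (c : J -> R[i]) (q : J -> int) : injective q ->
  \int[haar]_z (normc (\sum_i c i * val z ^ q i) ^+ 2) = \sum_i normc (c i) ^+ 2.
Proof.
move=> qI; apply: complexI.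
rewrite (@haar_int_trig (J * J)%type (fun ij => c ij.1 * (c ij.2)^* )
    (fun ij => q ij.1 - q ij.2)).
  rewrite (eq_bigl (fun ij => ij.1 == ij.2)); last by move=> ij; rewrite subr_eq0 (inj_eq qI).
  rewrite -(pair_big_dep xpredT (fun i j => i == j) (fun i j => c i * (c j)^* ))/=.
  rewrite rmorph_sum; apply: eq_bigr => i _; rewrite (big_pred1 i).
    exact/esym/normc_conj.
  by move=> j; rewrite /= eq_sym.
move=> z; rewrite normc_conj rmorph_sum big_distrlr/= pair_big/=.
apply: eq_bigr => -[i j] _ /=.
have -> : (c j * val z ^ q j)^* = (c j)^* * val z ^ (- q j).
  by rewrite rmorphM; congr (_ * _); exact: conj_circleX.
by rewrite mulrACA -expfzDr ?circle_neq0.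
Qed.

Lemma trig_pow_integrable (J : finType) (c : J -> R[i]) (q : J -> int) :
  haar.-integrable setT (EFin \o (fun z : T => normc (\sum_i c i * val z ^ q i) `^ p)).
Proof.
have := cLfun_pow_integrable (\sum_i c i *: monomial p1 (q i)).
by under eq_fun do rewrite /= val_cLfun_sum.
Qed.

Lemma Rintegral_sum (J : Type) (s : seq J) (F : J -> T -> R) :
  (forall j, haar.-integrable setT (EFin \o F j)) ->
  haar.-integrable setT (EFin \o (fun z => \sum_(j <- s) F j z)) /\
  \int[haar]_z (\sum_(j <- s) F j z) = \sum_(j <- s) \int[haar]_z F j z.
Proof.
move=> iF; elim: s => [|j s [ih1 ih2]].
  under eq_fun do rewrite big_nil; rewrite big_nil haar_cst; split => //.
  by apply: (@bounded_haar_integrable _ _ 0) => // z; rewrite normr0.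
under eq_fun do rewrite big_cons.
split; first exact: (integrableD measurableT (iF j) ih1).
by rewrite RintegralD// big_cons ih2.
Qed.

(** The bound of [key_family] holds at each point of the circle and so survives integration against
    a probability. The data are fixed before q. *)
Lemma key_nrm m (z : 'I_m.+1 -> int) (lam : 'I_m.+1 -> R[i]) :
  \sum_i z i = 0 ->
  (forall k, (k <= \sum_i posp (z i))%N -> gbin (p / 2) k != 0) ->
  (forall i, `|lam i| = 1) -> \prod_i lam i ^ z i != 1 ->
  exists (I : finType) (c : I -> 'I_m.+1 -> R[i]) (rho : I -> R) (kap : R),
    0 < kap /\ forall q : 'I_m.+1 -> int, \sum_i z i * q i = 0 ->
      kap <= \sum_a rho a * (nrm (\sum_i (lam i * c a i) *: Lpe p1 (q i)) `^ p -
                             nrm (\sum_i c a i *: Lpe p1 (q i)) `^ p).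
Proof.
move=> z0 gz lam1 mu1.
have [I [c [rho [kap [kap0 key]]]]] := key_family z0 gz lam1 mu1.
exists I, c, rho, kap; split => // q zq.
pose F a (x : T) := rho a * (normc (\sum_i (lam i * c a i) * val x ^ q i) `^ p -
  normc (\sum_i c a i * val x ^ q i) `^ p).
have iB a := integrableB measurableT
  (trig_pow_integrable (fun i => lam i * c a i) q) (trig_pow_integrable (c a) q).
have iF a : haar.-integrable setT (EFin \o F a).
  exact: (integrableZl measurableT (rho a) (iB a)).
have [i1 i2] := Rintegral_sum (index_enum I) iF.
have -> : \sum_a rho a * (nrm (\sum_i (lam i * c a i) *: Lpe p1 (q i)) `^ p -
    nrm (\sum_i c a i *: Lpe p1 (q i)) `^ p) = \int[haar]_x (\sum_a F a x).
  rewrite i2; apply: eq_bigr => a _.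
  rewrite /F RintegralZl//; last exact: (iB a).
  rewrite RintegralB//; [|exact: trig_pow_integrable..].
  by rewrite !nrm_trig.
rewrite -[leLHS]haar_cst; apply: le_Rintegral => //.
  by apply: (@bounded_haar_integrable _ _ `|kap|).
move=> x _; have := key (fun i => val x ^ q i).
have x1 i : `|val x ^ q i| = 1 by apply: unimodular_exprz; rewrite (eqP (valP x)).
move=> /(_ x1) H; apply: le_trans (H _) _.
  under eq_bigr do rewrite exprz_exp mulrC.
  rewrite -(big_morph (exprz (val x)) (fun a b => expfzDr a b (circle_neq0 x)) (expr0z _)).
  by rewrite zq expr0z.
rewrite le_eqVlt; apply/orP; left; apply/eqP; apply: eq_bigr => a _.
congr (_ * (normc _ `^ _ - _)); apply: eq_bigr => i _.
by rewrite mulrA [c a i * _]mulrC.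
Qed.

(* Interpolating |g|^p <= |g| <= t + |g|^2 / t for |g| <= 1. *)
Lemma nrm_average (J : finType) (c : J -> R[i]) (q : J -> int) (t : R) :
  injective q -> (0 < #|J|)%N -> (forall i, normc (c i) = 1) -> 0 < t ->
  (nrm (\sum_i c i *: Lpe p1 (q i)) / #|J|%:R) `^ p <= t + (t * #|J|%:R)^-1.
Proof.
move=> qI J0 c1 t0; set N : R := #|J|%:R; have N0 : 0 < N by rewrite ltr0n.
pose d i := (N^-1)%:C * c i.
have d1 i : normc (d i) = N^-1.
  by rewrite Normc.normcM c1 mulr1 normc_real ger0_norm// invr_ge0 ltW.
have -> : nrm (\sum_i c i *: Lpe p1 (q i)) / N = nrm (\sum_i d i *: Lpe p1 (q i)).
  under [in RHS]eq_bigr do rewrite -scalerA.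
  by rewrite -scaler_sumr nrmZ normc_real ger0_norm ?invr_ge0 ?ltW// mulrC.
rewrite nrm_trig.
pose g (z : T) := normc (\sum_i d i * val z ^ q i).
have g1 z : g z <= 1.
  apply: le_trans (normc_sum _ _ _) _.
  under eq_bigr do rewrite Normc.normcM normc_circle_pow mulr1 d1.
  by rewrite sumr_const -mulr_natl mulfV ?gt_eqF.
have g0 z : 0 <= g z by exact: normc_ge0.
have mg : measurable_fun setT g.
  apply: measurable_normc.
  have := cLfun_measurable (\sum_i d i *: monomial p1 (q i)).
  by rewrite (_ : val _ = fun z => \sum_i d i * val z ^ q i)//; apply/funext => z; rewrite val_cLfun_sum.
have i2 : haar.-integrable setT (EFin \o (fun z : T => g z ^+ 2)).
  apply: (@bounded_haar_integrable _ _ 1); first exact: measurable_funX.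
  by move=> z; rewrite ger0_norm ?exprn_ge0// exprn_ile1.
have it : haar.-integrable setT (EFin \o (fun z : T => t)).
  by apply: (@bounded_haar_integrable _ _ `|t|).
have i3 := integrableZl measurableT t^-1 i2.
apply: (@le_trans _ _ (\int[haar]_z (t + t^-1 * g z ^+ 2))).
  apply: le_Rintegral => //.
  - exact: trig_pow_integrable.
  - exact: (integrableD measurableT it i3).
  move=> z _; rewrite -/(g z).
  apply: (@le_trans _ _ (g z)).
    have [->|gz] := eqVneq (g z) 0; first by rewrite powR0 ?gt_eqF.
    apply: ge1r_powR => //; rewrite g1 andbT lt_def gz g0//.
  rewrite -subr_ge0 -(pmulr_rge0 _ t0) mulrBr mulrDr mulrA mulfV ?gt_eqF// mul1r.
  have : 0 <= (t - g z / 2) ^+ 2 by exact: sqr_ge0.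
  have : 0 <= g z ^+ 2 by exact: sqr_ge0.
  by lra.
rewrite RintegralD// haar_cst RintegralZl// haar_int_sqr//.
under eq_bigr do rewrite d1.
rewrite sumr_const -mulr_natl expr2 mulrA mulfV ?gt_eqF// mul1r invfM.
by [].
Qed.

End trig_integrals.

(** * Finite-rank operators *)

Section finite_rank.
Variables (R : realType) (V : normedModType R[i]).

Definition independent r (b : 'I_r -> V) : Prop :=
  forall a : 'I_r -> R[i], \sum_i a i *: b i = 0 -> forall i, a i = 0.

(** On the compact unit sphere of coefficient vectors the norm of the combination attains its
    minimum, which independence makes positive. Coefficients are split into real and imaginary parts
    to work in a real row space. *)
Lemma independent_bound r (b : 'I_r -> V) : independent b ->
  exists2 C : R, 0 <= C & forall (a : 'I_r -> R[i]) i, normc (a i) <= C * nrm (\sum_i a i *: b i).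
Proof.
case: r b => [|r] b bI; first by exists 0 => // a [].
pose cpx (x : 'rV[R]_(r.+1 + r.+1)) (i : 'I_r.+1) : R[i] :=
  (x 0 (lshift _ i) +i* x 0 (rshift _ i))%C.
pose f x := nrm (\sum_i cpx x i *: b i).
have cpxB x y i : cpx (x - y) i = cpx x i - cpx y i by rewrite /cpx !mxE.
have cpxZ (s : R) x i : cpx (s *: x) i = s%:C * cpx x i.
  by rewrite /cpx !mxE; apply/eqP; rewrite eq_complex/=; apply/andP; split; apply/eqP; ring.
have entry (x : 'rV[R]_(r.+1 + r.+1)) j : `|x 0 j| <= `|x|.
  by rewrite [leRHS]mx_normrE; apply: (le_bigmax _ (fun ij => `|x ij.1 ij.2|) (0, j)).
have cpx_le x i : normc (cpx x i) <= 2 * `|x|.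
  rewrite [cpx x i]complexE; apply: le_trans (normcD _ _) _.
  rewrite Normc.normcM !normc_real/= expr0n expr1n/= add0r sqrtr1 mul1r.
  by have := entry x (lshift _ i); have := entry x (rshift _ i); lra.
pose B := \sum_i nrm (b i).
have fB x : f x <= 2 * `|x| * B.
  apply: le_trans (nrm_sum _ _ _) _; rewrite mulr_sumr; apply: ler_sum => i _.
  by rewrite nrmZ ler_wpM2r ?nrm_ge0.
have fL x y : `|f x - f y| <= 2 * `|x - y| * B.
  apply: le_trans (nrm_dist _ _) _; apply: le_trans (fB _); rewrite /f -sumrB.
  by under eq_bigr do rewrite -scalerBl -cpxB.
have cf : continuous f.
  move=> x; apply/(@cvgrPdist_lt _ _ _ (nbhs x) (nbhs_filter x)) => e e0.
  have B0 : 0 <= B by apply: sumr_ge0 => i _; exact: nrm_ge0.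
  have d0 : 0 < e / (2 * (B + 1)) by rewrite divr_gt0// mulr_gt0// ltr_wpDl.
  apply/nbhs_ballP; exists (e / (2 * (B + 1))) => //= y; rewrite -ball_normE/= => xy.
  apply: le_lt_trans (fL _ _) _; rewrite -mulrA mulrCA.
  apply: (@le_lt_trans _ _ (`|x - y| * (2 * (B + 1)))).
    by rewrite ler_wpM2l//; lra.
  by rewrite -ltr_pdivlMr// mulr_gt0// ltr_wpDl.
have [x0 x0A x0min] : exists2 c, c \in [set x : 'rV[R]_(r.+1 + r.+1) | `|x| = 1] &
    forall t, t \in [set x : 'rV[R]_(r.+1 + r.+1) | `|x| = 1] -> f c <= f t.
  apply: EVT_min_rV.
  - exists (const_mx 1) => /=; rewrite [LHS]mx_normrE; apply/eqP; rewrite eq_le; apply/andP; split.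
      by apply/bigmax_leP; split => // i _; rewrite mxE normr1.
    by apply/bigmax_geP; right; exists (0, ord0) => //=; rewrite mxE normr1.
  - apply: bounded_closed_compact.
      exists 1; split => // M M1 x /= ->; exact: ltW.
    rewrite (_ : [set _ | _] = (fun x : 'rV[R]_(r.+1 + r.+1) => `|x|) @^-1` [set 1])//.
    apply: closed_comp => [x _|]; [exact: norm_continuous|exact: closed_eq].
  - exact: continuous_subspaceT.
have fx0 : 0 < f x0.
  rewrite lt_def nrm_ge0 andbT; apply/eqP => fx0.
  have cx0 := bI _ (nrm0_eq0 fx0).
  have : x0 = 0.
    apply/rowP => j; rewrite mxE; case: (split_ordP j) => i ->;
      by have := cx0 i; rewrite /cpx => -[].
  by move=> x00; move: (set_mem x0A); rewrite /= x00 normr0 => /eqP; rewrite eq_sym oner_eq0.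
exists (2 / f x0); first by rewrite divr_ge0// ltW.
move=> a i.
pose x : 'rV[R]_(r.+1 + r.+1) := row_mx (\row_i Re (a i)) (\row_i Im (a i)).
have xE j : cpx x j = a j.
  by rewrite /cpx /x row_mxEl row_mxEr !mxE; case: (a j).
have fxE : f x = nrm (\sum_i a i *: b i) by rewrite /f; under eq_bigr do rewrite xE.
rewrite -fxE -xE; apply: le_trans (cpx_le _ _) _.
have [->|x_neq0] := eqVneq x 0; first by rewrite normr0 mulr0 mulr_ge0 ?nrm_ge0// divr_ge0// ltW.
have nx0 : 0 < `|x| by rewrite normr_gt0.
have nx1 : [set x : 'rV[R]_(r.+1 + r.+1) | `|x| = 1] (`|x|^-1 *: x).
  by rewrite /= normrZ normfV normr_id mulVf ?gt_eqF.
have := x0min _ (mem_set nx1).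
have -> : f (`|x|^-1 *: x) = `|x|^-1 * f x.
  rewrite /f; under eq_bigr do rewrite cpxZ -scalerA.
  by rewrite -scaler_sumr nrmZ normc_real ger0_norm// invr_ge0.
rewrite ler_pdivlMl// => xx0.
by rewrite -mulrA ler_wpM2l// ler_pdivlMl// mulrC.
Qed.

(** A shortest spanning family is independent: a vector with nonzero coefficient in a relation could
    be eliminated. *)
Lemma independent_family (T : V -> V) : finite_rank T ->
  exists r (b : 'I_r -> V), independent b /\
    forall y, exists a : 'I_r -> R[i], T y = \sum_i a i *: b i.
Proof.
move=> fT.
have exP : exists r, `[< exists b : 'I_r -> V,
    forall y, exists a : 'I_r -> R[i], T y = \sum_i a i *: b i >].
  by have [r [b H]] := fT; exists r; apply/asboolP; exists b.
have [r /asboolP[b Tb] rmin] := ex_minnP exP.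
exists r, b; split => // a ab0 i; apply/eqP/negP => /negP ai0.
case: r b Tb rmin a ab0 i ai0 => [|r] b Tb rmin a ab0 i ai0; first by case: i ai0.
suff /rmin : `[< exists b : 'I_r -> V,
    forall y, exists a : 'I_r -> R[i], T y = \sum_i a i *: b i >] by rewrite ltnn.
apply/asboolP; exists (b \o lift i) => y; have [c Tc] := Tb y.
exists (fun j => c (lift i j) - c i * (a i)^-1 * a (lift i j)).
have bi : b i = - \sum_j ((a i)^-1 * a (lift i j)) *: b (lift i j).
  apply: (scalerI ai0); rewrite scalerN scaler_sumr.
  apply/eqP; rewrite -addr_eq0 -[X in _ == X]ab0 (bigD1_ord i)//=; apply/eqP; congr (_ + _).
  by apply: eq_bigr => j _; rewrite scalerA mulrA mulfV// mul1r.
rewrite Tc (bigD1_ord i)//= bi scalerN scaler_sumr addrC -sumrB.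
by apply: eq_bigr => j _; rewrite scalerA mulrA -scalerBl.
Qed.

(** In [finite_rank] the coefficients are arbitrary functions of y; over an independent family they
    are forced to be linear, and bounded by [independent_bound]. *)
Lemma bounded_finite_rank (T : {linear V -> V}) : bounded_op T -> finite_rank T ->
  exists r (b : 'I_r -> V) (phi : 'I_r -> V -> R[i]) (K : R),
    [/\ forall y, T y = \sum_i phi i y *: b i,
        forall i c u v, phi i (c *: u + v) = c * phi i u + phi i v
      & forall i y, normc (phi i y) <= K * nrm y].
Proof.
move=> [c0 Tc] /independent_family[r [b [bI /choice[phi Tphi]]]].
have [C C0 CP] := independent_bound bI.
exists r, b, (fun i y => phi y i), (C * Re c0); split => //.
- move=> i c u v; apply/eqP; rewrite -subr_eq0; apply/eqP.
  apply: (bI (fun i => phi (c *: u + v) i - (c * phi u i + phi v i))).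
  under eq_bigr do rewrite scalerBl scalerDl -scalerA.
  by rewrite sumrB big_split/= -scaler_sumr -!Tphi linearP subrr.
- move=> i y; apply: le_trans (CP (phi y) i) _; rewrite -Tphi -mulrA ler_wpM2l//.
  have := Tc y; rewrite !normE; case: c0 Tc => x1 x2 _.
  by rewrite lecE/= => /andP[_]; rewrite mulr0 subr0.
Qed.

End finite_rank.

(** * Necessity *)

Section LpE_characters.
Variables (R : realType) (p : R) (p1 : 1 <= p) (E : set int).
Notation haar := (haar R).
Notation Y := (LpE p1 E).

Let p_gt0 : 0 < p. Proof. exact: lt_le_trans ltr01 p1. Qed.

Lemma Lpe_spectrum q : E q -> Lpe p1 q \in spectrum_in E.
Proof.
move=> Eq; apply/asboolP => n En; rewrite -[LHS]/(Lpcoef _ _) Lpcoef_Lpe.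
by case: eqP => // qn; rewrite -qn in En.
Qed.

(** Outside E the value is 0 by default; where such frequencies arise in [mult_op_finite_rank],
    their coefficients vanish. *)
Definition LpEe (q : int) : Y := insubd 0 (Lpe p1 q).

Lemma val_LpEe q : E q -> val (LpEe q) = Lpe p1 q.
Proof. by move=> Eq; rewrite val_insubd Lpe_spectrum. Qed.

Lemma nrm_val (y : Y) : nrm y = nrm (val y).
Proof. by []. Qed.

Lemma nrm_LpEe q : E q -> nrm (LpEe q) = 1.
Proof. by move=> Eq; rewrite nrm_val val_LpEe// nrm_Lpe. Qed.

Lemma val_LpE_sum (I : Type) (s : seq I) (P : pred I) (F : I -> Y) :
  val (\sum_(i <- s | P i) F i) = \sum_(i <- s | P i) val (F i).
Proof. by apply: (big_morph (fun y : Y => val y)). Qed.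

Lemma val_LpE_trig (I : finType) (c : I -> R[i]) (q : I -> int) : (forall i, E (q i)) ->
  val (\sum_i c i *: LpEe (q i)) = \sum_i c i *: Lpe p1 (q i).
Proof.
move=> Eq; rewrite val_LpE_sum; apply: eq_bigr => i _.
by rewrite -[LHS]/(c i *: val (LpEe (q i))) val_LpEe.
Qed.

(** Given N characters with |phi| >= d, rotate each so that phi becomes positive on it: phi of their
    sum is at least N d, while by [nrm_average] the norm of the sum is o(N). *)
Lemma finite_large_values (phi : Y -> R[i]) (K d : R) :
  (forall c u v, phi (c *: u + v) = c * phi u + phi v) ->
  (forall y, normc (phi y) <= K * nrm y) -> 0 < d ->
  finite_set [set q | E q /\ d <= normc (phi (LpEe q))].
Proof.
move=> phiP phiK d0; apply: contrapT => /infinite_set_fset inf.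
have phi0 : phi 0 = 0.
  by have := phiP (-1) 0 0; rewrite scaler0 addr0 mulN1r addNr.
have phi_sum (I : finType) (c : I -> R[i]) (F : I -> Y) :
    phi (\sum_i c i *: F i) = \sum_i c i * phi (F i).
  by elim/big_rec2 : _ => [//|i x y _ <-]; rewrite phiP.
pose K1 := `|K| + 1; have K10 : 0 < K1 by rewrite ltr_wpDl.
have phiK1 y : normc (phi y) <= K1 * nrm y.
  apply: le_trans (phiK y) _; rewrite ler_wpM2r ?nrm_ge0//.
  by apply: le_trans (ler_norm K) _; rewrite lerDl.
(* For N >= t^-2 characters the mean has norm to the p at most t + 1 / (t N) <= 2 t, whereas the
   lower bound is (d / K1)^p = 3 t. *)
pose t := (d / K1) `^ p / 3; have t0 : 0 < t by rewrite divr_gt0// powR_gt0// divr_gt0.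
have [X XE XN] := inf (Num.bound (t ^- 2)).
pose N := #|{: X}|; have N0 : (0 < N)%N by rewrite /N -cardfE (leq_trans _ XN).
have Nt : t ^- 2 <= N%:R :> R.
  rewrite /N -cardfE; apply: (@le_trans _ _ (Num.bound (t ^- 2))%:R).
    by rewrite ltW// archi_boundP// invr_ge0 exprn_ge0// ltW.
  by rewrite ler_nat.
have qE (i : X) : E (fsval i) /\ d <= normc (phi (LpEe (fsval i))).
  exact: XE (fsvalP i).
have phin0 (i : X) : normc (phi (LpEe (fsval i))) != 0.
  by have [_ di] := qE i; rewrite gt_eqF// (lt_le_trans d0).
pose c (i : X) : R[i] := (normc (phi (LpEe (fsval i))))%:C / phi (LpEe (fsval i)).
have c1 i : normc (c i) = 1.
  by rewrite Normc.normcM Normc.normcV normc_real ger0_norm ?normc_ge0// mulfV.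
have := nrm_average p1 (val_inj : injective (@fsval _ X)) N0 c1 t0; rewrite -/N.
have -> : \sum_i c i *: Lpe p1 (fsval i) = val (\sum_i c i *: LpEe (fsval i)).
  by rewrite val_LpE_trig// => i; have [] := qE i.
rewrite -nrm_val; set y := \sum_i _.
have : N%:R * d <= K1 * nrm y.
  apply: le_trans (phiK1 y); rewrite /y phi_sum.
  under eq_bigr => i _.
    rewrite /c divfK; last by rewrite -normc_eq0.
  over.
  rewrite -rmorph_sum normc_real ger0_norm; last by apply: sumr_ge0 => i _; exact: normc_ge0.
  rewrite mulr_natl -sumr_const; apply: ler_sum => i _; by have [] := qE i.
have NR0 : 0 < N%:R :> R by rewrite ltr0n.
rewrite -ler_pdivrMl// => dK.
have {}dK : d / K1 <= nrm y / N%:R.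
  by rewrite ler_pdivlMr// (_ : d / K1 * _ = K1^-1 * (N%:R * d))//; ring.
have : (d / K1) `^ p <= (nrm y / N%:R) `^ p.
  apply: ge0_ler_powR; rewrite ?nnegrE ?divr_ge0 ?nrm_ge0//; exact: ltW.
move=> /le_trans h /h.
have -> : (d / K1) `^ p = 3 * t by rewrite /t; field.
have : (t * N%:R)^-1 <= t.
  by rewrite -[leLHS]div1r (ler_pdivrMr _ _ (mulr_gt0 t0 NR0)) mulrA -expr2 -ler_pdivrMl ?exprn_gt0// mulr1.
by lra.
Qed.

End LpE_characters.

Lemma powR_lipschitz (R : realType) (p D x y : R) : 1 <= p ->
  0 <= x <= D -> 0 <= y <= D -> `|x `^ p - y `^ p| <= p * D `^ (p - 1) * `|x - y|.
Proof.
move=> p1.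
wlog yx : x y / y <= x => [wlg|].
  by have [/wlg//|/ltW /wlg yx ? ?] := leP y x; rewrite distrC (distrC x y) yx.
move=> /andP[x0 xD] /andP[y0 yD]; have p0 : 0 < p by exact: lt_le_trans p1.
have pb a : 0 <= a -> a <= D -> a `^ (p - 1) <= D `^ (p - 1).
  by move=> a0 aD; apply: ge0_ler_powR; rewrite ?nnegrE ?subr_ge0//; exact: le_trans aD.
have D0 : 0 <= D `^ (p - 1) by exact: powR_ge0.
(* The derivative of the power is only available at positive points, so y = 0 is treated by hand. *)
move: y0; rewrite le_eqVlt => /predU1P[<-|y0].
  rewrite powR0 ?gt_eqF// !subr0 !ger0_norm ?powR_ge0//.
  have [->|xn0] := eqVneq x 0; first by rewrite powR0 ?gt_eqF// mulr0.
  have -> : x `^ p = x `^ (p - 1) * x.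
    by rewrite -{3}[x]powRr1// -powRD ?subrK// xn0 implybT.
  rewrite ler_wpM2r//; apply: le_trans (pb _ x0 xD) _.
  by rewrite ler_peMl.
rewrite !ger0_norm ?subr_ge0//; last first.
  by apply: ge0_ler_powR; rewrite ?nnegrE ?(ltW y0) ?(ltW p0).
have dP (t : R) : 0 < t -> is_derive t 1 (fun u : R => u `^ p) (p * t `^ (p - 1)) by move=> t0; exact: is_derive1_powR.
have [||c] := @MVT_segment R (fun u : R => u `^ p) (fun t => p * t `^ (p - 1)) y x yx.
- by move=> t; rewrite in_itv/= => /andP[yt _]; apply: dP; exact: lt_trans yt.
- apply: derivable_within_continuous => t; rewrite in_itv/= => /andP[yt _].
  by have [] := dP t (lt_le_trans y0 yt).
rewrite in_itv/= => /andP[yc cx] ->; rewrite ler_wpM2r ?subr_ge0//.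
rewrite ler_wpM2l ?(ltW p0)// pb//; first by rewrite (le_trans (ltW y0)).
exact: le_trans cx xD.
Qed.

Section cut.
Variables (R : realType) (V : normedModType R[i]) (S : set R[i]).

(** With multipliers 1 up to some index and mu beyond it, the sum telescopes to T y + mu (T_n y - T
    y), and T_n y tends to y. *)
Lemma umap_cut (e h : R) (ys : seq V) : umap V S -> 0 < e -> 0 < h ->
  S 1 -> (forall mu, S mu -> `|mu| = 1) ->
  exists T : {linear V -> V}, [/\ bounded_op T, finite_rank T,
    forall y, y \in ys -> nrm (T y - y) <= h &
    forall mu y, S mu -> nrm (T y + mu *: (y - T y)) <= (1 + e) * nrm y].
Proof.
move=> uV e0 h0 S1 Su; have e0C : 0 < e%:C by rewrite ltcR.
have [T [T0 Tf Tcvg TS]] := uV _ e0C.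
have [K KP] : exists K, forall y, y \in ys -> forall k, (K <= k)%N -> nrm (T k y - y) <= h.
  elim: ys => [|y ys [K KP]]; first by exists 0%N.
  have /cvg_nrm/(_ _ h0)[L LP] := Tcvg y.
  exists (maxn K L) => x; rewrite inE => /predU1P[->|xys] k; rewrite geq_max => /andP[Kk Lk].
    by rewrite nrmBC ltW// LP.
  exact: KP.
(* The index K + 1 is used because boundedness and finite rank are given from index 1 on. *)
have [bT fT] := Tf K.+1 isT; exists (T K.+1); split => //.
  by move=> y yys; apply: KP.
move=> mu y Smu; set L := nrm _.
rewrite -[leRHS]addr0; apply/ler_addgt0Pr => d d0; rewrite addr0.
have /cvg_nrm/(_ _ d0)[M MP] := Tcvg y.
pose n := maxn K.+1 M.
have eS k : S (if (k <= K.+1)%N then 1 else mu) by case: ifP.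
have := TS n _ eS y; rewrite big_add1/=.
have -> : \sum_(0 <= k < n) (if (k < K.+1)%N then 1 else mu) *: (T k.+1 y - T k y) =
    T K.+1 y + mu *: (T n y - T K.+1 y).
  have Kn : (K.+1 <= n)%N by rewrite leq_maxl.
  rewrite (big_cat_nat _ Kn)//=; congr (_ + _).
    rewrite big_nat_cond; under eq_bigr => k do rewrite andbT => /andP[_ ->].
    under eq_bigr do rewrite scale1r.
    by rewrite -big_nat_cond telescope_sumr// T0 subr0.
  rewrite big_nat_cond; under eq_bigr => k do rewrite andbT leqNgt => /andP[/negbTE -> _].
  by rewrite -scaler_sumr -big_nat_cond telescope_sumr.
rewrite !normE -(rmorph1 (real_complex R)) -rmorphD -rmorphM lecR => H.
rewrite /L (_ : T K.+1 y + _ = T K.+1 y + mu *: (T n y - T K.+1 y) + mu *: (y - T n y)).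
  apply: le_trans (nrmD _ _) (lerD H _).
  have -> : nrm (mu *: (y - T n y)) = nrm (y - T n y).
    by rewrite nrmZ (_ : normc mu = 1) ?mul1r//; apply: complexI; rewrite -norm_normc Su.
  by rewrite ltW// MP// leq_maxr.
by rewrite -addrA -scalerDr; congr (_ + _ *: _); rewrite [RHS]addrC subrKA.
Qed.

End cut.

Section necessity.
Variables (R : realType) (p : R) (p1 : 1 <= p) (E : set int).
Notation Y := (LpE p1 E).

Let p_gt0 : 0 < p. Proof. exact: lt_le_trans ltr01 p1. Qed.

Lemma finite_large_images (T : {linear Y -> Y}) (h : R) : 0 < h ->
  bounded_op T -> finite_rank T ->
  exists G : set int, [/\ finite_set G, G `<=` E &
    forall q, (E `\` G) q -> nrm (T (LpEe p1 E q)) <= h].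
Proof.
move=> h0 bT fT; have [r [b [phi [K [Tb phiP phiK]]]]] := bounded_finite_rank bT fT.
pose B := \sum_i nrm (b i) + 1.
have B0 : 0 < B by rewrite ltr_wpDl// sumr_ge0// => i _; exact: nrm_ge0.
pose d := h / B; have d0 : 0 < d by rewrite divr_gt0.
exists (\bigcup_(i in [set: 'I_r]) [set q | E q /\ d <= normc (phi i (LpEe p1 E q))]).
split.
- by apply: bigcup_finite => // i _; exact: finite_large_values (phiP i) (phiK i) d0.
- by move=> q [i _ []].
move=> q [Eq Gq]; rewrite Tb; apply: le_trans (nrm_sum _ _ _) _.
apply: (@le_trans _ _ (\sum_i d * nrm (b i))).
  apply: ler_sum => i _; rewrite nrmZ ler_wpM2r ?nrm_ge0// leNgt; apply/negP => di.
  by apply: Gq; exists i => //; split => //; exact: ltW.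
rewrite -mulr_sumr /d mulrAC ler_pdivrMr// ler_wpM2l ?(ltW h0)//.
by rewrite /B lerDl.
Qed.

Lemma umap_block_independent (S : set R[i]) (P : int -> Prop) (n : nat) :
  (forall k, (k <= n)%N -> gbin (p / 2) k != 0) ->
  S 1 -> (forall mu, S mu -> `|mu| = 1) -> (forall mu, S mu -> S mu^-1) ->
  (forall s, P s -> exists2 mu, S mu & mu ^ s != 1) ->
  umap Y S -> block_independent P E n.
Proof.
move=> gb S1 Su SV SP uY m; case: m => // m zeta _ zeta0 sum0 sumn j /andP[j0 jm] Ps pp Epp.
have [mu Smu mus] := SP _ Ps.
have mu1 := Su _ Smu; have mu_neq0 : mu != 0 by rewrite -normr_eq0 mu1 oner_neq0.
pose lam (i : 'I_m.+1) : R[i] := if (i < j)%N then 1 else mu.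
have lam1 i : `|lam i| = 1 by rewrite /lam; case: ifP; rewrite ?normr1.
have posn : (\sum_i posp (zeta i) <= n)%N.
  have eqpn : (\sum_i posp (zeta i))%:Z = (\sum_i negp (zeta i))%:Z.
    apply/eqP; rewrite -subr_eq0 !(big_morph Posz PoszD (erefl _)) -sumrB.
    by rewrite -[X in _ == X]sum0; apply/eqP; apply: eq_bigr => i _; rewrite -posp_negp.
  have : (\sum_i `|zeta i| = \sum_i posp (zeta i) + \sum_i negp (zeta i))%N.
    by rewrite -big_split/=; apply: eq_bigr => i _; case: (zeta i) => k /=; lia.
  by move: sumn eqpn; lia.
have lamz : \prod_i lam i ^ zeta i != 1.
  rewrite (bigID (fun i : 'I_m.+1 => (i < j)%N))/=.
  rewrite big1 ?mul1r; last by move=> i ij; rewrite /lam ij exp1rz.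
  rewrite (eq_bigr (fun i => mu ^ zeta i)); last by move=> i /negbTE ij; rewrite /lam ij.
  rewrite -(big_morph (exprz mu) (fun a b => expfzDr a b mu_neq0) (expr0z _)).
  (* The exponents from index j on sum to minus the partial sum s, so the product is the inverse of
     mu^s. *)
  apply: contra mus => /eqP mus; move: sum0; rewrite (bigID (fun i : 'I_m.+1 => (i < j)%N))/=.
  by move=> /eqP; rewrite addr_eq0 => /eqP ->; rewrite -invr_expz mus invr1.
have gz k : (k <= \sum_i posp (zeta i))%N -> gbin (p / 2) k != 0.
  by move=> kz; apply: gb; exact: leq_trans posn.
have [I [c [rho [kap [kap0 key]]]]] := key_nrm p1 sum0 gz lam1 lamz.
(* B bounds all norms involved, L is a Lipschitz constant of the p-th power on [0, B], and Q bounds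
   the total weight. With h = kap / (2 L Q), changing each norm by at most h changes the weighted
   sum by at most kap / 2. *)
pose B := \sum_a \sum_i normc (c a i) + 1.
have cB a : \sum_i normc (c a i) <= B.
  rewrite /B (bigD1 a)//= -addrA lerDl addr_ge0// sumr_ge0// => a' _.
  by apply: sumr_ge0 => i _; exact: normc_ge0.
have B0 : 0 < B.
  rewrite ltr_wpDl// sumr_ge0// => a _; apply: sumr_ge0 => i _; exact: normc_ge0.
pose L := p * B `^ (p - 1) + 1; have L0 : 0 < L by rewrite ltr_wpDl// mulr_ge0 ?powR_ge0// ltW.
pose Q : R := \sum_a `|rho a| + 1; have Q0 : 0 < Q by rewrite ltr_wpDl// sumr_ge0.
pose h := kap / (2 * L * Q); have h0 : 0 < h by rewrite divr_gt0// !mulr_gt0.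
have e0 : 0 < h / (2 * B) by rewrite divr_gt0// mulr_gt0.
have h40 : 0 < h / (4 * B) by rewrite divr_gt0// mulr_gt0.
have [T [bT fT Tp TS]] :=
  umap_cut [seq LpEe p1 E (pp i) | i <- enum 'I_m.+1] uY e0 h40 S1 Su.
have [G [fG GE TG]] := finite_large_images h40 bT fT.
exists G; split => // q qpp qG; apply/eqP => zq.
have Eq i : E (q i).
  have [ij|ij] := ltnP i j; first by rewrite qpp//; exact: Epp.
  by have [] := qG i ij.
have := key q zq; apply/negP; rewrite -ltNge.
(* The operator T + nu (1 - T) nearly fixes the first j characters and nearly multiplies the others
   by nu. Used with mu and with its inverse, it bounds the change of norm from both sides. *)
have cut (d : 'I_m.+1 -> R[i]) nu : (forall i, normc (lam i) = 1) -> S nu ->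
    \sum_i normc (d i) <= B ->
    nrm (\sum_(i < m.+1) ((if (i < j)%N then 1 else nu) * d i) *: Lpe p1 (q i)) <=
    nrm (\sum_i d i *: Lpe p1 (q i)) + h.
  move=> _ Snu dB.
  pose y : Y := \sum_i d i *: LpEe p1 E (q i).
  pose y' : Y := \sum_(i < m.+1) ((if (i < j)%N then 1 else nu) * d i) *: LpEe p1 E (q i).
  have -> : nrm (\sum_(i < m.+1) ((if (i < j)%N then 1 else nu) * d i) *: Lpe p1 (q i)) = nrm y'.
    by rewrite nrm_val val_LpE_trig.
  have yE : nrm (\sum_i d i *: Lpe p1 (q i)) = nrm y by rewrite nrm_val val_LpE_trig.
  have yB : nrm y <= B.
    apply: le_trans (nrm_sum _ _ _) (le_trans _ dB); apply: ler_sum => i _.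
    by rewrite nrmZ nrm_LpEe// mulr1.
  have diff : nrm (y' - (T y + nu *: (y - T y))) <= h / 2.
    have -> : y' - (T y + nu *: (y - T y)) = \sum_(i < m.+1) d i *: ((1 - nu) *:
        ((if (i < j)%N then LpEe p1 E (q i) else 0) - T (LpEe p1 E (q i)))).
      have TyE : T y = \sum_i d i *: T (LpEe p1 E (q i)).
        by rewrite /y linear_sum; apply: eq_bigr => i _; rewrite linearZ.
      rewrite TyE /y' /y -sumrB scaler_sumr -big_split/= -sumrB; apply: eq_bigr => i _.
      set u := LpEe _ _ _; set w := T u.
      rewrite [nu *: _]scalerBr !scalerA scalerBr mulrBr mulr1 [d i * nu]mulrC.
      case: ifP => _; last first.
        by rewrite scaler0 sub0r scalerBl opprB [in LHS]opprD [in LHS]opprB addrCA [X in _ + X = _]addrCA subrr addr0 addrC.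
      by rewrite mul1r !scalerBl !opprD !opprK [RHS]addrACA -[RHS]addrA.
    have nu1 : normc (1 - nu) <= 2.
      apply: le_trans (normcB _ _) _; rewrite Normc.normc1 (_ : normc nu = 1)//.
      by apply: complexI; rewrite -norm_normc Su.
    apply: le_trans (nrm_sum _ _ _) _.
    apply: (@le_trans _ _ (\sum_i normc (d i) * (2 * (h / (4 * B))))).
      apply: ler_sum => i _; rewrite !nrmZ ler_wpM2l ?normc_ge0// ler_pM ?normc_ge0 ?nrm_ge0//.
      case: ifPn => ij.
        rewrite nrmBC qpp//; apply: Tp; exact: map_f (mem_enum _ _).
      by rewrite sub0r nrmN; apply: TG; apply: qG; rewrite leqNgt.
    rewrite -mulr_suml; apply: (@le_trans _ _ (B * (2 * (h / (4 * B))))).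
      by rewrite ler_wpM2r// mulr_ge0// ltW.
    by rewrite le_eqVlt; apply/orP; left; apply/eqP; field; rewrite gt_eqF.
  rewrite yE; have := TS nu y Snu; have := nrmD (y' - (T y + nu *: (y - T y))) (T y + nu *: (y - T y)).
  rewrite subrK => H1 H2.
  have : h / (2 * B) * nrm y <= h / 2.
    apply: (@le_trans _ _ (h / (2 * B) * B)); first by rewrite ler_wpM2l// ltW.
    by rewrite le_eqVlt; apply/orP; left; apply/eqP; field; rewrite gt_eqF.
  by move: H1 H2 diff; rewrite mulrDl mul1r; lra.
have lamn i : normc (lam i) = 1 by apply: complexI; rewrite -norm_normc lam1.
have close a : `|nrm (\sum_i (lam i * c a i) *: Lpe p1 (q i)) -
    nrm (\sum_i c a i *: Lpe p1 (q i))| <= h.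
  have H1 := cut (c a) mu lamn Smu (cB a).
  have H2 := cut (fun i => lam i * c a i) mu^-1 lamn (SV _ Smu).
  have {}H2 : nrm (\sum_i c a i *: Lpe p1 (q i)) <=
      nrm (\sum_i (lam i * c a i) *: Lpe p1 (q i)) + h.
    have HB : \sum_i normc (lam i * c a i) <= B.
      by under eq_bigr do rewrite Normc.normcM lamn mul1r.
    have := H2 HB; under eq_bigr => i _.
      have -> : (if (i < j)%N then 1 else mu^-1) * (lam i * c a i) = c a i.
        by rewrite /lam; case: ifP => _; rewrite ?mul1r// mulrA mulVf// mul1r.
    over.
    by [].
  by rewrite ler_norml; apply/andP; split; move: H1 H2; rewrite /lam; lra.
have nB (d : 'I_m.+1 -> R[i]) : \sum_i normc (d i) <= B ->
    0 <= nrm (\sum_i d i *: Lpe p1 (q i)) <= B.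
  move=> dB; rewrite nrm_ge0/=; apply: le_trans (nrm_sum _ _ _) (le_trans _ dB).
  by apply: ler_sum => i _; rewrite nrmZ nrm_Lpe mulr1.
apply: (@le_lt_trans _ _ (\sum_a `|rho a| * (L * h))).
  apply: ler_sum => a _; apply: le_trans (ler_norm _) _; rewrite normrM ler_wpM2l//.
  apply: le_trans (powR_lipschitz p1 (nB _ _) (nB _ (cB a))) _.
    by under eq_bigr do rewrite Normc.normcM lamn mul1r.
  apply: ler_pM => //; first by rewrite mulr_ge0 ?powR_ge0// ltW.
  by rewrite /L lerDl.
rewrite -mulr_suml.
apply: (@le_lt_trans _ _ (Q * (L * h))).
  by rewrite ler_wpM2r ?(ltW (mulr_gt0 L0 h0))// /Q lerDl.
have -> : Q * (L * h) = kap / 2 by rewrite /h; field; rewrite !gt_eqF.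
by lra.
Qed.

End necessity.

(** * Block unconditionality *)

Lemma int_set_bound (G : set int) : finite_set G -> exists N, forall q, G q -> (`|q| <= N)%N.
Proof.
move=> /finite_fsetP[X ->]; exists (\max_(q <- X) `|q|)%N => q qX.
by apply: (@leq_bigmax_seq _ _ xpredT (fun q : int => `|q|%N)).
Qed.

Section block.
Variables (P : int -> Prop) (E : set int) (n : nat).
Hypotheses (P0 : ~ P 0) (JE : block_independent P E n).

(** In the expansion of |f|^(2n), n frequencies come from f and n from its conjugate; a term
    contributes when their sum with these signs is 0. *)
Let sgn (i : 'I_(n + n)) : int := if fintype.split i is inl _ then 1 else -1.

Let sum_split (F : 'I_(n + n) -> int) (D : pred 'I_(n + n)) :
  \sum_(i | D i) sgn i * F i =
  \sum_(i < n | D (lshift n i)) F (lshift n i) - \sum_(i < n | D (rshift n i)) F (rshift n i).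
Proof.
rewrite big_split_ord/= -sumrN; congr (_ + _); apply: eq_bigr => i _; rewrite /sgn.
  by rewrite (unsplitK (inl _ i)) mul1r.
by rewrite (unsplitK (inr _ i)) mulN1r.
Qed.

(* The signs +-1 with repeated points cover all zeta: the order of the indices
   is arranged by a permutation listing A first. *)
Lemma block_set (A : {set 'I_(n + n)}) (x : 'I_(n + n) -> int) :
  P (\sum_(i in A) sgn i) -> (forall i, i \in A -> E (x i)) ->
  exists G : set int, [/\ finite_set G, G `<=` E &
    forall y : 'I_(n + n) -> int, (forall i, i \in A -> y i = x i) ->
      (forall i, i \notin A -> (E `\` G) (y i)) -> \sum_i sgn i * y i != 0].
Proof.
move=> PA Ex.
pose s := enum A ++ enum (~: A).
have ss : size s == (n + n)%N.
  by rewrite size_cat -!cardE cardsC card_ord.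
have su : uniq s.
  rewrite cat_uniq !enum_uniq andbT /=; apply/hasPn => i.
  by rewrite !mem_enum inE.
pose pi (i : 'I_(n + n)) := tnth (Tuple ss) i.
have piI : injective pi by apply/tuple_uniqP.
have piA (i : 'I_(n + n)) : (i < #|A|)%N = (pi i \in A).
  rewrite /pi (tnth_nth i)/= nth_cat -cardE; case: ltnP => iA.
    by apply/esym; rewrite -mem_enum mem_nth// -cardE.
  have : nth i (enum (~: A)) (i - #|A|) \in enum (~: A).
    rewrite mem_nth// -cardE ltn_subLR//.
    by rewrite cardsC card_ord ltn_ord.
  by rewrite mem_enum inE => /negbTE.
have sumpi (F : 'I_(n + n) -> int) : \sum_i F (pi i) = \sum_i F i.
  by rewrite [RHS](reindex_inj piI).
have sumA : \sum_(i < n + n | (i < #|A|)%N) sgn (pi i) = \sum_(i in A) sgn i.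
  rewrite [RHS](reindex_inj piI); apply: eq_bigl => i; exact: piA.
have sgn1 i : `|sgn i|%N = 1%N by rewrite /sgn; case: (fintype.split _).
have A0 : (0 < #|A|)%N.
  rewrite lt0n cards_eq0; apply/eqP => A0; apply: P0.
  by move: PA; rewrite A0 big_set0.
have AN : (#|A| <= n + n)%N by rewrite -[leqRHS]card_ord max_card.
have m0 : (1 <= n + n)%N by rewrite (leq_trans A0).
have z0 (i : 'I_(n + n)) : sgn (pi i) != 0 by rewrite -absz_eq0 sgn1.
have zs : \sum_i sgn (pi i) = 0.
  rewrite (sumpi sgn); under eq_bigr do rewrite -[sgn _]mulr1.
  by rewrite (sum_split (fun=> 1) xpredT) subrr.
have zn : (\sum_i `|sgn (pi i)| <= n.*2)%N.
  under eq_bigr do rewrite sgn1.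
  by rewrite sum1_card card_ord addnn.
have jm : (1 <= #|A| <= n + n)%N by rewrite A0.
have Pj : P (\sum_(i < n + n | (i < #|A|)%N) sgn (pi i)) by rewrite sumA.
have Ej (i : 'I_(n + n)) : (i < #|A|)%N -> E (x (pi i)) by rewrite piA; exact: Ex.
have [G [fG GE GP]] := JE m0 z0 zs zn jm Pj Ej.
exists G; split => // y yA yN.
rewrite -(sumpi (fun i => sgn i * y i)); apply: (GP (fun i => y (pi i))).
  by move=> i; rewrite piA; exact: yA.
by move=> i; rewrite leqNgt piA; exact: yN.
Qed.

(** The finite set in [block_set] depends on A and on the points indexed by A. With those points in
    [-N0, N0] there are finitely many configurations, and N1 bounds the union of their sets. *)
Lemma block_bound (N0 : nat) : exists2 N1, (N0 <= N1)%N &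
  forall (A : {set 'I_(n + n)}) (y : 'I_(n + n) -> int), (forall i, E (y i)) ->
    P (\sum_(i in A) sgn i) -> (forall i, i \in A -> (`|y i| <= N0)%N) ->
    (forall i, i \notin A -> (N1 < `|y i|)%N) -> \sum_i sgn i * y i != 0.
Proof.
pose D := ({set 'I_(n + n)} * {ffun 'I_(n + n) -> 'I_N0.*2.+1})%type.
pose x (d : D) i : int := (d.2 i)%:Z - N0%:Z.
have /choice[G GP] : forall d : D, exists G : set int, finite_set G /\
    (P (\sum_(i in d.1) sgn i) -> (forall i, i \in d.1 -> E (x d i)) ->
    forall y : 'I_(n + n) -> int, (forall i, i \in d.1 -> y i = x d i) ->
      (forall i, i \notin d.1 -> (E `\` G) (y i)) -> \sum_i sgn i * y i != 0).
  move=> d; have [[PA Ex]|no] := pselect (P (\sum_(i in d.1) sgn i) /\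
      (forall i, i \in d.1 -> E (x d i))).
    by have [G [fG _ GP]] := block_set PA Ex; exists G; split.
  by exists set0; split => // PA Ex; exfalso; apply: no.
have fU : finite_set (\bigcup_(d in [set: D]) G d).
  by apply: bigcup_finite => [|d _]; [exact: finite_finset|have [] := GP d].
have [N1 N1P] := int_set_bound fU.
exists (maxn N0 N1); first by rewrite leq_maxl.
move=> A y Ey PA yA yN.
(* Outside A the value of [inord] may be a default; only entries in A are compared. *)
pose d : D := (A, [ffun i => inord (absz (y i + N0%:Z))]).
have xy i : i \in A -> x d i = y i.
  move=> /yA yN0; rewrite /x ffunE inordK; last by lia.
  by lia.
have [_ dP] := GP d; apply: dP => //.
- by move=> i iA; rewrite xy.
- by move=> i iA; rewrite xy.
move=> i /yN; rewrite gtn_max => /andP[_ N1y]; split => // Gy.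
have : (`|y i| <= N1)%N by apply: N1P; exists d.
by rewrite leqNgt N1y.
Qed.

Variables (R : realType) (p : R) (p1 : 1 <= p).
Hypothesis pn : p = n.*2%:R.

(** By [nrm_trig_even], these products are all that the norm sees of the coefficients. *)
Lemma eq_nrm_trig (J : finType) (c c' : J -> R[i]) (q : J -> int) :
  (forall f g : {ffun 'I_n -> J}, \sum_i q (f i) = \sum_i q (g i) ->
    (\prod_i c (f i)) * (\prod_i (c (g i))^* ) =
    (\prod_i c' (f i)) * (\prod_i (c' (g i))^* )) ->
  nrm (\sum_i c i *: Lpe p1 (q i)) = nrm (\sum_i c' i *: Lpe p1 (q i)).
Proof.
move=> cc'; have p0 : 0 < p by exact: lt_le_trans p1.
apply: (powR_injective p0); [by rewrite nnegrE nrm_ge0..|].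
apply: complexI; rewrite !(nrm_trig_even p1 _ _ pn); apply: eq_bigr => -[f g]/=.
by rewrite subr_eq0 => /eqP; exact: cc'.
Qed.

(** A term of the expansion is multiplied by lam^(hf - hg), where hf and hg count the high
    frequencies taken from f and g. The signs at the low positions sum to hg - hf, so if the factor
    is not 1, P holds of this sum and [block_bound] rules out the frequency relation that the term
    requires. *)
Lemma block_unconditional (N0 : nat) : exists2 N1, (N0 <= N1)%N &
  forall (J : finType) (q : J -> int) (a b : J -> R[i]) (lam : R[i]),
    (forall i, a i + b i != 0 -> E (q i)) -> (forall i, a i != 0 -> (`|q i| <= N0)%N) ->
    (forall i, b i != 0 -> (N1 < `|q i|)%N) ->
    `|lam| = 1 -> (forall s, ~ P s -> lam ^ s = 1) ->
    nrm (\sum_i (a i + lam * b i) *: Lpe p1 (q i)) =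
    nrm (\sum_i (a i + b i) *: Lpe p1 (q i)).
Proof.
have [N1 N01 N1P] := block_bound N0; exists N1 => // J q a b lam Eq qa qb lam1 lamP.
have lam0 : lam != 0 by rewrite -normr_eq0 lam1 oner_neq0.
pose hi i : nat := b i != 0.
have excl i : b i != 0 -> a i = 0.
  move=> /qb N1q; apply/eqP/negP => /negP/qa; rewrite leqNgt.
  by rewrite (leq_ltn_trans N01 N1q).
have cE i : a i + lam * b i = lam ^+ hi i * (a i + b i).
  rewrite /hi; have [->|bi] := eqVneq (b i) 0; first by rewrite mulr0 expr0 mul1r.
  by rewrite (excl _ bi) !add0r expr1.
apply: eq_nrm_trig => f g fg.
have [/forallP nz|/forallPn[i fgi]] := boolP [forall i, (a (f i) + b (f i) != 0) && (a (g i) + b (g i) != 0)]; last first.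
  move: fgi; rewrite negb_and !negbK => /orP[/eqP|/eqP] z.
    have p0 (h : J -> R[i]) : h (f i) = 0 -> \prod_i h (f i) = 0.
      by move=> h0; apply/eqP/prodf_eq0; exists i => //; rewrite h0.
    by rewrite (p0 (fun l => a l + b l))// (p0 (fun l => a l + lam * b l)) ?cE ?z ?mulr0// !mul0r.
  have p0 (h : J -> R[i]) : h (g i) = 0 -> \prod_i (h (g i))^* = 0.
    by move=> h0; apply/eqP/prodf_eq0; exists i => //; rewrite h0 rmorph0.
  by rewrite (p0 (fun l => a l + b l))// (p0 (fun l => a l + lam * b l)) ?cE ?z ?mulr0.
under eq_bigr do rewrite cE.
under [X in _ * X]eq_bigr do rewrite cE rmorphM rmorphXn.
rewrite !big_split/= mulrACA -[RHS]mul1r; congr (_ * _).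
rewrite -!expr_sum.
set hf := (\sum_i _)%N; set hg := (\sum_i _)%N.
have -> : lam^* = lam^-1 by rewrite unimodularV.
have -> : lam ^+ hf * lam^-1 ^+ hg = lam ^ (hf%:Z - hg%:Z).
  by rewrite expfzDr// -exprnP -exprnN exprVn.
apply/eqP/negP => /negP lams.
pose y i := match fintype.split i with inl k => q (f k) | inr k => q (g k) end.
pose A : {set 'I_(n + n)} := finset (fun i =>
  match fintype.split i with inl k => hi (f k) == 0%N | inr k => hi (g k) == 0%N end).
have Af k : (lshift n k \in A) = (hi (f k) == 0%N) by rewrite inE (unsplitK (inl _ k)).
have Ag k : (rshift n k \in A) = (hi (g k) == 0%N) by rewrite inE (unsplitK (inr _ k)).
have low l : a l + b l != 0 -> hi l = 0%N -> (`|q l| <= N0)%N.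
  by rewrite /hi; have [->|//] := eqVneq (b l) 0; rewrite addr0 => /qa.
have high l : hi l != 0%N -> (N1 < `|q l|)%N by rewrite /hi; case: (b l =P 0) => //= /eqP/qb.
have ys : \sum_i sgn i * y i = 0.
  transitivity (\sum_i q (f i) - \sum_i q (g i)); last by rewrite fg subrr.
  rewrite (sum_split y xpredT); congr (_ - _); apply: eq_bigr => k _.
    by rewrite /y (unsplitK (inl _ k)).
  by rewrite /y (unsplitK (inr _ k)).
suff : \sum_i sgn i * y i != 0 by rewrite ys eqxx.
apply: (N1P A y).
- by move=> i; rewrite /y; case: (fintype.split _) => k; apply: Eq; have /andP[] := nz k.
- apply: contrapT => /lamP; set s := \sum_(i in A) _ => s1.
  have sE : s = hg%:Z - hf%:Z.
    have cnt (h : {ffun 'I_n -> J}) :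
        (\sum_(i < n | hi (h i) == 0%N) (1 : int)) = n%:Z - (\sum_i hi (h i))%:Z.
      apply/eqP; rewrite eq_sym subr_eq big_mkcond (big_morph Posz PoszD (erefl _)) -big_split/=.
      rewrite (eq_bigr (fun=> 1)); last by move=> i _; rewrite /hi; case: (b (h i) != 0).
      by rewrite sumr_const card_ord natz.
    rewrite /s; under eq_bigr do rewrite -[sgn _]mulr1.
    rewrite (sum_split (fun=> 1)) (eq_bigl _ _ Af) (eq_bigl _ _ Ag) !cnt /hf /hg.
    by lia.
  move: lams; rewrite -opprB -sE -invr_expz s1 invr1 eqxx.
  by [].
- move=> i; rewrite inE /y; case: (fintype.split _) => k /eqP hk; apply: low => //; by have /andP[] := nz k.
- by move=> i; rewrite inE /y; case: (fintype.split _) => k; exact: high.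
Qed.

End block.

(** * Cutoffs *)

Definition win N (i : 'I_N.*2.+1) : int := i%:Z - N%:Z.

Lemma win_le N (i : 'I_N.*2.+1) : (`|win i| <= N)%N.
Proof. by have := ltn_ord i; rewrite /win; lia. Qed.

Lemma sum_win (V : nmodType) N (q : int) (F : int -> V) :
  \sum_(i < N.*2.+1) (if win i == q then F (win i) else 0) =
  if (`|q| <= N)%N then F q else 0.
Proof.
case: ifPn => qN.
  have i0 : (absz (q + N%:Z)%R < N.*2.+1)%N by lia.
  have wq : win (Ordinal i0) = q by rewrite /win /=; lia.
  rewrite (bigD1 (Ordinal i0))//= wq eqxx big1 ?addr0// => i ii0.
  case: eqP => // wi; exfalso; move/eqP: ii0; apply; apply: val_inj => /=.
  by move: wi; rewrite /win; lia.
by rewrite big1// => i _; case: eqP => // wi; move: qN; rewrite -wi win_le.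
Qed.

Section multipliers.
Variables (R : realType) (p : R) (p1 : 1 <= p).
Notation X := (Lp (haar R) p1).
Implicit Types (u v : X) (t : int -> R) (N : nat).

(** A Fourier multiplier restricted to frequencies in [-N, N], so that it is a finite sum, defined
    on all of L^p and of finite rank. *)
Definition fmult N t u : X :=
  \sum_(i < N.*2.+1) ((t (win i))%:C * Lpcoef u (win i)) *: Lpe p1 (win i).

Lemma fmultP N t c u v : fmult N t (c *: u + v) = c *: fmult N t u + fmult N t v.
Proof.
rewrite /fmult scaler_sumr -big_split/=; apply: eq_bigr => i _.
by rewrite LpcoefP mulrDr scalerDl scalerA mulrCA.
Qed.

Lemma Lpcoef_fmult N t u k :
  Lpcoef (fmult N t u) k = if (`|k| <= N)%N then (t k)%:C * Lpcoef u k else 0.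
Proof.
rewrite /fmult Lpcoef_sum -(sum_win N k (fun k => (t k)%:C * Lpcoef u k)).
apply: eq_bigr => i _; rewrite LpcoefZ Lpcoef_Lpe.
by case: eqP => // _; rewrite ?mulr1 ?mulr0.
Qed.

Lemma fmult_Lpe N t q :
  fmult N t (Lpe p1 q) = (if (`|q| <= N)%N then (t q)%:C else 0) *: Lpe p1 q.
Proof.
rewrite (_ : _ *: _ = if (`|q| <= N)%N then (t q)%:C *: Lpe p1 q else 0); last first.
  by case: ifP; rewrite ?scale0r.
rewrite -(sum_win N q (fun k => (t k)%:C *: Lpe p1 k)); apply: eq_bigr => i _.
by rewrite Lpcoef_Lpe eq_sym; case: eqP => _; rewrite ?mulr1// mulr0 scale0r.
Qed.

Lemma fmultD N t u v : fmult N t (u + v) = fmult N t u + fmult N t v.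
Proof. by rewrite -[u]scale1r fmultP !scale1r. Qed.

Lemma fmult0 N t : fmult N t (0 : X) = 0.
Proof. by apply: (addrI (fmult N t 0)); rewrite -fmultD !addr0. Qed.

Lemma fmultZ N t c u : fmult N t (c *: u) = c *: fmult N t u.
Proof. by rewrite -[c *: u]addr0 fmultP fmult0 addr0. Qed.

Lemma fmultB N t u v : fmult N t (u - v) = fmult N t u - fmult N t v.
Proof. by rewrite -scaleN1r fmultD fmultZ scaleN1r. Qed.

Lemma fmult_trig N t (I : Type) (s : seq I) (c : I -> R[i]) (q : I -> int) :
  (forall k, (N < `|k|)%N -> t k = 0) ->
  fmult N t (\sum_(i <- s) c i *: Lpe p1 (q i)) =
  \sum_(i <- s) (c i * (t (q i))%:C) *: Lpe p1 (q i).
Proof.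
move=> tN; rewrite (big_morph (fmult N t) (@fmultD N t) (fmult0 N t)).
apply: eq_bigr => i _; rewrite fmultZ fmult_Lpe scalerA.
by case: leqP => // /tN ->.
Qed.

Lemma fmult_bound N t u : nrm (fmult N t u) <= 4 * (\sum_(i < N.*2.+1) `|t (win i)|) * nrm u.
Proof.
apply: le_trans (nrm_sum _ _ _) _; rewrite mulrAC mulr_sumr; apply: ler_sum => i _.
rewrite nrmZ nrm_Lpe mulr1 Normc.normcM normc_real mulrC.
by rewrite ler_wpM2r// Lpcoef_le.
Qed.

Lemma fmult_spectrum E N t u : u \in spectrum_in E -> fmult N t u \in spectrum_in E.
Proof.
move=> /asboolP uE; apply/asboolP => k Ek; rewrite -[LHS]/(Lpcoef _ k) Lpcoef_fmult.
by case: ifP => // _; rewrite [Lpcoef u k]uE// mulr0.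
Qed.

Lemma fmult_fmult N t N' t' u : (N <= N')%N ->
  (forall k, (`|k| <= N)%N -> t' k = 1) -> fmult N t (fmult N' t' u) = fmult N t u.
Proof.
move=> NN' t'1; apply: eq_bigr => i _; rewrite Lpcoef_fmult.
by rewrite (leq_trans (win_le i) NN') t'1 ?win_le// mul1r.
Qed.

End multipliers.

(** * Fejer coefficients *)

Section fejer.
Variable R : realType.
Implicit Types (L N : nat).

(** This is max(0, 1 - |k| / L), written as the count of pairs that arises from expanding |1 + z +
    ... + z^(L-1)|^2. *)
Definition fejer L (k : int) : R :=
  (\sum_(i < L) \sum_(j < L) (i%:Z - j%:Z == k)%R)%N%:R / L%:R.

Lemma fejer_supp L (k : int) : (L <= `|k|)%N -> fejer L k = 0.
Proof.
move=> Lk; rewrite /fejer big1 ?mul0r// => i _; rewrite big1// => j _.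
have := ltn_ord i; have := ltn_ord j; case: eqP => //; lia.
Qed.

Lemma sum_lt (L m : nat) : (\sum_(i < L) (i < m) <= m)%N.
Proof.
elim: L => [|L ih]; first by rewrite big_ord0.
have [mL|Lm] := leqP m L.
  by rewrite big_ord_recr/= ltnNge mL addn0.
rewrite (leq_trans _ Lm)//; rewrite -[leqRHS]card_ord -sum1_card.
by apply: leq_sum => i _; case: (_ < _)%N.
Qed.

Lemma sum_eq_ord (L : nat) (m : int) :
  (\sum_(j < L) (m == j%:Z)%R = ((0 <= m) && (m < L%:Z))%R)%N.
Proof.
have [/andP[m0 mL]|mL] := boolP ((0 <= m) && (m < L%:Z)).
  have mL' : (absz m < L)%N by lia.
  rewrite (bigD1 (Ordinal mL'))//= big1 ?addn0; first by case: eqP => //; lia.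
  move=> j jm; case: eqP => // mj; move/eqP: jm; case; apply: val_inj => /=; lia.
rewrite big1// => j _; case: eqP => // mj; move: mL; rewrite mj.
by have := ltn_ord j; lia.
Qed.

Lemma fejer_near L (k : int) : (0 < L)%N -> 0 <= 1 - fejer L k <= `|k|%N%:R / L%:R.
Proof.
move=> L0; have LR : 0 < L%:R :> R by rewrite ltr0n.
rewrite /fejer; set c := (\sum_(i < L) _)%N.
have cE : c = (\sum_(i < L) ((0 <= i%:Z - k) && (i%:Z - k < L%:Z))%R)%N.
  apply: eq_bigr => i _; rewrite -sum_eq_ord; apply: eq_bigr => j _.
  by congr nat_of_bool; lia.
have cL : (c <= L)%N.
  rewrite cE -[leqRHS]card_ord -sum1_card; apply: leq_sum => i _.
  by case: (_ && _).
have Lc : (L <= c + `|k|)%N.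
  rewrite cE -[leqLHS]card_ord -sum1_card.
  have [k0|k0] := leP 0 k.
    apply: leq_trans (leq_add (leqnn _) (sum_lt L `|k|)); rewrite -big_split/=.
    by apply: leq_sum => i _; have := ltn_ord i; lia.
  have -> : (\sum_(i < L) ((0 <= i%:Z - k) && (i%:Z - k < L%:Z))%R =
      \sum_(i < L) ((0 <= (rev_ord i)%:Z - k) && ((rev_ord i)%:Z - k < L%:Z))%R)%N.
    by rewrite (reindex_inj rev_ord_inj).
  apply: leq_trans (leq_add (leqnn _) (sum_lt L `|k|)); rewrite -big_split/=.
  by apply: leq_sum => i _; have := ltn_ord i; lia.
rewrite subr_ge0 ler_pdivrMr// mul1r ler_nat cL/=.
rewrite lerBlDl -mulrDl -natrD ler_pdivlMr// mul1r ler_nat addnC.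
by rewrite addnC.
Qed.

(* The Fejer kernel |1 + z + ... + z^(L-1)|^2 / L, sampled at roots of unity,
   exhibits the multiplier as an average of rotations. *)
Lemma fejer_avg M (w : R[i]) L (q : int) : M.-primitive_root w -> `|w| = 1 -> (0 < L)%N ->
  (L + `|q| < M)%N ->
  \sum_(a < M) (normc (\sum_(i < L) (w ^+ a) ^ i%:Z) ^+ 2)%:C * (w ^+ a) ^ (- q) =
  (M%:R * L%:R * fejer L q)%:C.
Proof.
move=> wM w1 L0 LM; have w0 : w != 0 by rewrite -normr_eq0 w1 oner_neq0.
transitivity (\sum_(i < L) \sum_(j < L) \sum_(a < M) (w ^+ a) ^ (i%:Z - j%:Z - q)).
  under [RHS]eq_bigr do rewrite exchange_big/=.
  rewrite [RHS]exchange_big/=; apply: eq_bigr => a _.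
  have wa0 : w ^+ a != 0 by rewrite expf_neq0.
  rewrite normc_conj rmorph_sum big_distrlr/= mulr_suml.
  apply: eq_bigr => i _; rewrite mulr_suml; apply: eq_bigr => j _.
  have -> : ((w ^+ a) ^ j%:Z)^* = (w ^+ a) ^ (- j%:Z).
    rewrite -unimodularV ?invr_expz//.
    by apply: unimodular_exprz; rewrite normrX w1 expr1n.
  by rewrite -!expfzDr.
have -> : M%:R * L%:R * fejer L q = M%:R * (\sum_(i < L) \sum_(j < L) (i%:Z - j%:Z == q)%R)%N%:R.
  by rewrite /fejer -mulrA; congr (_ * _); rewrite mulrC divfK ?pnatr_eq0 -?lt0n.
rewrite rmorphM !rmorph_nat natr_sum mulr_sumr; apply: eq_bigr => i _.
rewrite natr_sum mulr_sumr; apply: eq_bigr => j _.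
rewrite (sum_root wM).
have -> : (M %| `|(i%:Z - j%:Z - q)%R|)%N = (i%:Z - j%:Z == q).
  rewrite -subr_eq0 -absz_eq0; have [->|x0] := eqVneq `|(i%:Z - j%:Z - q)%R|%N 0%N; first by rewrite dvdn0.
  apply/negbTE/negP => /dvdn_leq; rewrite lt0n => /(_ x0).
  by have := ltn_ord i; have := ltn_ord j; lia.
by case: eqP; rewrite ?mulr1 ?mulr0.
Qed.

End fejer.

Lemma conj_unimodularX (R : rcfType) (x : R[i]) (k : int) : `|x| = 1 -> (x ^ k)^* = x ^ (- k).
Proof. by move=> x1; rewrite -unimodularV ?invr_expz//; exact: unimodular_exprz. Qed.

(** * Norms of Fejer means and of cutoffs *)

Section contraction.
Variables (R : realType) (n : nat) (p : R) (p1 : 1 <= p).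
Hypothesis pn : p = n.*2%:R.
Notation X := (Lp (haar R) p1).
Implicit Types (u v : X) (L N : nat).

(** Rotation invariance, read off from the expansion for p = 2n: the factors a^q cancel in every
    contributing term. *)
Lemma nrm_rotation (J : finType) (c : J -> R[i]) (q : J -> int) (a : R[i]) : `|a| = 1 ->
  nrm (\sum_i (c i * a ^ (- q i)) *: Lpe p1 (q i)) = nrm (\sum_i c i *: Lpe p1 (q i)).
Proof.
move=> a1; have a0 : a != 0 by rewrite -normr_eq0 a1 oner_neq0.
apply: (eq_nrm_trig p1 pn) => f g fg.
have E i : (c (g i) * a ^ (- q (g i)))^* = (c (g i))^* * a ^ q (g i).
  by rewrite rmorphM; congr (_ * _); rewrite -[in RHS](opprK (q (g i))); exact: conj_unimodularX.
rewrite (eq_bigr _ (fun i _ => E i)) !big_split/= mulrACA -[RHS]mulr1; congr (_ * _).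
rewrite -!(big_morph (exprz a) (fun x y => expfzDr x y a0) (expr0z _)) sumrN fg.
by rewrite -expfzDr// addNr.
Qed.

(** The Fejer mean is an average of rotations with weights [K a] >= 0; their total mass M L is the
    value of the average at frequency 0. *)
Lemma fejer_contraction_trig N L (s : seq (R[i] * int)) : (0 < L)%N -> (L <= N)%N ->
  nrm (fmult N (fejer R L) (\sum_(x <- s) x.1 *: Lpe p1 x.2)) <=
  nrm (\sum_(x <- s) x.1 *: Lpe p1 x.2).
Proof.
move=> L0 LN; have LR : 0 < L%:R :> R by rewrite ltr0n.
rewrite fmult_trig; last by move=> k Nk; apply: fejer_supp; rewrite (leq_trans LN)// ltnW.
rewrite !(big_tnth _ _ s); set t := in_tuple s.
pose c i := (tnth t i).1; pose q i := (tnth t i).2.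
pose m := (\max_i `|q i|)%N.
have qm i : (`|q i| <= m)%N by exact: (leq_bigmax i).
(* The grid is finer than L plus the largest frequency, so that [fejer_avg] applies to every q i. *)
have [w wM w1] := primitive_root_pow2 R (L + m).
set M := (2 ^ _)%N in wM.
have LmM : (L + m < M)%N by rewrite (leq_trans (ltn_expl _ (isT : 1 < 2)%N))// leq_exp2l.
have MR : 0 < M%:R :> R by rewrite ltr0n expn_gt0.
pose K (a : 'I_M) : R := normc (\sum_(i < L) (w ^+ a) ^ i%:Z) ^+ 2.
have K0 a : 0 <= K a by exact: sqr_ge0.
have avg (k : int) : (`|k| <= m)%N -> \sum_(a < M) (K a)%:C * (w ^+ a) ^ (- k) =
    (M%:R * L%:R * fejer R L k)%:C.
  by move=> km; apply: fejer_avg => //; rewrite (leq_ltn_trans _ LmM)// leq_add2l.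
have Ksum : \sum_a K a = M%:R * L%:R.
  apply: complexI; rewrite rmorph_sum.
  have := avg 0; rewrite leq0n => /(_ isT); under eq_bigr do rewrite oppr0 expr0z mulr1.
  move=> ->; congr (_%:C); rewrite -[RHS]mulr1; congr (_ * _).
  have /andP[] := fejer_near R 0 L0; rewrite mul0r; lra.
have E : (M%:R * L%:R)%:C *: \sum_i (c i * (fejer R L (q i))%:C) *: Lpe p1 (q i) =
    \sum_a (K a)%:C *: \sum_i (c i * (w ^+ a) ^ (- q i)) *: Lpe p1 (q i).
  rewrite scaler_sumr; under [RHS]eq_bigr do rewrite scaler_sumr.
  rewrite exchange_big/=; apply: eq_bigr => i _.
  under [RHS]eq_bigr do rewrite scalerA.
  rewrite -scaler_suml scalerA; congr (_ *: _).
  under eq_bigr do rewrite mulrCA.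
  by rewrite -mulr_sumr avg// mulrCA -rmorphM.
have ML : 0 < M%:R * L%:R :> R by rewrite mulr_gt0.
rewrite -(ler_pM2l ML).
have -> : M%:R * L%:R * nrm (\sum_i (c i * (fejer R L (q i))%:C) *: Lpe p1 (q i)) =
    nrm ((M%:R * L%:R)%:C *: \sum_i (c i * (fejer R L (q i))%:C) *: Lpe p1 (q i)).
  by rewrite nrmZ normc_real gtr0_norm.
rewrite E; apply: le_trans (nrm_sum _ _ _) _.
rewrite -Ksum mulr_suml; apply: ler_sum => a _.
rewrite nrmZ normc_real ger0_norm// nrm_rotation//.
by rewrite normrX w1 expr1n.
Qed.

Lemma fejer_contraction N L u : (0 < L)%N -> (L <= N)%N ->
  nrm (fmult N (fejer R L) u) <= nrm u.
Proof.
move=> L0 LN; apply/ler_addgt0Pr => e e0.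
set C := 4 * (\sum_(i < N.*2.+1) `|fejer R L (win i)|).
have C0 : 0 <= C by rewrite mulr_ge0// sumr_ge0.
have d0 : 0 < e / (C + 1) by rewrite divr_gt0// ltr_wpDl.
have [s us] := trig_dense u d0.
set P := \sum_(x <- s) _ in us.
have H1 := fejer_contraction_trig s L0 LN; rewrite -/P in H1.
have H2 := fmult_bound N (fejer R L) (u - P); rewrite -/C fmultB in H2.
have H3 := nrmD (fmult N (fejer R L) u - fmult N (fejer R L) P) (fmult N (fejer R L) P).
have H4 := nrmD (P - u) u; rewrite nrmBC in H4.
rewrite !subrK in H3 H4.
have H5 : C * nrm (u - P) <= C * (e / (C + 1)) by rewrite ler_wpM2l.
have H6 : C * (e / (C + 1)) + e / (C + 1) = e by field; rewrite gt_eqF// ltr_wpDl.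
apply: le_trans H3 _; apply: le_trans (lerD (le_trans H2 H5) (le_trans H1 H4)) _.
by rewrite addrA [leRHS]addrC lerD2r -[leRHS]H6 lerD2l.
Qed.

(** In contrast to [trig_dense], the approximant is a multiplier of u itself and so keeps its
    spectrum in E. Fejer means approximate a nearby polynomial, and contractivity transfers this to
    u. *)
Lemma spectrum_dense (E : set int) u (e : R) : u \in spectrum_in E -> 0 < e ->
  exists N (t : int -> R), nrm (u - fmult N t u) <= e.
Proof.
move=> uE e0; have e3 : 0 < e / 3 by rewrite divr_gt0.
have [s us] := trig_dense u e3; set P := \sum_(x <- s) _ in us.
pose B := \sum_(x <- s) normc x.1 * `|x.2|%N%:R.
have B0 : 0 <= B by apply: sumr_ge0 => x _; rewrite mulr_ge0 ?normc_ge0.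
pose L := (Num.bound (B / (e / 3))).+1; exists L, (fejer R L).
have LB : B / L%:R <= e / 3.
  rewrite ler_pdivrMr ?ltr0n// mulrC -ler_pdivrMr//.
  apply/ltW/(lt_trans (archi_boundP _)); first by rewrite divr_ge0// ltW.
  by rewrite ltr_nat.
have PP : nrm (P - fmult L (fejer R L) P) <= e / 3.
  rewrite fmult_trig; last by move=> k Lk; apply: fejer_supp; exact: ltnW.
  rewrite /P -sumrB; apply: le_trans LB; apply: le_trans (nrm_sum _ _ _) _.
  rewrite mulr_suml; apply: ler_sum => x _.
  rewrite -scalerBl nrmZ nrm_Lpe mulr1.
  have -> : x.1 - x.1 * (fejer R L x.2)%:C = x.1 * (1 - fejer R L x.2)%:C.
    by rewrite rmorphB mulrBr mulr1.
  have /andP[f0 f1] := fejer_near R x.2 (isT : (0 < L)%N).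
  rewrite Normc.normcM normc_real ger0_norm// -mulrA ler_wpM2l//; exact: normc_ge0.
have H1 := @fejer_contraction L L (u - P) isT (leqnn _); rewrite fmultB in H1.
set F := fmult L (fejer R L) in PP H1 *.
have -> : u - F u = (u - P) + ((P - F P) - (F u - F P)).
  by rewrite opprB [_ - F P + _]addrA subrK addrA subrK.
apply: le_trans (nrmD _ _) _; have := nrmB (P - F P) (F u - F P).
by lra.
Qed.

(* Fejer's means corrected on [-N0, N0] to be exactly the identity there. *)
Lemma cutoff (N0 : nat) (d : R) : 0 < d -> exists N (t : int -> R),
  [/\ (N0 <= N)%N, forall k, (`|k| <= N0)%N -> t k = 1, forall k, (N < `|k|)%N -> t k = 0 &
    forall u, nrm (fmult N t u) <= (1 + d) * nrm u].
Proof.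
move=> d0.
pose B : R := 4 * (N0.*2.+1%:R * N0%:R); have B0 : 0 <= B by rewrite !mulr_ge0.
pose L := (Num.bound (B / d)).+1; pose N := maxn N0 L.
have LB : B / L%:R <= d.
  rewrite ler_pdivrMr ?ltr0n// mulrC -ler_pdivrMr//.
  apply/ltW/(lt_trans (archi_boundP _)); first by rewrite divr_ge0// ltW.
  by rewrite ltr_nat.
exists N, (fun k => if (`|k| <= N0)%N then 1 else fejer R L k); split.
- by rewrite leq_maxl.
- by move=> k ->.
- move=> k; rewrite gtn_max => /andP[N0k Lk]; rewrite leqNgt N0k/=.
  by apply: fejer_supp; exact: ltnW.
move=> u; pose g k : R := if (`|k| <= N0)%N then 1 - fejer R L k else 0.
have -> : fmult N (fun k => if (`|k| <= N0)%N then 1 else fejer R L k) u =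
    fmult N (fejer R L) u + fmult N g u.
  rewrite /fmult -big_split/=; apply: eq_bigr => i _.
  rewrite -scalerDl -mulrDl -rmorphD; congr ((_%:C * _) *: _).
  by rewrite /g; case: ifP => _; ring.
apply: le_trans (nrmD _ _) _; rewrite mulrDl mul1r lerD//.
  by apply: fejer_contraction => //; rewrite leq_maxr.
apply: le_trans (nrm_sum _ _ _) _.
apply: (@le_trans _ _ (\sum_(j < N0.*2.+1) N0%:R / L%:R * (4 * nrm u))); last first.
  rewrite sumr_const card_ord -mulr_natl [X in X <= _](_ : _ = B / L%:R * nrm u).
    by rewrite ler_wpM2r ?nrm_ge0.
  by rewrite /B; ring.
have H (q : int) : (`|q| <= N)%N -> (`|q| <= N0)%N ->
    nrm (((g q)%:C * Lpcoef u q) *: Lpe p1 q) <= N0%:R / L%:R * (4 * nrm u).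
  move=> qN qN0; rewrite nrmZ nrm_Lpe mulr1 Normc.normcM normc_real.
  apply: ler_pM; rewrite ?normc_ge0 ?Lpcoef_le//.
  rewrite /g qN0; have /andP[f0 f1] := fejer_near R q (isT : (0 < L)%N).
  rewrite ger0_norm//; apply: le_trans f1 _.
  by rewrite ler_wpM2r ?invr_ge0// ler_nat.
pose F (q : int) : R := if (`|q| <= N0)%N then N0%:R / L%:R * (4 * nrm u) else 0.
apply: (@le_trans _ _ (\sum_(i < N.*2.+1) F (win i))).
  apply: ler_sum => i _; rewrite /F; case: ifPn => iN0; first by apply: H => //; exact: win_le.
  by rewrite /g (negbTE iN0) mul0r scale0r nrm0.
have FE (q : int) : F q = \sum_(j < N0.*2.+1) (if win j == q then N0%:R / L%:R * (4 * nrm u) else 0).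
  by rewrite (sum_win N0 q (fun=> N0%:R / L%:R * (4 * nrm u))).
rewrite (eq_bigr _ (fun i _ => FE (win i))) exchange_big/=; apply: ler_sum => j _.
under eq_bigr do rewrite eq_sym.
rewrite (sum_win N (win j) (fun=> N0%:R / L%:R * (4 * nrm u))).
by case: ifP => // _; rewrite mulr_ge0 ?mulr_ge0 ?nrm_ge0 ?invr_ge0.
Qed.

End contraction.

(** * Unconditional cutoffs *)

Section clarkson.
Variable R : realType.

Lemma pow_sum_le (x y : R) n : 0 <= x -> 0 <= y -> x ^+ n.+1 + y ^+ n.+1 <= (x + y) ^+ n.+1.
Proof.
move=> x0 y0; elim: n => [|n ih]; first by rewrite !expr1.
rewrite [leRHS]exprS; apply: (@le_trans _ _ ((x + y) * (x ^+ n.+1 + y ^+ n.+1))).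
  rewrite mulrDl !mulrDr -!exprS -addrA lerD2l addrA lerDr addr_ge0//;
  by rewrite mulr_ge0// exprn_ge0.
by rewrite ler_wpM2l// addr_ge0.
Qed.

Lemma pow_mean_le (x y : R) n : 0 <= x -> 0 <= y ->
  2 * (x + y) ^+ n <= 2 ^+ n * (x ^+ n + y ^+ n).
Proof.
move=> x0 y0; elim: n => [|n ih]; first by rewrite !expr0; lra.
have mono : (x - y) * (x ^+ n - y ^+ n) >= 0.
  have [xy|/ltW xy] := leP x y.
    by rewrite mulr_le0// subr_le0// lerXn2r.
  by rewrite mulr_ge0// subr_ge0// lerXn2r.
have := ler_wpM2l (addr_ge0 x0 y0) ih.
have : 0 <= (2 : R) ^+ n by rewrite exprn_ge0.
move=> /mulr_ge0 /(_ mono); rewrite !exprS; lra.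
Qed.

(** Either x <= s, or (x / s)^m >= 1. It turns a bound on a sum of powers into a bound on the sum of
    the terms. *)
Lemma pow_young (x s : R) m : 0 <= x -> 0 < s -> x <= s + x ^+ m.+1 / s ^+ m.
Proof.
move=> x0 s0; have sm : 0 < s ^+ m by rewrite exprn_gt0.
have [xs|sx] := leP x s; first by rewrite ler_wpDr// divr_ge0 ?exprn_ge0// ltW.
rewrite ler_wpDl ?(ltW s0)// exprS -mulrA ler_peMr// ler_pdivlMr// mul1r.
by rewrite lerXn2r ?nnegrE// ltW.
Qed.

Lemma pow_near1 (e : R) m : 0 < e -> exists2 d : R, 0 < d & (1 + d) ^+ m <= 1 + e.
Proof.
move=> e0; pose f := Num.min e 1; have f0 : 0 < f by rewrite lt_min e0 ltr01.
have fe : f <= e by rewrite ge_min lexx.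
have f1 : f <= 1 by rewrite ge_min lexx orbT.
suff [d d0 dP] : exists2 d : R, 0 < d & (1 + d) ^+ m <= 1 + f.
  by exists d => //; apply: le_trans dP _; rewrite lerD2l.
move: f f0 f1 {fe}; elim: m => [|m ih] f f0 f1; first by exists 1 => //; rewrite expr0; lra.
have f20 : 0 < f / 2 by rewrite divr_gt0.
have f21 : f / 2 <= 1 by lra.
have [d d0 dP] := ih (f / 2) f20 f21.
pose d' := Num.min d (f / 4).
have d'0 : 0 < d' by rewrite lt_min d0/= divr_gt0.
have d'd : d' <= d by rewrite ge_min lexx.
have d'f : d' <= f / 4 by rewrite ge_min lexx orbT.
exists d' => //; rewrite exprS; clearbody d'.
have H : (1 + d') ^+ m <= 1 + f / 2.
  by apply: le_trans dP; rewrite lerXn2r ?nnegrE//; lra.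
apply: le_trans (ler_wpM2l _ H) _; first by lra.
have : d' * (f / 2) <= (f / 4) * (1 / 2) by apply: ler_pM; lra.
by lra.
Qed.

Variables (n : nat) (p : R) (p1 : 1 <= p).
Hypothesis pn : p = n.*2%:R.
Notation X := (Lp (haar R) p1).

(** Pointwise, superadditivity of the n-th power, the parallelogram law and convexity of the n-th
    power are applied to squared moduli; then the inequality is integrated. *)
Lemma clarkson (u v : X) :
  2 * (nrm (u + v) ^+ n.*2 + nrm (u - v) ^+ n.*2) <=
  2 ^+ n.*2 * (nrm u ^+ n.*2 + nrm v ^+ n.*2).
Proof.
have n0 : (0 < n)%N.
  by rewrite lt0n; apply/eqP => n0; move: p1; rewrite pn n0 ler10.
have powE (x : R) : 0 <= x -> x `^ p = x ^+ n.*2 by move=> x0; rewrite pn powR_mulrn.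
have pt (a b : R[i]) : 2 * (normc (a + b) `^ p + normc (a - b) `^ p) <=
    2 ^+ n.*2 * (normc a `^ p + normc b `^ p).
  rewrite !powE ?normc_ge0// -!mul2n !exprM.
  have -> : (2 : R) ^+ 2 ^+ n = 2 ^+ n * 2 ^+ n by rewrite -!exprM mul2n -addnn exprD.
  have sq : normc (a + b) ^+ 2 + normc (a - b) ^+ 2 = 2 * (normc a ^+ 2 + normc b ^+ 2).
    by rewrite !normc_sqr; case: a b => [a1 a2] [b1 b2] /=; ring.
  case: n n0 => // m _.
  apply: (@le_trans _ _ (2 * (normc (a + b) ^+ 2 + normc (a - b) ^+ 2) ^+ m.+1)).
    by rewrite ler_wpM2l// pow_sum_le// sqr_ge0.
  rewrite sq exprMn mulrCA -mulrA ler_wpM2l ?exprn_ge0//.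
  by rewrite pow_mean_le// sqr_ge0.
rewrite -[u]Lp_reprK -[v]Lp_reprK; set f := Lp_repr u; set g := Lp_repr v.
have -> : Lp_class f + Lp_class g = Lp_class (f + g) by rewrite Lp_classD.
have -> : Lp_class f - Lp_class g = Lp_class (f - g).
  by apply/eqP; rewrite subr_eq -Lp_classD subrK.
rewrite -!powE ?nrm_ge0// !nrm_class.
have ilin (r : R) (h k : cLfunType (haar R) p1) : (haar R).-integrable setT
    (EFin \o (fun z => r * (normc (val h z) `^ p + normc (val k z) `^ p))).
  exact: (integrableZl measurableT r (integrableD measurableT
    (cLfun_pow_integrable h) (cLfun_pow_integrable k))).
have lin (r : R) (h k : cLfunType (haar R) p1) :
    r * (\int[haar R]_z (normc (val h z) `^ p) + \int[haar R]_z (normc (val k z) `^ p)) =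
    \int[haar R]_z (r * (normc (val h z) `^ p + normc (val k z) `^ p)).
  have ih := cLfun_pow_integrable h; have ik := cLfun_pow_integrable k.
  rewrite RintegralZl//; last exact: (integrableD measurableT ih ik).
  by rewrite RintegralD.
rewrite !lin.
apply: le_Rintegral => //; [exact: ilin..|].
by move=> z _; rewrite (powE 2)//; exact: (pt (val f z) (val g z)).
Qed.

End clarkson.

(** * Averaging cutoffs separated by gaps *)

Section unconditional_cutoffs.
Variables (R : realType) (n : nat) (p : R) (p1 : 1 <= p).
Hypothesis pn : p = n.*2%:R.
Variables (P : int -> Prop) (E : set int) (S : set R[i]).
Hypotheses (P0 : ~ P 0) (JE : block_independent P E n).
Hypothesis Su : forall mu, S mu -> `|mu| = 1.
Hypothesis SP : forall mu s, S mu -> ~ P s -> mu ^ s = 1.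
Notation X := (Lp (haar R) p1).

(** Here t i lives on [-N i, N i], B i is the block bound belonging to N i, and t (i + 1) is 1 up to
    B i. Thus cutoff i + 1 of y and y minus its cutoff i + 2 are separated by a gap wide enough for
    the block identity. *)
Lemma gap_cutoffs (N0 : nat) (d : R) : 0 < d ->
  exists (N B : nat -> nat) (t : nat -> int -> R),
  (forall i, [/\ (N0 <= N i)%N, (N i <= B i)%N, (B i <= N i.+1)%N,
    forall k, (N i < `|k|)%N -> t i k = 0 &
    forall k, (`|k| <= B i)%N -> t i.+1 k = 1]) /\
  (forall i, [/\ forall k, (`|k| <= N0)%N -> t i k = 1,
    forall u : X, nrm (fmult (N i) (t i) u) <= (1 + d) * nrm u &
    forall (J : finType) (q : J -> int) (a b : J -> R[i]) (lam : R[i]), S lam ->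
      (forall i, a i + b i != 0 -> E (q i)) ->
      (forall l, a l != 0 -> (`|q l| <= N i)%N) ->
      (forall l, b l != 0 -> (B i < `|q l|)%N) ->
      nrm (\sum_i (a i + lam * b i) *: Lpe p1 (q i)) =
      nrm (\sum_i (a i + b i) *: Lpe p1 (q i))]).
Proof.
move=> d0.
have /choice[blk blkP] : forall m, exists B, (m <= B)%N /\
    forall (J : finType) (q : J -> int) (a b : J -> R[i]) (lam : R[i]), S lam ->
      (forall i, a i + b i != 0 -> E (q i)) ->
      (forall l, a l != 0 -> (`|q l| <= m)%N) ->
      (forall l, b l != 0 -> (B < `|q l|)%N) ->
      nrm (\sum_i (a i + lam * b i) *: Lpe p1 (q i)) =
      nrm (\sum_i (a i + b i) *: Lpe p1 (q i)).
  move=> m; have [B mB BP] := block_unconditional P0 JE p1 pn m.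
  exists B; split=> // J q a b lam Sl Eq qa qb; apply: BP => //; first exact: Su.
  by move=> s; exact: SP.
have /choice[cN /choice[ct cP]] : forall m, exists N, exists t : int -> R,
  [/\ (m <= N)%N, forall k, (`|k| <= m)%N -> t k = 1, forall k, (N < `|k|)%N -> t k = 0 &
    forall u : X, nrm (fmult N t u) <= (1 + d) * nrm u].
  by move=> m; have [N [t tP]] := cutoff p1 pn m d0; exists N, t.
pose M i := iter i (fun m => blk (cN m)) N0.
have N0M i : (N0 <= M i)%N.
  elim: i => //= i ih; apply: leq_trans ih _.
  by have [c1 _ _ _] := cP (M i); have [c2 _] := blkP (cN (M i)); exact: leq_trans c1 c2.
exists (fun i => cN (M i)), (fun i => M i.+1), (fun i => ct (M i)); split => i.
  have [c1 c2 c3 c4] := cP (M i); have [d1 d2 d3 d4] := cP (M i.+1).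
  split => //; first exact: leq_trans (N0M i) c1.
  by have [] := blkP (cN (M i)).
have [c1 c2 c3 c4] := cP (M i); split => //.
- by move=> k kN0; apply: c2; exact: leq_trans (N0M i).
- by have [] := blkP (cN (M i)).
Qed.

Lemma unconditional_cutoff_trig (N0 : nat) (e : R) : 0 < e ->
  exists N (t : int -> R),
  [/\ (N0 <= N)%N, forall k, (`|k| <= N0)%N -> t k = 1, forall k, (N < `|k|)%N -> t k = 0 &
    forall (J : finType) (c : J -> R[i]) (q : J -> int) (lam : R[i]),
      (forall i, c i != 0 -> E (q i)) -> S lam ->
      nrm (fmult N t (\sum_i c i *: Lpe p1 (q i)) + lam *:
        (\sum_i c i *: Lpe p1 (q i) - fmult N t (\sum_i c i *: Lpe p1 (q i)))) <=
      (1 + e) * nrm (\sum_i c i *: Lpe p1 (q i))].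
Proof.
(* Each averaged term will have norm at most Y + 2 |Q i|, and the mean of the |Q i| will be at most
   2 s Y; hence the factor 4. *)
move=> e0; pose s := e / 4; have s0 : 0 < s by rewrite divr_gt0.
have n0 : (0 < n)%N by rewrite lt0n; apply/eqP => n0; move: p1; rewrite pn n0 ler10.
pose m := n.*2; have mE : m = m.-1.+1 by rewrite prednK// /m double_gt0.
pose K := (Num.bound (4 * 2 ^+ m / s ^+ m)).+1.
have K0 : 0 < K%:R :> R by rewrite ltr0n.
have KP : 4 * 2 ^+ m <= K%:R * s ^+ m.
  rewrite -ler_pdivrMr ?exprn_gt0//; apply/ltW/(lt_trans (archi_boundP _)).
    by rewrite divr_ge0 ?mulr_ge0 ?exprn_ge0// ltW.
  by rewrite ltr_nat.
(* The excess [cc] - 1 of (1 + d)^m enters once per step, so it is kept below 1 / K. *)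
have [d d0 dP] := @pow_near1 R K%:R^-1 m (ltac:(by rewrite invr_gt0)).
have [N [B [t [tP1 tP2]]]] := gap_cutoffs N0 d0.
have NN i j : (i <= j)%N -> (N i <= N j)%N.
  move=> /subnK <-; elim: (j - i)%N => // k ih; apply: leq_trans ih _.
  by rewrite addSn; have [_ h1 h2 _ _] := tP1 (k + i)%N; exact: leq_trans h2.
have tt1 i k : (`|k| <= N i)%N -> t i.+1 k = 1.
  by have [_ h1 _ _ h3] := tP1 i; move=> kN; apply: h3; exact: leq_trans h1.
pose T k := K%:R^-1 * \sum_(i < K) t i.+1 k.
have TN k : (N K < `|k|)%N -> T k = 0.
  move=> kN; rewrite /T big1 ?mulr0// => i _.
  by have [_ _ _ h _] := tP1 i.+1; apply: h; apply: leq_ltn_trans kN; exact: NN.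
exists (N K), T; split => //.
- by have [] := tP1 K.
- move=> k kN0; rewrite /T; under eq_bigr => i _.
    have [-> // _ _] := tP2 i.+1.
  over.
  by rewrite sumr_const card_ord mulVf// gt_eqF.
move=> J c q lam Ec Sl; set y := \sum_i c i *: _; set Y := nrm y.
pose r i : X := fmult (N i) (t i) y.
have rE i : r i = \sum_l (c l * (t i (q l))%:C) *: Lpe p1 (q l).
  by rewrite /r /y fmult_trig//; have [] := tP1 i.
have rY i : nrm (r i) <= (1 + d) * Y by have [_ + _] := tP2 i; apply.
have rr i j : (i < j)%N -> fmult (N i) (t i) (r j) = r i.
  move=> ij; apply: fmult_fmult; first by rewrite NN// ltnW.
  case: j ij => // j; rewrite ltnS => ij k kN; apply: tt1.
  by rewrite (leq_trans kN)// NN.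
pose Q i := r i.+2 - r i.+1.
have rA i : r i.+1 + lam *: (y - r i.+2) = \sum_l
    (c l * (t i.+1 (q l))%:C + lam * (c l * (1 - t i.+2 (q l))%:C)) *: Lpe p1 (q l).
  rewrite !rE /y -sumrB scaler_sumr -big_split/=; apply: eq_bigr => l _.
  rewrite -scalerBl scalerA -scalerDl; congr (_ *: _).
  by rewrite [(1 - _)%:C]rmorphB rmorph1; ring.
(* The two summands are separated by a gap, so lam may be replaced by 1. *)
have gapE i : nrm (r i.+1 + lam *: (y - r i.+2)) = nrm (y - Q i).
  have [_ _ blk] := tP2 i.+1; have [_ _ _ tz t1] := tP1 i.+1.
  rewrite rA blk//; last 3 first.
  - by move=> l H; apply: Ec; apply: contraNneq H => ->; rewrite !mul0r addr0.
  - move=> l; rewrite leqNgt; apply: contraNN => /tz ->; by rewrite mulr0.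
  - move=> l; rewrite ltnNge; apply: contraNN => /t1 ->; by rewrite subrr mulr0.
  congr nrm; rewrite /Q !rE /y -!sumrB; apply: eq_bigr => l _.
  rewrite -!scalerBl; congr (_ *: _).
  by rewrite [(1 - _)%:C]rmorphB rmorph1; ring.
pose a i := nrm (r i) ^+ m; pose Z := Y ^+ m.
have Z0 : 0 <= Z by rewrite exprn_ge0// nrm_ge0.
pose cc := (1 + d) ^+ m.
have cc1 : 1 <= cc by rewrite exprn_ege1// lerDl ltW.
have aZ i : a i <= cc * Z.
  by rewrite /a /cc /Z -exprMn lerXn2r ?nnegrE ?nrm_ge0// mulr_ge0 ?nrm_ge0//; lra.
have a0 i : 0 <= a i by rewrite exprn_ge0// nrm_ge0.
pose A : R := 2 ^+ m / 2; have A0 : 0 <= A by rewrite divr_ge0// exprn_ge0.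
(* Cutoff i maps both r (i + 1) and r (i + 2) to r i, which bounds the norm of their sum from below
   by nearly 2 |r i|. Clarkson's inequality then leaves a combination of the a i that telescopes. *)
have stepQ i : nrm (Q i) ^+ m <= A * (a i.+2 + a i.+1 - 2 * a i) + 2 * A * ((cc - 1) * Z).
  have := clarkson pn (r i.+2) (r i.+1); rewrite -/m -/(Q i) -/(a i.+2) -/(a i.+1).
  set W := nrm (_ + _) ^+ m => clk.
  have ccW : 2 ^+ m * a i <= cc * W.
    rewrite /a /W -!exprMn; have [_ bnd _] := tP2 i.
    have := bnd (r i.+2 + r i.+1); rewrite fmultD !rr//.
    have -> : nrm (r i + r i) = 2 * nrm (r i).
      by rewrite -mulr2n -scaler_nat nrmZ -(rmorph_nat (real_complex R)) normc_real ger0_norm.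
    move=> H; rewrite lerXn2r ?nnegrE ?mulr_ge0 ?nrm_ge0//; lra.
  have WA : 2 ^+ m * (a i - (cc - 1) * Z) <= W.
    have cc0 : 0 < cc by lra.
    rewrite -(ler_pM2l cc0); apply: le_trans ccW.
    rewrite mulrCA ler_wpM2l ?exprn_ge0//.
    have := ler_wpM2l (_ : 0 <= cc - 1) (aZ i).
    rewrite subr_ge0 => /(_ cc1); lra.
  have e2 : (2 : R) ^+ m = 2 * A by rewrite /A mulrC divfK.
  move: clk WA; rewrite e2; lra.
have teles k : \sum_(i < k) nrm (Q i) ^+ m <=
    A * (a k.+1 + 2 * a k - a 1%N - 2 * a 0%N) + k%:R * (2 * A * ((cc - 1) * Z)).
  elim: k => [|k ih]; first by rewrite big_ord0; lra.
  rewrite big_ord_recr/= -natr1; have := stepQ k; lra.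
have ccK : (cc - 1) * K%:R <= 1 by rewrite -ler_pdivlMr// mul1r; rewrite /cc; lra.
have K1 : K%:R^-1 <= 1 :> R by rewrite invf_le1// ler1n.
have sumQ : \sum_(i < K) nrm (Q i) ^+ m <= 4 * 2 ^+ m * Z.
  apply: le_trans (teles K) _.
  have e2 : (2 : R) ^+ m = 2 * A by rewrite /A mulrC divfK.
  have h1 : a K.+1 + 2 * a K - a 1%N - 2 * a 0%N <= 6 * Z.
    have c2 : cc * Z <= 2 * Z by rewrite ler_wpM2r// /cc; lra.
    have := aZ K.+1; have := aZ K; have := a0 1%N; have := a0 0%N; lra.
  have h2 : K%:R * ((cc - 1) * Z) <= Z.
    by rewrite mulrA [K%:R * _]mulrC ler_piMl.
  have := ler_wpM2l A0 h1; have := ler_wpM2l A0 h2; rewrite e2; lra.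
have TE : fmult (N K) T y = K%:R^-1%:C *: \sum_(i < K) r i.+1.
  rewrite /y fmult_trig//; under [in RHS]eq_bigr do rewrite rE.
  rewrite exchange_big scaler_sumr/=; apply: eq_bigr => l _.
  rewrite -scaler_suml scalerA; congr (_ *: _).
  by rewrite -mulr_sumr mulrCA /T -rmorph_sum -rmorphM.
have [Y0|Yn0] := eqVneq Y 0.
  have y0 : y = 0 by exact: nrm0_eq0.
  by rewrite Y0 mulr0 y0 fmult0 subrr scaler0 addr0 nrm0.
have Y0 : 0 < Y by rewrite lt_def Yn0 nrm_ge0.
have sY : 0 < s * Y by rewrite mulr_gt0.
(* Young's inequality at level s Y: the first terms add up to K s Y, and the choice of K bounds the
   rest by the same amount. *)
have sumQ1 : \sum_(i < K) nrm (Q i) <= K%:R * (2 * (s * Y)).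
  have young i : nrm (Q i) <= s * Y + nrm (Q i) ^+ m / (s * Y) ^+ m.-1.
    by rewrite {1}mE; apply: pow_young => //; exact: nrm_ge0.
  apply: (@le_trans _ _ (\sum_(i < K) (s * Y + nrm (Q i) ^+ m / (s * Y) ^+ m.-1))).
    by apply: ler_sum => i _.
  rewrite big_split/= sumr_const card_ord -mulr_suml -[X in X + _]mulr_natl.
  rewrite (_ : K%:R * (2 * _) = K%:R * (s * Y) + K%:R * (s * Y)); last by ring.
  rewrite lerD2l ler_pdivrMr ?exprn_gt0//; apply: le_trans sumQ _.
  rewrite -[leRHS]mulrA -exprS -mE exprMn mulrA -/Z.
  by rewrite ler_wpM2r.
have main : fmult (N K) T y + lam *: (y - fmult (N K) T y) =
    K%:R^-1%:C *: \sum_(i < K) ((r i.+1 + lam *: (y - r i.+2)) + lam *: Q i).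
  have yE : y = K%:R^-1%:C *: \sum_(i < K) y.
    rewrite sumr_const card_ord -[y *+ K]scaler_nat scalerA -(rmorph_nat (real_complex R)) -rmorphM.
    by rewrite mulVf ?gt_eqF// rmorph1 scale1r.
  rewrite TE {1}yE -scalerBr -sumrB scalerA mulrC -scalerA -scalerDr scaler_sumr -big_split/=.
  congr (_ *: _); apply: eq_bigr => i _; rewrite -addrA; congr (_ + _).
  by rewrite -scalerDr; congr (_ *: _); rewrite /Q addrA subrK.
rewrite main nrmZ normc_real ger0_norm ?invr_ge0// ler_pdivrMl//.
apply: le_trans (nrm_sum _ _ _) _.
apply: (@le_trans _ _ (\sum_(i < K) (Y + 2 * nrm (Q i)))).
  apply: ler_sum => i _; apply: le_trans (nrmD _ _) _; rewrite gapE nrmZ.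
  have -> : normc lam = 1 by apply: complexI; rewrite -norm_normc Su.
  have := nrmB y (Q i); rewrite -/Y; lra.
rewrite big_split/= sumr_const card_ord -mulr_sumr -[X in X + _]mulr_natl.
have -> : K%:R * ((1 + e) * Y) = K%:R * Y + 2 * (K%:R * (2 * (s * Y))).
  by rewrite /s; field.
by rewrite lerD2l ler_wpM2l.
Qed.

End unconditional_cutoffs.

(** * Sufficiency *)

Section mult_op.
Variables (R : realType) (p : R) (p1 : 1 <= p) (E : set int).
Notation Y := (LpE p1 E).

Definition mult_op (N : nat) (t : int -> R) (y : Y) : Y :=
  exist (fun u : Lp (haar R) p1 => u \in spectrum_in E) _ (fmult_spectrum N t (valP y)).

Lemma val_mult_op N t y : val (mult_op N t y) = fmult N t (val y).
Proof. by []. Qed.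

Lemma mult_op_linear N t : linear (mult_op N t).
Proof. by move=> c u v; apply: val_inj; rewrite /= fmultP. Qed.

HB.instance Definition _ N t :=
  GRing.isLinear.Build R[i] Y Y _ (mult_op N t) (mult_op_linear N t).

Lemma mult_op_finite_rank N t : finite_rank (mult_op N t).
Proof.
exists N.*2.+1, (fun i => LpEe p1 E (win i)) => y.
exists (fun i => (t (win i))%:C * Lpcoef (val y) (win i)); apply: val_inj.
rewrite val_mult_op val_LpE_sum; apply: eq_bigr => i _.
rewrite -[RHS]/(_ *: val (LpEe p1 E (win i))).
have [Ei|Ei] := pselect (E (win i)); first by rewrite val_LpEe.
by have /asboolP/(_ _ Ei) := valP y; rewrite -[LHS]/(Lpcoef _ _) => ->; rewrite mulr0 !scale0r.
Qed.

End mult_op.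

Section sufficiency.
Variables (R : realType) (n : nat) (p : R) (p1 : 1 <= p).
Hypothesis pn : p = n.*2%:R.
Variables (P : int -> Prop) (E : set int) (S : set R[i]).
Hypotheses (P0 : ~ P 0) (JE : block_independent P E n).
Hypotheses (S1 : S 1) (SN1 : S (-1)) (Su : forall mu, S mu -> `|mu| = 1).
Hypothesis Sdiv : forall mu nu, S mu -> S nu -> S (mu / nu).
Hypothesis SP : forall mu s, S mu -> ~ P s -> mu ^ s = 1.
Notation X := (Lp (haar R) p1).
Notation Y := (LpE p1 E).

(** The cutoff is fixed first; its operator bound C then tells how well u has to be approximated by
    a polynomial with spectrum in E. *)
Lemma unconditional_cutoff (N0 : nat) (e : R) : 0 < e ->
  exists N (t : int -> R),
  [/\ (N0 <= N)%N, forall k, (`|k| <= N0)%N -> t k = 1, forall k, (N < `|k|)%N -> t k = 0 &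
    forall (u : X) (lam : R[i]), u \in spectrum_in E -> S lam ->
      nrm (fmult N t u + lam *: (u - fmult N t u)) <= (1 + e) * nrm u].
Proof.
move=> e0; have [N [t [t1 t2 t3 t4]]] := unconditional_cutoff_trig p1 pn P0 JE Su SP N0 e0.
exists N, t; split => // u lam uE Sl.
have laml : normc lam = 1 by apply: complexI; rewrite -norm_normc Su.
apply/ler_addgt0Pr => h h0.
pose C := 4 * (\sum_(i < N.*2.+1) `|t (win i)|).
have C0 : 0 <= C by rewrite mulr_ge0// sumr_ge0.
have D0 : 0 < 2 * C + 1 + (1 + e) by lra.
have [N' [t' uv]] := spectrum_dense pn uE (divr_gt0 h0 D0).
set v := fmult N' t' u in uv.
have Av : nrm (fmult N t v + lam *: (v - fmult N t v)) <= (1 + e) * nrm v.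
  apply: (t4 _ (fun i => (t' (win i))%:C * Lpcoef u (win i)) (@win N')) => // i.
  have [//|Ei] := pselect (E (win i)).
  have /asboolP/(_ _ Ei) := uE; rewrite -[LHS]/(Lpcoef _ _) => ->.
  by rewrite mulr0 eqxx.
set w := u - v in uv.
have Aw : nrm (fmult N t w + lam *: (w - fmult N t w)) <= (2 * C + 1) * nrm w.
  have H1 := fmult_bound N t w; rewrite -/C in H1.
  apply: le_trans (nrmD _ _) _; rewrite nrmZ laml mul1r.
  move: H1 (nrmB w (fmult N t w)); move: (nrm w) (nrm (fmult N t w)) (nrm (_ - _)) => *; lra.
have PhiD (x y : X) : fmult N t (x + y) + lam *: ((x + y) - fmult N t (x + y)) =
    (fmult N t x + lam *: (x - fmult N t x)) + (fmult N t y + lam *: (y - fmult N t y)).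
  by rewrite fmultD opprD [x + y + _]addrACA scalerDr [LHS]addrACA.
have uvw : u = v + w by rewrite [v + _]addrC subrK.
have -> := etrans (congr1 (fun x => fmult N t x + lam *: (x - fmult N t x)) uvw) (PhiD v w).
apply: le_trans (nrmD _ _) _.
have nv : nrm v <= nrm u + nrm w by have := nrmB u w; rewrite /w opprB addrC subrK.
have e1 : 0 <= 1 + e by rewrite addr_ge0// ltW.
have H := ler_wpM2l e1 nv.
have {}uv : (2 * C + 1 + (1 + e)) * nrm w <= h by rewrite -ler_pdivlMl// mulrC.
apply: le_trans (lerD Av Aw) _; apply: le_trans (lerD H (lexx _)) _.
by rewrite mulrDr -addrA lerD2l -mulrDl [1 + e + _]addrC.
Qed.

(** With lam = -1, twice the cutoff of u is u plus its image under 2 T - 1. *)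
Lemma cutoff_contraction N t (d : R) (u : X) :
  (forall lam : R[i], S lam -> nrm (fmult N t u + lam *: (u - fmult N t u)) <= (1 + d) * nrm u) ->
  0 < d -> nrm (fmult N t u) <= (1 + d) * nrm u.
Proof.
move=> H d0; have := H _ SN1; set T := fmult N t u => HT.
have : nrm (2 *: T) <= nrm u + (1 + d) * nrm u.
  have -> : 2 *: T = u + (T + -1 *: (u - T)).
    by rewrite scaleN1r opprB addrC -addrA subrK scaler_nat mulr2n.
  by apply: le_trans (nrmD _ _) _; rewrite lerD2l.
rewrite nrmZ -(rmorph_nat (real_complex R)) normc_real ger0_norm//.
have := mulr_ge0 (ltW d0) (nrm_ge0 u); lra.
Qed.

Lemma block_independent_umap : umap Y S.
Proof.
move=> eps; case: eps => e e'; rewrite ltcE/= => /andP[/eqP -> e0]; rewrite -/(e%:C).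
(* Factor k of the product may have norm q (k + 1) / q k, so that the first k factors together cost
   q k < 1 + e. *)
pose q k : R := 1 + e * (1 - 2^-1 ^+ k).
have h01 k : 0 < (2^-1 : R) ^+ k <= 1.
  by rewrite exprn_gt0 ?invr_gt0//= exprn_ile1// ?invr_ge0// invf_le1 ?ler1n.
have q1 k : 1 <= q k <= 1 + e.
  have /andP[a1 a2] := h01 k; rewrite lerDl mulr_ge0 ?(ltW e0) ?subr_ge0//=.
  by rewrite lerD2l ler_piMr ?(ltW e0)// gerBl ltW.
have q0 k : 0 < q k by have /andP[] := q1 k; lra.
have qS k : q k < q k.+1.
  rewrite ltrD2l ltr_pM2l// ltrD2l ltrN2 exprS gtr_pMl; last by have /andP[] := h01 k.
  by rewrite invf_lt1 ?ltr1n.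
pose d k := q k.+1 / q k - 1.
have d0 k : 0 < d k by rewrite subr_gt0 ltr_pdivlMr// mul1r.
have dq k : 1 + d k = q k.+1 / q k by rewrite /d addrC subrK.
have /choice[cN /choice[ct cP]] : forall m : nat * nat, exists N, exists t : int -> R,
    [/\ (m.1 <= N)%N, forall k, (`|k| <= m.1)%N -> t k = 1, forall k, (N < `|k|)%N -> t k = 0 &
    forall (u : X) (lam : R[i]), u \in spectrum_in E -> S lam ->
      nrm (fmult N t u + lam *: (u - fmult N t u)) <= (1 + d m.2) * nrm u].
  by move=> m; have [N [t tP]] := unconditional_cutoff m.1 (d0 m.2); exists N, t.
(* The threshold s (k + 1) is at least N k, which makes the cutoffs nested, and at least k + 1,
   which makes them converge to the identity. *)
pose s := fix s k := if k is k'.+1 then maxn (cN (s k', k')) k else 0%N.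
pose N k := cN (s k, k); pose t k := ct (s k, k).
have NP k : [/\ (s k <= N k)%N, forall j, (`|j| <= s k)%N -> t k j = 1,
    forall j, (N k < `|j|)%N -> t k j = 0 &
    forall (u : X) (lam : R[i]), u \in spectrum_in E -> S lam ->
      nrm (fmult (N k) (t k) u + lam *: (u - fmult (N k) (t k) u)) <= (1 + d k) * nrm u].
  exact: cP (s k, k).
have Ns k : (N k <= s k.+1)%N by exact: leq_maxl.
have ks k : (k <= s k)%N by case: k => // k; exact: leq_maxr.
have smono i j : (i <= j)%N -> (s i <= s j)%N.
  move=> /subnK <-; elim: (j - i)%N => // k ih; apply: leq_trans ih _; rewrite addSn.
  by have [h _ _ _] := NP (k + i)%N; exact: leq_trans h (Ns _).
pose T k : {linear Y -> Y} := if k is k'.+1 then @mult_op R p p1 E (N k') (t k') else @mult_op R p p1 E 0 (fun=> 0).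
have T0 y : T 0%N y = 0.
  apply: val_inj; rewrite val_mult_op /fmult big1// => i _.
  by rewrite rmorph0 mul0r scale0r.
have TT i j y : (i < j)%N -> T i (T j y) = T i y.
  case: i => [|i]; first by rewrite !T0.
  case: j => // j ij; apply: val_inj; rewrite !val_mult_op.
  have [sN t1 _ _] := NP j.
  apply: fmult_fmult => [|k kN]; last by apply: t1; rewrite (leq_trans kN)// (leq_trans (Ns i))// smono.
  by rewrite (leq_trans (Ns i))// (leq_trans _ sN)// smono.
have TA k y lam : S lam -> nrm (T k.+1 y + lam *: (y - T k.+1 y)) <= (1 + d k) * nrm y.
  by move=> Sl; have [_ _ _ H] := NP k; exact: H (valP y) Sl.
have Tc k y : nrm (T k.+1 y) <= (1 + d k) * nrm y.
  by apply: cutoff_contraction (d0 k) => lam Sl; have [_ _ _ H] := NP k; exact: H (valP y) Sl.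
have de k : 1 + d k <= 1 + e.
  rewrite dq ler_pdivrMr//; have /andP[h1 _] := q1 k; have /andP[_ h2] := q1 k.+1.
  by apply: le_trans h2 _; rewrite ler_peMr//; lra.
exists T; split => //.
- case=> // k _; split; last exact: mult_op_finite_rank.
  exists (1 + d k)%:C => y; rewrite !normE -rmorphM lecR; exact: Tc.
- move=> y; apply/cvg_nrm => h h0.
  have D0 : 0 < 2 * (2 + e) by lra.
  have [N' [t' yv]] := spectrum_dense pn (valP y) (divr_gt0 h0 D0).
  pose v := @mult_op R p p1 E N' t' y.
  have {}yv : nrm (y - v) <= h / (2 * (2 + e)) by [].
  exists N'.+1 => -[//|k]; rewrite ltnS => N'k.
  have Tv : T k.+1 v = v.
    have [sN t1 tz _] := NP k; apply: val_inj; rewrite !val_mult_op [X in fmult _ _ X]/fmult fmult_trig//.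
    apply: eq_bigr => i _; rewrite t1 ?mulr1//.
    by rewrite (leq_trans (win_le i))// (leq_trans N'k).
  have -> : y - T k.+1 y = (y - v) - T k.+1 (y - v).
    by rewrite linearB/= Tv opprB addrA subrK.
  apply: le_lt_trans (nrmB _ _) _.
  have := Tc k (y - v); have := ler_wpM2r (nrm_ge0 (y - v)) (de k).
  have : (2 + e) * nrm (y - v) <= h / 2.
    have e2 : 0 < 2 + e by lra.
    rewrite -ler_pdivlMl// (le_trans yv)// le_eqVlt; apply/orP; left; apply/eqP; field.
    by rewrite gt_eqF.
  lra.
move=> m f Sf.
(* The tail with coefficient f (k + 1) completes the partial sum to a unimodular multiple of a
   product of operators. Raising k by 1 amounts to evaluating at T (k + 1) y + mu (y - T (k + 1) y)
   with mu = f (k + 2) / f (k + 1). *)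
have X_bound k y : nrm (\sum_(1 <= i < k.+1) f i *: (T i y - T i.-1 y) + f k.+1 *: (y - T k y)) <=
    q k * nrm y.
  elim: k y => [|k ih] y.
    rewrite big_geq// add0r T0 subr0 nrmZ (_ : normc (f 1%N) = 1).
      by rewrite /q expr0 subrr mulr0 addr0.
    by apply: complexI; rewrite -norm_normc Su.
  have fk0 : f k.+1 != 0 by rewrite -normr_eq0 Su ?oner_neq0.
  pose mu := f k.+2 / f k.+1; have Smu : S mu by exact: Sdiv.
  pose Ay := T k.+1 y + mu *: (y - T k.+1 y).
  have TAy i : (i < k.+1)%N -> T i Ay = T i y.
    by move=> ik; rewrite /Ay linearD linearZ_LR linearB !TT// subrr scaler0 addr0.
  have -> : \sum_(1 <= i < k.+2) f i *: (T i y - T i.-1 y) + f k.+2 *: (y - T k.+1 y) =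
      \sum_(1 <= i < k.+1) f i *: (T i Ay - T i.-1 Ay) + f k.+1 *: (Ay - T k Ay).
    rewrite big_nat_recr//= -addrA; congr (_ + _).
      apply: eq_big_nat => i /andP[i0 ik]; rewrite !TAy//.
      by rewrite (leq_ltn_trans (leq_pred i)).
    rewrite TAy// /Ay [in RHS]addrAC [in RHS]scalerDr; congr (_ + _).
    by rewrite scalerA /mu mulrC divfK.
  apply: le_trans (ih Ay) _.
  have := TA k y mu Smu; rewrite -/Ay dq => H.
  apply: le_trans (ler_wpM2l (ltW (q0 k)) H) _.
  by rewrite mulrA mulrCA mulfV ?mulr1// gt_eqF.
move=> y; rewrite !normE -(rmorph1 (real_complex R)) -rmorphD -rmorphM lecR.
case: m => [|m]; first by rewrite big_geq// nrm0 mulr_ge0 ?nrm_ge0//; lra.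
(* Since T m+1 absorbs into the smaller cutoffs, the sum is the completed expression at T (m + 1) y,
   which costs one more factor 1 + d m. *)
have -> : \sum_(1 <= k < m.+2) f k *: (T k y - T k.-1 y) =
    \sum_(1 <= i < m.+1) f i *: (T i (T m.+1 y) - T i.-1 (T m.+1 y)) +
    f m.+1 *: (T m.+1 y - T m (T m.+1 y)).
  rewrite big_nat_recr//; congr (_ + _); last by rewrite TT.
  apply: eq_big_nat => i /andP[i0 im]; rewrite !TT//.
  by rewrite (leq_ltn_trans (leq_pred i)).
apply: le_trans (X_bound m _) _.
apply: le_trans (ler_wpM2l (ltW (q0 m)) (Tc m y)) _.
rewrite dq mulrA mulrCA mulfV ?mulr1 ?gt_eqF// ler_wpM2r ?nrm_ge0//.
by have /andP[] := q1 m.+1.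
Qed.

End sufficiency.

Section instances.
Variable R : realType.
Implicit Types (mu nu : R[i]) (s : int).

(** An |s|-th root of -1 has s-th power -1. *)
Lemma unit_circle_separates s : s != 0 -> exists2 mu : R[i], `|mu| = 1 & mu ^ s != 1.
Proof.
move=> s0; have k0 : (0 < `|s|)%N by rewrite absz_gt0.
pose mu : R[i] := `|s|.-root (-1).
have muX : mu ^+ `|s| = -1 by rewrite rootCK.
have m1 : -1 != 1 :> R[i] by rewrite -subr_eq0 -opprD oppr_eq0 (pnatr_eq0 _ 2).
exists mu.
  apply/eqP; rewrite -(pexpr_eq1 (n := `|s|))// -normrX muX normrN normr1 eqxx//.
case: (s) muX => k /= muX; first by rewrite -exprnP muX.
by rewrite NegzE -exprnN muX invrN invr1.
Qed.

Lemma sign_separates s : odd `|s|%N -> (-1 : R[i]) ^ s != 1.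
Proof.
have m1 : -1 != 1 :> R[i] by rewrite -subr_eq0 -opprD oppr_eq0 (pnatr_eq0 _ 2).
case: s => k ok; first by rewrite -exprnP -signr_odd ok.
by rewrite NegzE -exprnN -signr_odd ok invrN invr1.
Qed.

Lemma sign_even mu s : [set 1; -1] mu -> ~ odd `|s|%N -> mu ^ s = 1.
Proof.
move=> mu1 /negP ek; have muk k : ~~ odd k -> mu ^+ k = 1.
  by move=> /negbTE ok; case: mu1 => ->; rewrite ?expr1n// -signr_odd ok.
case: s ek => k ek; first by rewrite -exprnP muk.
by rewrite NegzE -exprnN muk// invr1.
Qed.

End instances.

Theorem theorem8p2p1 (R : realType) (p : R) (p1 : 1 <= p) (E : set int) :
  (forall n : nat, p = n.*2%:R ->
     (complex_umap (LpE p1 E) <-> complex_J E n) /\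
     (real_umap (LpE p1 E) <-> real_J E n)) /\
  ((forall n : nat, p <> n.*2%:R) ->
     (complex_umap (LpE p1 E) -> complex_Joo E) /\
     (real_umap (LpE p1 E) -> real_Joo E)).
Proof.
have two0 : 2 != 0 :> R by rewrite pnatr_eq0.
have complex_nec n : (forall k, (k <= n)%N -> gbin (p / 2) k != 0) ->
    complex_umap (LpE p1 E) -> complex_J E n.
  move=> g0; apply: umap_block_independent => //=.
  - exact: normr1.
  - by move=> mu mu1; rewrite normfV mu1 invr1.
  - exact: unit_circle_separates.
have real_nec n : (forall k, (k <= n)%N -> gbin (p / 2) k != 0) ->
    real_umap (LpE p1 E) -> real_J E n.
  move=> g0; apply: umap_block_independent => //=.
  - by left.
  - by move=> mu [] ->; rewrite ?normrN normr1.
  - by move=> mu [] ->; [left|right]; rewrite ?invrN invr1.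
  - by move=> s /sign_separates; exists (-1) => //; right.
split=> [n pn|pn].
  have p2 : p / 2 = n%:R by rewrite pn -muln2 natrM mulfK.
  (* The binomial coefficient of n over k vanishes only for k > n; this ties p = 2n to block
     independence of order n. *)
  have g0 k : (k <= n)%N -> gbin (p / 2) k != 0.
    move=> kn; apply: gbin_neq0 => i ik; rewrite p2 eqr_nat gtn_eqF//.
    exact: leq_trans kn.
  split; (split; first by [exact: complex_nec|exact: real_nec]) => JE.
    apply: (block_independent_umap p1 pn _ JE) => //=.
    - by rewrite normrN normr1.
    - by move=> mu nu mu1 nu1; rewrite normf_div mu1 nu1 divr1.
    - by move=> mu s _ /negP; rewrite negbK => /eqP ->; rewrite expr0z.
  apply: (block_independent_umap p1 pn _ JE) => //=.
  - by right.
  - by move=> mu [] ->; rewrite ?normrN normr1.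
  - move=> mu nu [] -> [] ->; rewrite ?invrN ?invr1 ?mulrN1 ?mulr1 ?opprK; by [left|right].
  - by move=> mu s; exact: sign_even.
(* Now p / 2 is not a natural number, no coefficient vanishes, and every order n is reached. *)
have g0 n k : (k <= n)%N -> gbin (p / 2) k != 0.
  move=> _; apply: gbin_neq0 => i _; apply/eqP => pi; apply: (pn i).
  by rewrite -muln2 natrM -pi divfK.
by split=> U n _; [exact: complex_nec n (g0 n) U|exact: real_nec n (g0 n) U].
Qed.
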